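(* Let $\alpha\ge\beta\ge-\frac12$ with $\alpha>-\frac12$, and let $\delta>0$. The Opdam–Cherednik transform of the functions $\{H_n^\delta\}_{n\in\mathbb{N}}$ is given by $$\mathcal{F}(H_{2n}^\delta)(\lambda)=\frac{(-1)^n}{n!}\,\frac{\Gamma(\alpha+1)\,\Gamma\bigl(\frac{\delta+1+i\lambda}2\bigr)\Gamma\bigl(\frac{\delta+1-i\lambda}2\bigr)}{\Gamma\bigl(\frac{\alpha+\beta+\delta}2+n+1\bigr)\,\Gamma\bigl(\frac{\alpha-\beta+\delta}2+n+1\bigr)}\;P_n\Bigl(-\frac{\lambda^2}4;\frac{\delta+1}2,\frac{\delta+1}2,\frac{\alpha+\beta+1}2,\frac{\alpha-\beta+1}2\Bigr)$$ and $$\mathcal{F}(H_{2n+1}^\delta)(\lambda)=\frac{(-1)^n}{n!}\,\frac{(\rho+i\lambda)\,\Gamma(\alpha+1)\,\Gamma\bigl(\frac{\delta+1+i\lambda}2\bigr)\Gamma\bigl(\frac{\delta+1-i\lambda}2\bigr)}{2\,\Gamma\bigl(\frac{\alpha+\beta+\delta}2+n+2\bigr)\,\Gamma\bigl(\frac{\alpha-\beta+\delta}2+n+1\bigr)}\;P_n\Bigl(-\frac{\lambda^2}4;\frac{\delta+1}2,\frac{\delta-1}2,\frac{\alpha+\beta+3}2,\frac{\alpha-\beta+1}2\Bigr),$$ where $P_n(t^2;a,b,c,d)$ denotes the Wilson polynomials.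
   Context: Set $\rho=\alpha+\beta+1$, $A_{\alpha,\beta}(z)=(\sinh z)^{2\alpha+1}(\cosh z)^{2\beta+1}$ for $z\ge0$, $\varphi_\lambda^{(\alpha,\beta)}(x)={}_2F_1\bigl(\frac{\rho+i\lambda}2,\frac{\rho-i\lambda}2;\alpha+1;-\sinh^2x\bigr)$, and $$G_\lambda^{(\alpha,\beta)}(x)=\varphi_\lambda^{(\alpha,\beta)}(x)+\frac{\rho+i\lambda}{4(\alpha+1)}\sinh(2x)\,\varphi_\lambda^{(\alpha+1,\beta+1)}(x).$$ The Opdam–Cherednik transform is $\mathcal{F}(f)(\lambda)=\int_{\mathbb{R}}f(x)\,G_\lambda^{(\alpha,\beta)}(-x)\,A_{\alpha,\beta}(|x|)\,dx$. Jacobi polynomials: $P_n^{(a,b)}(z)=\frac{(a+1)_n}{n!}\,{}_2F_1\bigl(-n,a+b+n+1;a+1;\frac{1-z}2\bigr)$, where $(a)_n=a(a+1)\cdots(a+n-1)$. The functions $H_n^\delta$ on $\mathbb{R}$, $n\in\mathbb{N}=\{0,1,2,\dots\}$, are $$H_{2n}^\delta(x)=(\cosh x)^{-\alpha-\beta-\delta-2}\,P_n^{(\alpha,\delta)}(1-2\tanh^2x),\qquad H_{2n+1}^\delta(x)=(\cosh x)^{-\alpha-\beta-\delta-2}\,P_n^{(\alpha+1,\delta-1)}(1-2\tanh^2x)\,\tanh x.$$ Wilson polynomials (polynomials in $t^2$): $$P_n(t^2;a,b,c,d)=(a+b)_n(a+c)_n(a+d)_n\;{}_4F_3\Bigl(\begin{matrix}-n,\;a+b+c+d+n-1,\;a+t,\;a-t\\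 a+b,\;a+c,\;a+d\end{matrix};1\Bigr).$$
   Formalization: The sign of the formula for F(H_{2n+1}) is corrected from (-1)^n to (-1)^{n+1}: as printed it fails at n=0, λ=0, where the transform is negative and the right side positive. λ ranges over complex numbers with |Im λ|<δ+1, where the integral converges absolutely. *)

(* Defs.v *)
From mathcomp Require Import all_boot all_order all_algebra.
From mathcomp Require Import all_classical all_reals all_analysis.
From mathcomp Require Export complex.

Set Implicit Arguments.
Unset Strict Implicit.
Unset Printing Implicit Defensive.

Import Order.TTheory GRing.Theory Num.Theory.
Import numFieldNormedType.Exports.

Local Open Scope classical_set_scope.
Local Open Scope ring_scope.
Local Open Scope complex_scope.

Definition poch (K : numFieldType) (a : K) (n : nat) : K :=
  \prod_(i < n) (a + i%:R).

(* It terminates when a numerator parameter is a nonpositive integer. *)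
Definition pFq_term (K : numFieldType) (num den : seq K) (z : K) (k : nat) : K :=
  (\prod_(a <- num) poch a k) / (\prod_(b <- den) poch b k)
    * z ^+ k / (k`!)%:R.

Definition pFq (K : numFieldType) (num den : seq K) (z : K) : K :=
  limn (series (pFq_term num den z)).

Definition is_sum (K : numFieldType) (u : nat -> K) (s : K) : Prop :=
  series u @ \oo --> s.

Definition real_analytic_at (R : realType) (f : R -> R[i]) (x0 : R) : Prop :=
  exists c : nat -> R[i], exists2 r : R, 0 < r &
    forall x : R, `|x - x0| < r ->
      is_sum (fun k => c k * ((x - x0)%:C) ^+ k) (f x).

(* The Gauss series converges only on the unit disc, whereas the argument
   - sinh^2 x ranges over the whole half-line ]-oo, 0].  Hence 2F1 is taken to
   be the analytic continuation of the series, which on the real line below 1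
   exists and is unique as soon as c is not a nonpositive integer. *)
Definition is_gauss2F1 (R : realType) (a b c : R[i]) (F : R -> R[i]) : Prop :=
  (forall x : R, `|x| < 1 -> F x = pFq [:: a; b] [:: c] x%:C) /\
  (forall x : R, x < 1 -> real_analytic_at F x).

Definition gauss2F1 (R : realType) (a b c : R[i]) : R -> R[i] :=
  xget (fun=> 0) [set F | is_gauss2F1 a b c F].

Definition Cintegrable (R : realType) (D : set R) (f : R -> R[i]) : Prop :=
  (@lebesgue_measure R).-integrable D (fun x => (complex.Re (f x))%:E) /\
  (@lebesgue_measure R).-integrable D (fun x => (complex.Im (f x))%:E).

Definition Cintegral (R : realType) (D : set R) (f : R -> R[i]) : R[i] :=
  (\int[@lebesgue_measure R]_(x in D) complex.Re (f x)) +i*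
  (\int[@lebesgue_measure R]_(x in D) complex.Im (f x)).

(* t ^ z = exp (z * ln t), meaningful for t > 0 only. *)
Definition cpowR (R : realType) (t : R) (z : R[i]) : R[i] :=
  (t `^ complex.Re z)%:C *
  (cos (complex.Im z * ln t) +i* sin (complex.Im z * ln t)).

(* Euler's integral, meaningful for Re z > 0 only. *)
Definition Gamma (R : realType) (z : R[i]) : R[i] :=
  Cintegral `]0, +oo[ (fun t : R => cpowR t (z - 1) * (expR (- t))%:C).

Definition sinh (R : realType) (x : R) : R := (expR x - expR (- x)) / 2.
Definition cosh (R : realType) (x : R) : R := (expR x + expR (- x)) / 2.
Definition tanh (R : realType) (x : R) : R := sinh x / cosh x.

Definition rho (R : realType) (alpha beta : R) : R := alpha + beta + 1.

Definition Aweight (R : realType) (alpha beta z : R) : R :=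
  sinh z `^ (2 * alpha + 1) * cosh z `^ (2 * beta + 1).

Definition jacobi_fun (R : realType) (alpha beta : R) (lam : R[i]) (x : R)
    : R[i] :=
  gauss2F1 (((rho alpha beta)%:C + 'i * lam) / 2)
           (((rho alpha beta)%:C - 'i * lam) / 2)
           (alpha + 1)%:C (- sinh x ^+ 2).

Definition opdam_fun (R : realType) (alpha beta : R) (lam : R[i]) (x : R)
    : R[i] :=
  jacobi_fun alpha beta lam x +
  ((rho alpha beta)%:C + 'i * lam) / (4 * (alpha + 1))%:C *
    (sinh (2 * x))%:C * jacobi_fun (alpha + 1) (beta + 1) lam x.

(* The kernel is G_lam(- x): for odd f only the odd part of G_lam contributes,
   and it does so with a minus sign. *)
Definition OC_integrand (R : realType) (alpha beta : R) (f : R -> R)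
    (lam : R[i]) (x : R) : R[i] :=
  (f x)%:C * opdam_fun alpha beta lam (- x) * (Aweight alpha beta `|x|)%:C.

Definition OC_transform (R : realType) (alpha beta : R) (f : R -> R)
    (lam : R[i]) : R[i] :=
  Cintegral setT (OC_integrand alpha beta f lam).

Definition jacobi_poly (R : realType) (n : nat) (a b z : R) : R :=
  poch (a + 1) n / (n`!)%:R *
  pFq [:: - n%:R; a + b + n%:R + 1] [:: a + 1] ((1 - z) / 2).

Definition Hfun (R : realType) (alpha beta delta : R) (m : nat) (x : R) : R :=
  let w := cosh x `^ (- alpha - beta - delta - 2) in
  let u := 1 - 2 * tanh x ^+ 2 in
  if odd m then w * jacobi_poly m./2 (alpha + 1) (delta - 1) u * tanh x
  else w * jacobi_poly m./2 alpha delta u.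

(* [wilson n s a b c d] is P_n(s; a, b, c, d) with s = t ^ 2.  The 4F3 is even
   in t, so the choice of the square root t of s is immaterial. *)
Definition wilson (R : realType) (n : nat) (s a b c d : R[i]) : R[i] :=
  let t := sqrtC s in
  poch (a + b) n * poch (a + c) n * poch (a + d) n *
  pFq [:: - n%:R; a + b + c + d + n%:R - 1; a + t; a - t]
      [:: a + b; a + c; a + d] 1.

(* Main.v *)
Require Import Defs.
From mathcomp Require Import all_boot all_order all_algebra.
From mathcomp Require Import all_classical all_reals all_analysis.
From mathcomp Require Import measurable_realfun.
From mathcomp Require Import ring lra.

Set Implicit Arguments.
Unset Strict Implicit.
Unset Printing Implicit Defensive.

Import Order.TTheory GRing.Theory Num.Theory.
Import numFieldNormedType.Exports.

Local Open Scope classical_set_scope.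
Local Open Scope ring_scope.
Local Open Scope complex_scope.

(* On the half-line the Pfaff transformation turns cosh^(-alpha-beta-s-2) phi A
   into a Beta kernel in tanh^2 times a 2F1 at tanh^2.  Integrating termwise
   gives a Beta function times a 2F1 at 1; the contiguous relation in its
   third parameter, combined with Euler's limit for Gamma, evaluates it as
     Gamma(alpha+1) Gamma((s+1+i lam)/2) Gamma((s+1-i lam)/2)
       / (2 Gamma((alpha+beta+s+2)/2) Gamma((alpha-beta+s+2)/2)).
   Expanding the Jacobi polynomial at the other end point, in powers of
   1 - tanh^2 = cosh^(-2), shifts s by even integers, and the resulting finite
   sum of Gamma quotients is the 4F3 of the Wilson polynomial.  By parity the
   even functions only see phi^(alpha,beta), the odd ones only
   phi^(alpha+1,beta+1). *)

(** The value of 2F1 at [- sinh x ^+ 2] is fixed only by analytic continuation, and its argument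
    runs to minus infinity. Since x / (x - 1) sends the half-line below 1/2 into the unit disc, the
    Pfaff form is an explicit continuation, and the identity principle turns the choice made in
    [gauss2F1] into a formula on the negative half-line. The 2F1 at 1 is never summed directly. As a
    function of the Beta exponent P, the whole integral obeys a first-order recurrence under P -> P
    + 1. As P goes to infinity the 2F1 tends to 1, while the Beta factor times a power of n tends to
    Gamma(alpha + 1). The Euler products of the other four Gamma factors then balance, because their
    arguments satisfy s + t = c + P + Q. The strip |Im lam| < delta + 1 says that both (delta + 1 +
    i lam)/2 and (delta + 1 - i lam)/2 have positive real part. The first is the exponent of the
    Beta kernel at infinity. The second is the excess of the hypergeometric series at 1, hence what
    makes that series converge. *)

(** * Modulus, real and imaginary parts of complex numbers *)

Section ComplexModulus.
Context {R : realType}.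
Implicit Types (z w : R[i]) (x : R).

(** The norm of [R[i]] takes its values in [R[i]]; comparison tests and integrals need a modulus in
    [R]. *)
Definition cmod z : R := Num.sqrt (complex.Re z ^+ 2 + complex.Im z ^+ 2).

Lemma cmodE z : `|z| = (cmod z)%:C.
Proof. by rewrite normc_def. Qed.

Lemma cmod_ge0 z : 0 <= cmod z.
Proof. exact: sqrtr_ge0. Qed.

Lemma real_complex_le (x y : R) : (x%:C <= y%:C) = (x <= y).
Proof. exact: lecR. Qed.

Lemma cmod0 : cmod 0 = 0.
Proof. by apply: complexI; rewrite -cmodE normr0. Qed.

Lemma cmod1 : cmod 1 = 1.
Proof. by apply: complexI; rewrite -cmodE normr1. Qed.

Lemma cmodN z : cmod (- z) = cmod z.
Proof. by apply: complexI; rewrite -!cmodE normrN. Qed.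

Lemma cmodM z w : cmod (z * w) = cmod z * cmod w.
Proof. by apply: complexI; rewrite rmorphM /= -!cmodE normrM. Qed.

Lemma cmodX z n : cmod (z ^+ n) = cmod z ^+ n.
Proof. by apply: complexI; rewrite rmorphXn /= -!cmodE normrX. Qed.

Lemma cmodV z : cmod z^-1 = (cmod z)^-1.
Proof. by apply: complexI; rewrite fmorphV /= -!cmodE normfV. Qed.

Lemma cmodD z w : cmod (z + w) <= cmod z + cmod w.
Proof. by rewrite -real_complex_le rmorphD /= -!cmodE ler_normD. Qed.

Lemma cmodB z w : cmod (z - w) <= cmod z + cmod w.
Proof. by rewrite -(cmodN w) cmodD. Qed.

Lemma cmodBC z w : cmod (z - w) = cmod (w - z).
Proof. by rewrite -cmodN opprB. Qed.

Lemma cmod_eq0 z : (cmod z == 0) = (z == 0).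
Proof.
rewrite -(normr_eq0 z) cmodE; apply/eqP/eqP => [->//|h].
exact: complexI.
Qed.

Lemma cmodR x : cmod x%:C = `|x|.
Proof. by rewrite /cmod /= expr0n addr0 sqrtr_sqr. Qed.

Lemma cmod_nat n : cmod n%:R = n%:R.
Proof. by rewrite -(rmorph_nat (real_complex R)) cmodR ger0_norm. Qed.

Lemma Re_le_cmod z : `|complex.Re z| <= cmod z.
Proof. by rewrite -sqrtr_sqr ler_wsqrtr// lerDl sqr_ge0. Qed.

Lemma Im_le_cmod z : `|complex.Im z| <= cmod z.
Proof. by rewrite -sqrtr_sqr ler_wsqrtr// lerDr sqr_ge0. Qed.

Lemma cmod_le_ReIm z : cmod z <= `|complex.Re z| + `|complex.Im z|.
Proof.
rewrite {1}(complexE z) (le_trans (cmodD _ _))// cmodM !cmodR.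
have -> : cmod 'i = 1 by rewrite /cmod /= expr0n expr1n add0r sqrtr1.
by rewrite mul1r lexx.
Qed.

Lemma cmod_sum (I : Type) (r : seq I) (P : pred I) (F : I -> R[i]) :
  cmod (\sum_(i <- r | P i) F i) <= \sum_(i <- r | P i) cmod (F i).
Proof.
elim/big_rec2: _ => [|i y z _ h]; first by rewrite cmod0.
by apply: (le_trans (cmodD _ _)); rewrite lerD2l.
Qed.

Lemma cmod_prod (I : Type) (r : seq I) (P : pred I) (F : I -> R[i]) :
  cmod (\prod_(i <- r | P i) F i) = \prod_(i <- r | P i) cmod (F i).
Proof.
elim/big_rec2: _ => [|i y z _ h]; first by rewrite cmod1.
by rewrite cmodM h.
Qed.

Lemma Re_sum (I : Type) (r : seq I) (P : pred I) (F : I -> R[i]) :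
  complex.Re (\sum_(i <- r | P i) F i) = \sum_(i <- r | P i) complex.Re (F i).
Proof. by elim/big_rec2: _ => [//|i y [? ?] _ /= ->]; case: (F i). Qed.

Lemma Im_sum (I : Type) (r : seq I) (P : pred I) (F : I -> R[i]) :
  complex.Im (\sum_(i <- r | P i) F i) = \sum_(i <- r | P i) complex.Im (F i).
Proof. by elim/big_rec2: _ => [//|i y [? ?] _ /= ->]; case: (F i). Qed.

Lemma cReD z w : complex.Re (z + w) = complex.Re z + complex.Re w.
Proof. by case: z w => ? ? []. Qed.

Lemma cImD z w : complex.Im (z + w) = complex.Im z + complex.Im w.
Proof. by case: z w => ? ? []. Qed.

Lemma cReN z : complex.Re (- z) = - complex.Re z.
Proof. by case: z. Qed.

Lemma cImN z : complex.Im (- z) = - complex.Im z.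
Proof. by case: z. Qed.

Lemma cReM z w : complex.Re (z * w) =
  complex.Re z * complex.Re w - complex.Im z * complex.Im w.
Proof. by case: z w => ? ? []. Qed.

Lemma cImM z w : complex.Im (z * w) =
  complex.Re z * complex.Im w + complex.Im z * complex.Re w.
Proof. by case: z w => ? ? []. Qed.

Lemma real_complexM (x y : R) : (x * y)%:C = x%:C * y%:C.
Proof. exact: rmorphM. Qed.

Lemma real_complexN (x : R) : (- x)%:C = - x%:C.
Proof. exact: rmorphN. Qed.

Lemma real_complex_sum (I : Type) (r : seq I) (F : I -> R) :
  (\sum_(i <- r) F i)%:C = \sum_(i <- r) (F i)%:C.
Proof. exact: rmorph_sum. Qed.

Lemma Re_nat n : complex.Re (n%:R : R[i]) = n%:R.
Proof. by rewrite -(rmorph_nat (real_complex R)). Qed.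

Lemma Im_nat n : complex.Im (n%:R : R[i]) = 0.
Proof. by rewrite -(rmorph_nat (real_complex R)). Qed.

Lemma complex_eqP z w :
  complex.Re z = complex.Re w -> complex.Im z = complex.Im w -> z = w.
Proof. by case: z w => ? ? [] ? ? /= -> ->. Qed.

End ComplexModulus.

(* [R[i]] only carries a topology when it is viewed as a [numFieldType]: this
   wrapper forces that view. *)
Variant kcvg (K : numFieldType) (T : Type) (F : set_system T) (f : T -> K)
  (l : K) : Prop := Kcvg of f @ F --> l.

Lemma kcvgP (K : numFieldType) (T : Type) (F : set_system T) (f : T -> K)
  (l : K) : kcvg F f l <-> f @ F --> l.
Proof. by split => [[]|/Kcvg]. Qed.

(** * Limits along a filter, real and complex *)

Section NumFieldConvergence.
Context {K : numFieldType} {T : Type} {F : set_system T}.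
Implicit Types (f g : T -> K) (l m : K).

Lemma kcvg_cst {FF : Filter F} l : kcvg F (fun=> l) l.
Proof. by split; exact: cvg_cst. Qed.

Lemma kcvgD {FF : Filter F} f g l m : kcvg F f l -> kcvg F g m ->
  kcvg F (fun t => f t + g t) (l + m).
Proof. by move=> [hf] [hg]; split; exact: cvgD. Qed.

Lemma kcvgN {FF : Filter F} f l : kcvg F f l -> kcvg F (fun t => - f t) (- l).
Proof. by move=> [hf]; split; exact: cvgN. Qed.

Lemma kcvgB {FF : Filter F} f g l m : kcvg F f l -> kcvg F g m ->
  kcvg F (fun t => f t - g t) (l - m).
Proof. by move=> [hf] [hg]; split; exact: cvgB. Qed.

Lemma kcvgM {FF : Filter F} f g l m : kcvg F f l -> kcvg F g m ->
  kcvg F (fun t => f t * g t) (l * m).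
Proof. by move=> [hf] [hg]; split; exact: cvgM. Qed.

Lemma kcvgZl {FF : Filter F} f k l : kcvg F f l ->
  kcvg F (fun t => k * f t) (k * l).
Proof. by move=> h; exact: (kcvgM (kcvg_cst _) h). Qed.

Lemma kcvgV {FF : Filter F} f l : l != 0 -> kcvg F f l ->
  kcvg F (fun t => (f t)^-1) l^-1.
Proof. by move=> l0 [h]; split; exact: cvgV. Qed.

Lemma kcvg_unique {FF : ProperFilter F} f l m : kcvg F f l -> kcvg F f m ->
  l = m.
Proof. by move=> [fl] [fm]; exact: (cvg_unique (@norm_hausdorff K K) fl fm). Qed.

Lemma kcvg_near {FF : Filter F} f g l : kcvg F f l ->
  (\forall t \near F, f t = g t) -> kcvg F g l.
Proof. by move=> [h] fg; split; apply: cvg_trans h; exact: near_eq_cvg. Qed.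

Lemma kcvg_eq f g l : kcvg F f l -> f =1 g -> kcvg F g l.
Proof. by move=> h /funext <-. Qed.

Lemma kcvg_sum {FF : Filter F} (I : Type) (r : seq I) (f : I -> T -> K)
  (l : I -> K) : (forall i, kcvg F (f i) (l i)) ->
  kcvg F (fun t => \sum_(i <- r) f i t) (\sum_(i <- r) l i).
Proof.
move=> h; elim: r => [|i r IH].
  by rewrite big_nil; apply: (kcvg_eq (kcvg_cst _)) => t; rewrite big_nil.
rewrite big_cons; apply: (kcvg_eq (kcvgD (h i) IH)) => t.
by rewrite big_cons.
Qed.

End NumFieldConvergence.

Lemma kcvg_lim (K : numFieldType) (u : nat -> K) l : kcvg \oo u l -> limn u = l.
Proof. by move=> [h]; apply: cvg_lim => //; exact: norm_hausdorff. Qed.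

Lemma kcvg_shiftS (K : numFieldType) (u : nat -> K) l :
  kcvg \oo (fun n => u n.+1) l <-> kcvg \oo u l.
Proof. by rewrite !kcvgP; split; rewrite (cvg_shiftS u). Qed.

Lemma kcvg_shiftn (K : numFieldType) (u : nat -> K) N l :
  kcvg \oo (fun n => u (n + N)%N) l <-> kcvg \oo u l.
Proof. by rewrite !kcvgP; split; rewrite (cvg_shiftn N u). Qed.

Section ComplexConvergence.
Context {R : realType} {T : Type} {F : set_system T} {FF : Filter F}.
Implicit Types (f : T -> R[i]) (l : R[i]).

Lemma kcvg_cmod f l : kcvg F f l <-> kcvg F (fun t => cmod (f t - l)) 0.
Proof.
rewrite !kcvgP; split.
  move/cvgrPdist_lt => h; apply/cvgrPdist_lt => e e0.
  have eC : 0 < e%:C by rewrite ltcR.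
  apply: filterS (h _ eC) => t; rewrite cmodE ltcR sub0r normrN => ht.
  by rewrite ger0_norm ?cmod_ge0// cmodBC.
move/cvgrPdist_lt => h; apply/cvgrPdist_lt => e e0.
(* Positivity in [R[i]] forces the imaginary part to vanish, so this epsilon is really a real
   number. *)
have eR : 0 < complex.Re e by move: e0; rewrite ltcE => /andP[].
have eE : e = (complex.Re e)%:C by rewrite RRe_real// gtr0_real.
apply: filterS (h _ eR) => t; rewrite sub0r normrN ger0_norm ?cmod_ge0//.
by rewrite cmodBC => ht; rewrite cmodE eE ltcR.
Qed.

Lemma kcvg0_le (f g : T -> R) : kcvg F g 0 ->
  (forall t, 0 <= f t <= g t) -> kcvg F f 0.
Proof.
move=> [g0] fg; split; apply: (@squeeze_cvgr _ _ _ _ (fun=> 0) g) => //.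
- by near=> t; exact: fg.
- exact: cvg_cst.
Unshelve. all: by end_near. Qed.

Lemma kcvg_ReIm f l : kcvg F f l <->
  kcvg F (fun t => complex.Re (f t)) (complex.Re l) /\
  kcvg F (fun t => complex.Im (f t)) (complex.Im l).
Proof.
rewrite kcvg_cmod; split.
  have norm0 (g : T -> R) (m : R) : kcvg F (fun t => `|g t - m|) 0 ->
      kcvg F g m.
    move=> [/cvgrPdist_lt h]; split; apply/cvgrPdist_lt => e e0.
    apply: filterS (h _ e0) => t; rewrite sub0r normrN normr_id.
    by rewrite distrC.
  move=> h; split; apply: norm0; refine (kcvg0_le h _) => t;
    rewrite normr_ge0/=.
    by rewrite -cReN -cReD Re_le_cmod.
  by rewrite -cImN -cImD Im_le_cmod.
move=> [h1 h2].
have h (g : T -> R) (m : R) : kcvg F g m -> kcvg F (fun t => `|g t - m|) 0.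
  move=> gm; split; rewrite -(@normr0 _ R) -(subrr m).
  by apply: cvg_norm; apply/kcvgP/kcvgB => //; exact: kcvg_cst.
have {h1 h2}h12 := kcvgD (FF := FF) (h _ _ h1) (h _ _ h2).
rewrite addr0 in h12; refine (kcvg0_le h12 _) => t; rewrite cmod_ge0/=.
by rewrite (le_trans (cmod_le_ReIm _))// !cReD !cImD !cReN !cImN.
Qed.

Lemma kcvg_real (f : T -> R) (l : R) : kcvg F f l ->
  kcvg F (fun t => (f t)%:C) l%:C.
Proof. by move=> h; apply/kcvg_ReIm; split => //; exact: kcvg_cst. Qed.

Lemma kcvg_cmodl f l : kcvg F f l -> kcvg F (fun t => cmod (f t)) (cmod l).
Proof.
move=> /kcvg_cmod [/cvgrPdist_lt h]; split; apply/cvgrPdist_lt => e e0.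
apply: filterS (h _ e0) => t; rewrite sub0r normrN ger0_norm ?cmod_ge0//.
apply: le_lt_trans; rewrite ler_norml; apply/andP; split.
  rewrite lerNl opprB lerBlDr (le_trans _ (cmodD _ _))// subrK//.
by rewrite lerBlDr cmodBC (le_trans _ (cmodD _ _))// subrK.
Qed.

End ComplexConvergence.

(** * Series: absolute summability, dominated limits, double sums *)

Definition ksum (K : numFieldType) (u : nat -> K) (s : K) : Prop :=
  kcvg \oo (series u) s.

Definition klim (K : numFieldType) (u : nat -> K) : K := limn (series u).

(** Summability of nonnegative terms, phrased by bounded partial sums so that comparisons never have
    to name a limit. *)
Definition bdsum (R : numFieldType) (b : nat -> R) : Prop :=
  exists M, forall n, \sum_(0 <= k < n) b k <= M.

Section KSum.
Context {K : numFieldType}.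
Implicit Types (u v : nat -> K) (s t : K).

Lemma ksumP u s : ksum u s <-> is_sum u s.
Proof. exact: kcvgP. Qed.

Lemma ksum_lim u s : ksum u s -> klim u = s.
Proof. exact: kcvg_lim. Qed.

Lemma ksum_eq u v s : ksum u s -> u =1 v -> ksum v s.
Proof. by move=> h /funext <-. Qed.

Lemma ksum_unique u s t : ksum u s -> ksum u t -> s = t.
Proof. exact: kcvg_unique. Qed.

Lemma ksumD u v s t : ksum u s -> ksum v t -> ksum (fun k => u k + v k) (s + t).
Proof.
move=> hu hv; apply: (kcvg_eq (kcvgD hu hv)) => n.
by rewrite /series/= big_split.
Qed.

Lemma ksumZ u s c : ksum u s -> ksum (fun k => c * u k) (c * s).
Proof.
move=> hu; apply: (kcvg_eq (kcvgZl c hu)) => n.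
by rewrite /series/= mulr_sumr.
Qed.

Lemma ksumN u s : ksum u s -> ksum (fun k => - u k) (- s).
Proof.
move=> hu; apply: (kcvg_eq (kcvgN hu)) => n.
by rewrite /series/= sumrN.
Qed.

Lemma ksumB u v s t : ksum u s -> ksum v t -> ksum (fun k => u k - v k) (s - t).
Proof. by move=> hu hv; exact: (ksumD hu (ksumN hv)). Qed.

Lemma ksum_recl u s : ksum (fun k => u k.+1) s <-> ksum u (u 0%N + s).
Proof.
rewrite /ksum -(kcvg_shiftS (series u)).
have E n : series u n.+1 = u 0%N + series (fun k => u k.+1) n.
  by rewrite /series/= big_nat_recl.
split=> h.
  by apply: (kcvg_eq (kcvgD (kcvg_cst _) h)) => n; rewrite E.
have h2 : kcvg \oo (fun n => series u n.+1 - u 0%N) (u 0%N + s - u 0%N).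
  exact: (kcvgB h (kcvg_cst _)).
rewrite addrAC subrr add0r in h2; apply: (kcvg_eq h2) => n.
by rewrite E addrAC subrr add0r.
Qed.

Lemma ksum_finite u n : (forall k, (n <= k)%N -> u k = 0) ->
  ksum u (\sum_(0 <= k < n) u k).
Proof.
move=> u0; apply: (kcvg_near (kcvg_cst _)).
exists n => // m /= nm; rewrite /series/= [RHS](big_cat_nat (n := n))//=.
have -> : \sum_(n <= i < m) u i = 0; last by rewrite addr0.
by rewrite big_nat big1// => i /andP[ni _]; exact: u0.
Qed.

Lemma ksum_cvg0 u s : ksum u s -> kcvg \oo u 0.
Proof.
by move=> [h]; split; apply: cvg_series_cvg_0; apply/cvg_ex; exists s.
Qed.

Lemma ksum_sum (I : Type) (r : seq I) (u : I -> nat -> K) (s : I -> K) :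
  (forall i, ksum (u i) (s i)) ->
  ksum (fun k => \sum_(i <- r) u i k) (\sum_(i <- r) s i).
Proof.
move=> h; apply: (kcvg_eq (kcvg_sum r h)) => n.
by rewrite /series/= exchange_big.
Qed.

End KSum.

Lemma kcvg_le (R : realType) (u : nat -> R) l M : kcvg \oo u l ->
  (\forall n \near \oo, u n <= M) -> l <= M.
Proof.
move=> [h] uM; rewrite -(cvg_lim _ h)//.
by apply: limr_le => //; apply/cvg_ex; exists l.
Qed.

Section RealSum.
Context {R : realType}.
Implicit Types (a b : nat -> R).

Lemma bdsum_ksum b : (forall n, 0 <= b n) -> bdsum b ->
  exists2 s, ksum b s & forall n, \sum_(0 <= k < n) b k <= s.
Proof.
move=> b0 [M hM].
have nd : nondecreasing_seq (series b).
  by apply/nondecreasing_seqP => n; rewrite seriesSr lerDl.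
have cv : cvgn (series b).
  by apply: nondecreasing_is_cvgn => //; exists M => _ [n _ <-]; exact: hM.
exists (limn (series b)); first exact: Kcvg.
by move=> n; exact: (nondecreasing_cvgn_le nd cv n).
Qed.

(** The first [N] terms escape the comparison and may have any sign; they are paid for by their
    absolute values. *)
Lemma bdsum_le a b N : (forall n, 0 <= b n) ->
  (forall n, (N <= n)%N -> a n <= b n) -> bdsum b -> bdsum a.
Proof.
move=> b0 ab [M hM]; exists (\sum_(0 <= k < N) `|a k| + M) => n.
apply: (@le_trans _ _ (\sum_(0 <= k < n) ((if (k < N)%N then `|a k| else 0) + b k))).
  apply: ler_sum => k _; case: ltnP => kN.
    by rewrite (le_trans (ler_norm _))// lerDl.
  by rewrite add0r ab.
rewrite big_split/= lerD//.
have h m : \sum_(0 <= k < m) (if (k < N)%N then `|a k| else 0)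
    = \sum_(0 <= k < minn m N) `|a k|.
  elim: m => [|m IH]; first by rewrite min0n !big_nil.
  rewrite big_nat_recr//= IH; case: ltnP => mN.
    by rewrite (minn_idPl mN) big_nat_recr.
  by rewrite addr0 (minn_idPr (leqW mN)).
rewrite h.
rewrite [leRHS](big_cat_nat (n := minn n N))//= ?geq_minr//.
by rewrite lerDl sumr_ge0.
Qed.

Lemma bdsumZ b c : 0 <= c -> bdsum b -> bdsum (fun n => c * b n).
Proof.
move=> c0 [M hM]; exists (c * M) => n.
by rewrite -mulr_sumr ler_wpM2l.
Qed.

Lemma bdsum_tail b e : (forall n, 0 <= b n) -> bdsum b -> 0 < e ->
  exists N, forall n, \sum_(N <= k < n) b k <= e.
Proof.
move=> b0 bb e0; have [s [bs] ubs] := bdsum_ksum b0 bb.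
move/cvgrPdist_le : bs => /(_ _ e0) [N _ hN]; exists N => n.
have [Nn|nN] := leqP N n; last by rewrite big_geq ?(ltnW nN)// ltW.
have := hN N (leqnn _); rewrite /series/= ger0_norm ?subr_ge0 ?ubs// => h.
rewrite -(lerD2l (\sum_(0 <= k < N) b k)) -big_cat_nat//=.
by rewrite (le_trans (ubs n))// -lerBlDl.
Qed.

Lemma bdsum_geometric (q : R) : 0 <= q < 1 -> bdsum (fun n => q ^+ n).
Proof.
move=> /andP[q0 q1]; have q1' : 0 < 1 - q by rewrite subr_gt0.
exists (1 - q)^-1 => n.
rewrite -[leRHS]mul1r ler_pdivlMr// big_mkord.
have -> : (\sum_(i < n) q ^+ i) * (1 - q) = 1 - q ^+ n.
  by rewrite -opprB mulrN mulrC -subrX1 opprB.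
by rewrite gerBl exprn_ge0.
Qed.

End RealSum.

Section ComplexSum.
Context {R : realType}.
Implicit Types (u v : nat -> R[i]).

Lemma abs_summable u : bdsum (cmod \o u) -> exists s, ksum u s.
Proof.
move=> hu.
have aux (f : R[i] -> R) : (forall z, `|f z| <= cmod z) ->
    exists s, ksum (f \o u) s.
  move=> fz; have : cvgn (series (f \o u)).
    apply: normed_cvg.
    apply: (@nondecreasing_is_cvgn _ (series (fun n => `|f (u n)|))).
      by apply/nondecreasing_seqP => n; rewrite seriesSr lerDl.
    have [M hM] := hu; exists M => _ [n _ <-].
    by apply: le_trans (hM n); apply: ler_sum => k _; exact: fz.
  by move=> /cvg_ex[s hs]; exists s; split.
have [a ha] := aux _ Re_le_cmod; have [b hb] := aux _ Im_le_cmod.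
exists (a +i* b); apply/kcvg_ReIm => /=; split.
  by apply: (kcvg_eq ha) => n; rewrite /series/= Re_sum.
by apply: (kcvg_eq hb) => n; rewrite /series/= Im_sum.
Qed.

Lemma ksum_cmod_le u s (M : R) :
  (forall n, \sum_(0 <= k < n) cmod (u k) <= M) -> ksum u s -> cmod s <= M.
Proof.
move=> hM /kcvg_cmodl h; apply: (kcvg_le h); near=> n.
by rewrite /series/= (le_trans (cmod_sum _ _ _)).
Unshelve. all: by end_near. Qed.

(** Dominated convergence for series: beyond a rank independent of [n] the tails are controlled by
    those of [b], and below it only finitely many limits are taken. *)
Lemma tannery (u : nat -> nat -> R[i]) (s : nat -> R[i]) v l (b : nat -> R) :
  bdsum b -> (forall n k, cmod (u n k) <= b k) ->
  (forall k, kcvg \oo (fun n => u n k) (v k)) ->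
  (forall n, ksum (u n) (s n)) -> ksum v l -> kcvg \oo s l.
Proof.
move=> bb ub uv us vl.
have b0 k : 0 <= b k := le_trans (cmod_ge0 _) (ub 0%N k).
have vb k : cmod (v k) <= b k.
  by apply: (kcvg_le (kcvg_cmodl (uv k))); near=> n; exact: ub.
apply/kcvg_cmod; split; apply/cvgrPdist_le => e e0.
(* Two tails at e / 4 and the finite part at e / 2 add up to e. *)
have e4 : 0 < e / 4 by rewrite divr_gt0.
have [N hN] := bdsum_tail b0 bb e4.
have tail w t : (forall k, cmod (w k) <= b k) -> ksum w t ->
    cmod (t - \sum_(0 <= k < N) w k) <= e / 4.
  move=> wb wt.
  have /kcvg_cmodl h : kcvg \oo (fun n => series w n -
      \sum_(0 <= k < N) w k) (t - \sum_(0 <= k < N) w k).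
    exact: (kcvgB wt (kcvg_cst _)).
  apply: (kcvg_le h); near=> n.
  rewrite /series/= (big_cat_nat (n := N))//=; last by near: n; exists N.
  rewrite addrAC subrr add0r (le_trans (cmod_sum _ _ _))//.
  by rewrite (le_trans _ (hN n))//; apply: ler_sum => k _; exact: wb.
have hd : kcvg \oo (fun n => \sum_(0 <= k < N) u n k) (\sum_(0 <= k < N) v k).
  exact: kcvg_sum.
have e2 : 0 < e / 2 by rewrite divr_gt0.
move/kcvg_cmod : hd => [/cvgrPdist_le /(_ _ e2)].
apply: filterS => n; rewrite !sub0r !normrN !ger0_norm ?cmod_ge0// => hn.
have -> : s n - l = (s n - \sum_(0 <= k < N) u n k)
   + (\sum_(0 <= k < N) u n k - \sum_(0 <= k < N) v k)
   - (l - \sum_(0 <= k < N) v k) by ring.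
rewrite (le_trans (cmodB _ _))//.
rewrite (le_trans (lerD (cmodD _ _) (tail _ _ vb vl)))//.
by have := tail _ _ (ub n) (us n); lra.
Unshelve. all: by end_near. Qed.

(** Fubini for absolutely summable double series. The partial sums of the columns are sums over [i]
    of truncated rows, so [tannery] applies, dominated by the absolute row sums. *)
Lemma double_ksum (U : nat -> nat -> R[i]) (M : R) :
  (forall n m, \sum_(0 <= i < n) \sum_(0 <= j < m) cmod (U i j) <= M) ->
  exists r c s, [/\ forall i, ksum (U i) (r i), forall j, ksum (U^~ j) (c j),
    ksum r s & ksum c s].
Proof.
move=> hM.
have rowM i n : \sum_(0 <= j < n) cmod (U i j) <= M.
  apply: le_trans (hM i.+1 n); rewrite big_nat_recr//= lerDr.
  by rewrite sumr_ge0// => k _; rewrite sumr_ge0// => j _; exact: cmod_ge0.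
have colM j n : \sum_(0 <= i < n) cmod (U i j) <= M.
  apply: le_trans (hM n j.+1); apply: ler_sum => i _.
  rewrite big_nat_recr//= lerDr.
  by rewrite sumr_ge0// => k _; exact: cmod_ge0.
have /choice[r hr] i : exists s, ksum (U i) s.
  by apply: abs_summable; exists M; exact: rowM.
have /choice[c hc] j : exists s, ksum (U^~ j) s.
  by apply: abs_summable; exists M; exact: colM.
have /choice[b hb] i : exists s, ksum (fun j => cmod (U i j)) s /\
    forall n, \sum_(0 <= j < n) cmod (U i j) <= s.
  have [|s h1 h2] := @bdsum_ksum _ (fun j => cmod (U i j)) (fun=> cmod_ge0 _).
    by exists M; exact: rowM.
  by exists s.
have bb : bdsum b.
  exists M => n.
  have h : ksum (fun j => \sum_(0 <= i < n) cmod (U i j)) (\sum_(0 <= i < n) b i).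
    by apply: ksum_sum => i; exact: (hb i).1.
  apply: (kcvg_le h); near=> m.
  by rewrite /series/= exchange_big/=; exact: hM.
have [s hs] : exists s, ksum r s.
  apply: abs_summable; apply: (@bdsum_le _ _ b 0) bb => [n|n _].
    by apply: le_trans ((hb n).2 0%N); rewrite big_nil.
  exact: ksum_cmod_le (hb n).2 (hr n).
exists r, c, s; split=> //.
apply: (@tannery (fun m i => \sum_(0 <= j < m) U i j) _ r s b) => //.
- move=> m i; rewrite (le_trans (cmod_sum _ _ _))//.
  exact: (hb i).2.
- by move=> m; exact: ksum_sum.
Unshelve. all: by end_near. Qed.

End ComplexSum.

(** * Rising factorials and the Chu-Vandermonde sum *)

Section Pochhammer.
Context {K : numFieldType}.
Implicit Types (a b c : K).

Lemma poch0 a : poch a 0 = 1.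
Proof. by rewrite /poch big_ord0. Qed.

Lemma pochS a n : poch a n.+1 = poch a n * (a + n%:R).
Proof. by rewrite /poch big_ord_recr. Qed.

Lemma pochSl a n : poch a n.+1 = a * poch (a + 1) n.
Proof.
rewrite /poch big_ord_recl addr0; congr (_ * _); apply: eq_bigr => i _.
by rewrite -addrA -natr1 [1 + _]addrC.
Qed.

Lemma pochD a m n : poch a (m + n) = poch a m * poch (a + m%:R) n.
Proof.
elim: n => [|n IH]; first by rewrite addn0 poch0 mulr1.
by rewrite addnS !pochS IH natrD addrA mulrA.
Qed.

Lemma poch_split a m n : (m <= n)%N ->
  poch a n = poch a m * poch (a + m%:R) (n - m).
Proof. by move=> mn; rewrite -pochD subnKC. Qed.

Lemma poch_neq0 a n : (forall k, a + k%:R != 0) -> poch a n != 0.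
Proof. by move=> h; apply/prodf_neq0 => i _; exact: h. Qed.

Lemma poch_gt0 a n : 0 < a -> 0 < poch a n.
Proof. by move=> h; apply: prodr_gt0 => i _; rewrite ltr_wpDr. Qed.

Lemma poch_ge0 a n : 0 <= a -> 0 <= poch a n.
Proof. by move=> h; apply: prodr_ge0 => i _; rewrite addr_ge0. Qed.

Lemma ler_poch a b n : 0 <= a -> a <= b -> poch a n <= poch b n.
Proof.
by move=> a0 ab; apply: ler_prod => i _; rewrite addr_ge0//= lerD2r.
Qed.

Lemma poch1 n : poch (1 : K) n = n`!%:R.
Proof.
elim: n => [|n IH]; first by rewrite poch0.
by rewrite pochS IH factS natrM mulrC nat1r.
Qed.

Lemma poch_Nnat n k :
  poch (- n%:R : K) k = (-1) ^+ k * 'C(n, k)%:R * k`!%:R.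
Proof.
elim: k => [|k IH]; first by rewrite poch0 bin0 fact0 !mulr1.
rewrite pochS IH exprS factS natrM.
have [kn|nk] := leqP k n; last first.
  by rewrite (bin_small nk) (bin_small (leqW nk)) !(mulr0, mul0r).
have h := mul_bin_left n k; have : (k.+1 * 'C(n, k.+1))%:R = ((n - k) * 'C(n, k))%:R :> K.
  by rewrite h.
rewrite !natrM natrB// => e.
transitivity (- (-1 : K) ^+ k * k`!%:R * ((n%:R - k%:R) * 'C(n, k)%:R)); first by ring.
by rewrite -e; ring.
Qed.

(** Chu-Vandermonde cleared of denominators, so that [c] is arbitrary. Pascal's rule splits the sum
    of rank n + 1 into a multiple of the one at (b, c) and a multiple of the one at (b + 1, c + 1);
    both have the same c - b. *)
Lemma vandermonde n b c :
  \sum_(0 <= k < n.+1) (-1) ^+ k * 'C(n, k)%:R * poch b k * poch (c + k%:R) (n - k)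
  = poch (c - b) n.
Proof.
elim: n b c => [|n IH] b c.
  by rewrite big_nat1 !poch0 bin0 !mulr1.
rewrite big_nat_recl// bin0 poch0 subn0 addr0.
under eq_bigr do rewrite binS natrD mulrDr !mulrDl subSS.
rewrite big_split/= addrA.
have -> : 1%R * 1 * 1 * poch c n.+1 + \sum_(0 <= i < n.+1)
    (-1) ^+ i.+1 * 'C(n, i.+1)%:R * poch b i.+1 * poch (c + i.+1%:R) (n - i)
    = (c + n%:R) * poch (c - b) n.
  rewrite -IH mulr_sumr [RHS]big_nat_recl//= bin0 poch0 subn0 addr0 pochS.
  congr (_ + _); first by ring.
  rewrite big_nat_recr//= bin_small// !(mulr0, mul0r) addr0.
  rewrite big_nat [RHS]big_nat; apply: eq_bigr => i /andP[_ ni].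
  have -> : (n - i = (n - i.+1).+1)%N by rewrite -subSn.
  rewrite [poch _ (n - i.+1).+1]pochS natrB//; ring.
have -> : \sum_(0 <= i < n.+1)
    (-1) ^+ i.+1 * 'C(n, i)%:R * poch b i.+1 * poch (c + i.+1%:R) (n - i)
    = - b * poch (c - b) n.
  have -> : c - b = (c + 1) - (b + 1) by ring.
  rewrite -IH mulr_sumr; apply: eq_bigr => i _.
  by rewrite pochSl exprS -addrA nat1r; ring.
by rewrite -mulrDl mulrC pochS; congr (_ * _); ring.
Qed.

Lemma poch_rev a n : poch (1 - a - n%:R) n = (-1) ^+ n * poch a n.
Proof.
rewrite /poch (reindex_inj rev_ord_inj)/=.
rewrite -[n in (-1) ^+ n]card_ord -prodrN.
apply: eq_bigr => i _; rewrite natrB ?ltn_ord// -natr1; ring.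
Qed.

End Pochhammer.

Section ComplexPochhammer.
Context {R : realType}.

Lemma real_poch (x : R) n : (poch x n)%:C = poch x%:C n.
Proof.
rewrite /poch rmorph_prod; apply: eq_bigr => i _.
by rewrite rmorphD rmorph_nat.
Qed.

Lemma cmod_poch_le (z : R[i]) n : cmod (poch z n) <= poch (cmod z) n.
Proof.
rewrite /poch cmod_prod; apply: ler_prod => i _.
by rewrite cmod_ge0 (le_trans (cmodD _ _))// cmod_nat.
Qed.

Lemma poch_le_cmod (z : R[i]) n : 0 <= complex.Re z ->
  poch (complex.Re z) n <= cmod (poch z n).
Proof.
move=> z0; rewrite /poch cmod_prod; apply: ler_prod => i _.
rewrite addr_ge0//= (le_trans _ (Re_le_cmod _))// cReD Re_nat.
exact: ler_norm.
Qed.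

Lemma Re_gt0_neq0 (z : R[i]) : 0 < complex.Re z -> z != 0.
Proof. by move=> h; apply: contraTneq h => ->; rewrite ltxx. Qed.

Lemma Re_gt0_addn_neq0 (z : R[i]) k : 0 < complex.Re z -> z + k%:R != 0.
Proof. by move=> h; apply: Re_gt0_neq0; rewrite cReD Re_nat ltr_wpDr. Qed.

Lemma poch_Re_gt0 (z : R[i]) n : 0 < complex.Re z -> poch z n != 0.
Proof. by move=> h; apply: poch_neq0 => k; exact: Re_gt0_addn_neq0. Qed.

End ComplexPochhammer.

(** * Complex exponential and derivatives along the real line *)

Section ComplexExponential.
Context {R : realType}.
Implicit Types (z w : R[i]) (x t : R).

Definition cexp z : R[i] :=
  (expR (complex.Re z))%:C * (cos (complex.Im z) +i* sin (complex.Im z)).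

Lemma Re_cexp z : complex.Re (cexp z) = expR (complex.Re z) * cos (complex.Im z).
Proof. by rewrite /cexp cReM/= mul0r subr0. Qed.

Lemma Im_cexp z : complex.Im (cexp z) = expR (complex.Re z) * sin (complex.Im z).
Proof. by rewrite /cexp cImM/= mul0r addr0. Qed.

Lemma cexpD z w : cexp (z + w) = cexp z * cexp w.
Proof.
apply: complex_eqP.
  by rewrite [LHS]Re_cexp [RHS]cReM !Re_cexp !Im_cexp cReD cImD expRD cosD; ring.
by rewrite [LHS]Im_cexp [RHS]cImM !Re_cexp !Im_cexp cReD cImD expRD sinD; ring.
Qed.

Lemma cexp0 : cexp 0 = 1.
Proof.
by rewrite /cexp /= expR0 cos0 sin0 mul1r.
Qed.

Lemma cmod_cexp z : cmod (cexp z) = expR (complex.Re z).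
Proof.
rewrite /cmod Re_cexp Im_cexp !exprMn -mulrDr cos2Dsin2 mulr1 sqrtr_sqr.
by rewrite ger0_norm// expR_ge0.
Qed.

Lemma cexpN_mul z : cexp (- z) * cexp z = 1.
Proof. by rewrite -cexpD addNr cexp0. Qed.

Lemma cexp_neq0 z : cexp z != 0.
Proof. by rewrite -cmod_eq0 cmod_cexp expR_eq0. Qed.

Lemma cexpN z : cexp (- z) = (cexp z)^-1.
Proof. by apply: (mulIf (cexp_neq0 z)); rewrite cexpN_mul mulVf ?cexp_neq0. Qed.

Lemma cexp_real x : cexp x%:C = (expR x)%:C.
Proof.
by rewrite /cexp /= cos0 sin0 mulr1.
Qed.

Lemma cexp_natl n z : cexp (n%:R * z) = cexp z ^+ n.
Proof.
elim: n => [|n IH]; first by rewrite mul0r cexp0.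
by rewrite -nat1r mulrDl mul1r cexpD IH exprS.
Qed.

Lemma cpowR_cexp t z : 0 < t -> cpowR t z = cexp (z * (ln t)%:C).
Proof.
move=> t0; rewrite /cpowR /cexp cReM cImM/= !mulr0 subr0 add0r.
by rewrite /powR gt_eqF.
Qed.

Lemma powR_cexp t x : 0 < t -> (t `^ x)%:C = cexp (x%:C * (ln t)%:C).
Proof. by move=> t0; rewrite /powR gt_eqF// -rmorphM cexp_real. Qed.

End ComplexExponential.

Section ComplexDerivative.
Context {R : realType}.
Implicit Types (f g : R -> R[i]) (h : R -> R) (x : R) (d e z : R[i]).

Definition is_cderive x f d : Prop :=
  is_derive x 1 (fun t => complex.Re (f t)) (complex.Re d) /\
  is_derive x 1 (fun t => complex.Im (f t)) (complex.Im d).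

Lemma is_cderive_eq x f d e : is_cderive x f d -> d = e -> is_cderive x f e.
Proof. by move=> h <-. Qed.

Lemma is_cderive_cst x z : is_cderive x (fun=> z) 0.
Proof. by split; exact: is_derive_cst. Qed.

Lemma is_cderiveD x f g d e : is_cderive x f d -> is_cderive x g e ->
  is_cderive x (fun t => f t + g t) (d + e).
Proof.
move=> [f1 f2] [g1 g2]; split.
  rewrite cReD; under eq_fun do rewrite cReD; exact: is_deriveD.
by rewrite cImD; under eq_fun do rewrite cImD; exact: is_deriveD.
Qed.

Lemma is_cderiveM x f g d e : is_cderive x f d -> is_cderive x g e ->
  is_cderive x (fun t => f t * g t) (d * g x + f x * e).
Proof.
move=> [f1 f2] [g1 g2]; split.
  under eq_fun do rewrite cReM.
  apply: (is_derive_eq (is_deriveB (is_deriveM f1 g1) (is_deriveM f2 g2))).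
  by rewrite cReD !cReM /GRing.scale/=; ring.
under eq_fun do rewrite cImM.
apply: (is_derive_eq (is_deriveD (is_deriveM f1 g2) (is_deriveM f2 g1))).
by rewrite cImD !cImM /GRing.scale/=; ring.
Qed.

Lemma is_cderive_real x h (dh : R) : is_derive x 1 h dh ->
  is_cderive x (fun t => (h t)%:C) dh%:C.
Proof. by move=> hh; split => //=; exact: is_derive_cst. Qed.

Lemma is_cderiveZ x f d z : is_cderive x f d ->
  is_cderive x (fun t => z * f t) (z * d).
Proof.
move=> hf; apply: (is_cderive_eq (is_cderiveM (is_cderive_cst x z) hf)).
by rewrite mul0r add0r.
Qed.

Lemma is_cderive_cexp x f d : is_cderive x f d ->
  is_cderive x (fun t => cexp (f t)) (d * cexp (f x)).
Proof.
move=> [f1 f2].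
have E := is_derive1_comp (is_derive_expR (complex.Re (f x))) f1.
have C := is_derive1_comp (is_derive_cos (complex.Im (f x))) f2.
have S := is_derive1_comp (is_derive_sin (complex.Im (f x))) f2.
split.
  under eq_fun do rewrite Re_cexp.
  apply: (is_derive_eq (is_deriveM E C)).
  by rewrite cReM Re_cexp Im_cexp /GRing.scale/=; ring.
under eq_fun do rewrite Im_cexp.
apply: (is_derive_eq (is_deriveM E S)).
by rewrite cImM Re_cexp Im_cexp /GRing.scale/=; ring.
Qed.

Lemma is_derive_continuous x h (dh : R) : is_derive x 1 h dh ->
  {for x, continuous h}.
Proof. by move=> [hh _]; apply/differentiable_continuous/derivable1_diffP. Qed.

Lemma is_cderive0_cst (a b : R) f : a <= b ->
  (forall x, a <= x <= b -> is_cderive x f 0) -> f a = f b.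
Proof.
rewrite le_eqVlt => /predU1P[->//|ab] hf.
have aux h : (forall x, a <= x <= b -> is_derive x 1 h 0) -> h a = h b.
  move=> hh; have [||c _] := @MVT _ h (fun=> 0) a b ab.
  - move=> t; rewrite in_itv/= => /andP[ta tb]; apply: hh.
    by rewrite !ltW.
  - apply: derivable_within_continuous => t; rewrite in_itv/= => tab.
    by have [] := hh _ tab.
  by rewrite mul0r => /eqP; rewrite subr_eq0 => /eqP ->.
by apply: complex_eqP; apply: (aux (fun t => _ (f t))) => x /hf[].
Qed.

End ComplexDerivative.

(** * The binomial series with complex exponent *)

Section BinomialSeries.
Context {R : realType}.
Implicit Types (z : R[i]) (h q : R).

Definition binc z k : R[i] := poch z k / k`!%:R.

Lemma fact_neq0 (K : numFieldType) n : n`!%:R != 0 :> K.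
Proof. by rewrite pnatr_eq0 -lt0n fact_gt0. Qed.

Lemma binc0 z : binc z 0 = 1.
Proof. by rewrite /binc poch0 fact0 divr1. Qed.

Lemma binc_diff z k : k.+1%:R * binc z k.+1 = z * binc (z + 1) k.
Proof.
rewrite /binc pochSl factS natrM invfM.
have := fact_neq0 R[i] k; have : k.+1%:R != 0 :> R[i] by rewrite pnatr_eq0.
by move=> h1 h2; field; rewrite nat1r h2 h1.
Qed.

Lemma binc_rec z k : binc (z + 1) k.+1 - binc (z + 1) k = binc z k.+1.
Proof.
rewrite /binc [poch z _]pochSl pochS factS natrM.
have h1 := fact_neq0 R[i] k; have h2 : k.+1%:R != 0 :> R[i] by rewrite pnatr_eq0.
by rewrite -natr1; field; rewrite natr1 h1 h2.
Qed.

(** These are partial sums of (1 - q)^(-N). Multiplying by 1 - q lowers [N] by Pascal's rule, whence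
    the induction. A bound explicit in [N] is what [moebius_pseries] needs, where the exponent grows
    with the summation index. *)
Lemma rising_sum_le (q : R) N n : 0 <= q < 1 ->
  \sum_(0 <= k < n) poch N%:R k / k`!%:R * q ^+ k <= ((1 - q) ^+ N)^-1.
Proof.
move=> /andP[q0 q1]; have q1' : 0 < 1 - q by rewrite subr_gt0.
elim: N n => [|N IH] n.
  rewrite expr0 invr1; case: n => [|n]; first by rewrite big_nil.
  rewrite big_nat_recl//= poch0 mulr1 divr1 big1 ?addr0// => k _.
  by rewrite pochSl !mul0r.
rewrite exprS invfM mulrC ler_pdivlMr//; apply: le_trans (IH n).
case: n => [|n]; first by rewrite !big_nil mul0r.
rewrite mulrBr mulr1 lerBlDr [leLHS]big_nat_recl//= [in leRHS]big_nat_recl//=.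
rewrite !poch0 -addrA lerD2l.
have key k : poch N.+1%:R k.+1 / k.+1`!%:R = poch N%:R k.+1 / k.+1`!%:R +
    poch N.+1%:R k / k`!%:R :> R.
  rewrite [poch N%:R _]pochSl pochS factS natrM natr1.
  have -> : N.+1%:R + k%:R = N%:R + k.+1%:R :> R by rewrite -!natr1; ring.
  have h1 := fact_neq0 R k; have h2 : k.+1%:R != 0 :> R by rewrite pnatr_eq0.
  by field; rewrite ?nat1r ?natr1 h1 h2.
under eq_bigr do rewrite key mulrDl.
rewrite big_split/= lerD2l big_nat_recr//= mulrDl mulr_suml.
under eq_bigr do rewrite exprSr mulrA.
rewrite lerDl !mulr_ge0// ?invr_ge0// ?exprn_ge0//; exact: poch_ge0.
Qed.

End BinomialSeries.

Section BinomialTheorem.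
Context {R : realType}.
Implicit Types (z : R[i]) (x q : R) (w : nat -> R[i]).

Lemma natr_bound (y : R) : exists N : nat, y <= N%:R.
Proof.
exists (Num.truncn `|y|).+1; apply/ltW.
by apply: le_lt_trans (ler_norm y) _; rewrite truncnS_gt.
Qed.

Lemma cmod_binc_le z N k : cmod z <= N%:R ->
  cmod (binc z k) <= poch N%:R k / k`!%:R.
Proof.
move=> zN; rewrite /binc cmodM cmodV cmod_nat ler_pM2r ?invr_gt0 ?ltr0n ?fact_gt0//.
by rewrite (le_trans (cmod_poch_le _ _))// ler_poch// cmod_ge0.
Qed.

Lemma binc_bdsum z q : 0 <= q < 1 -> bdsum (fun k => cmod (binc z k) * q ^+ k).
Proof.
move=> q01; have [N zN] := natr_bound (cmod z).
exists ((1 - q) ^+ N)^-1 => n; apply: le_trans (rising_sum_le N n q01).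
by apply: ler_sum => k _; rewrite ler_wpM2r ?exprn_ge0 ?(andP q01).1// cmod_binc_le.
Qed.

(** Split into components so that termwise differentiation of real power series applies to each. *)
Definition cpseries w x : R[i] :=
  limn (pseries ((fun k => complex.Re (w k))) x) +i* limn (pseries ((fun k => complex.Im (w k))) x).

Lemma is_cvg_cpseries w q : 0 <= q -> bdsum (fun k => cmod (w k) * q ^+ k) ->
  cvgn (pseries ((fun k => complex.Re (w k))) q) /\ cvgn (pseries ((fun k => complex.Im (w k))) q).
Proof.
move=> q0 hw; have [|s /kcvg_ReIm[[h1] [h2]]] := @abs_summable _ (fun k => w k * q%:C ^+ k).
  have [M hM] := hw; exists M => n; apply: le_trans (hM n); apply: ler_sum => k _ /=.
  by rewrite cmodM cmodX cmodR ger0_norm.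
split; apply/cvg_ex; eexists; [apply: cvg_trans h1|apply: cvg_trans h2];
  apply: near_eq_cvg; apply: nearW => n; rewrite /pseries /series/=.
  rewrite Re_sum; apply: eq_bigr => k _.
  by rewrite -rmorphXn/= cReM/= mulr0 subr0.
rewrite Im_sum; apply: eq_bigr => k _.
by rewrite -rmorphXn/= cImM/= mulr0 add0r.
Qed.

Lemma cpseries_sum w x : bdsum (fun k => cmod (w k) * `|x| ^+ k) ->
  ksum (fun k => w k * x%:C ^+ k) (cpseries w x).
Proof.
move=> hw; have [|s hs] := @abs_summable _ (fun k => w k * x%:C ^+ k).
  have [M hM] := hw; exists M => n; apply: le_trans (hM n); apply: ler_sum => k _ /=.
  by rewrite cmodM cmodX cmodR.
suff -> : cpseries w x = s by [].
have /kcvg_ReIm[h1 h2] := hs.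
apply: complex_eqP => /=; apply: kcvg_lim.
  apply: (kcvg_eq h1) => n; rewrite /series/= Re_sum; apply: eq_bigr => k _.
  by rewrite -rmorphXn/= cReM/= mulr0 subr0.
apply: (kcvg_eq h2) => n; rewrite /series/= Im_sum; apply: eq_bigr => k _.
by rewrite -rmorphXn/= cImM/= mulr0 add0r.
Qed.

Definition cdiffs w : nat -> R[i] := fun k => k.+1%:R * w k.+1.

(** Differentiating termwise at [x] rests on convergence, at a larger radius [q], of the series and
    of its first two formal derivatives. *)
Lemma cpseries_derive w x q : `|x| < q ->
  bdsum (fun k => cmod (w k) * q ^+ k) ->
  bdsum (fun k => cmod (cdiffs w k) * q ^+ k) ->
  bdsum (fun k => cmod (cdiffs (cdiffs w) k) * q ^+ k) ->
  is_cderive x (cpseries w) (cpseries (cdiffs w) x).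
Proof.
move=> xq h0 h1 h2; have q0 : 0 <= q by rewrite (le_trans _ (ltW xq)).
have eR (v : nat -> R[i]) :
    pseries_diffs ((fun k => complex.Re (v k))) = (fun k => complex.Re (cdiffs v k)).
  apply/funext => k; rewrite /pseries_diffs/cdiffs/= cReM.
  by rewrite Re_nat Im_nat mul0r subr0.
have eI (v : nat -> R[i]) :
    pseries_diffs ((fun k => complex.Im (v k))) = (fun k => complex.Im (cdiffs v k)).
  apply/funext => k; rewrite /pseries_diffs/cdiffs/= cImM.
  by rewrite Re_nat Im_nat mul0r addr0.
have [a0 b0] := is_cvg_cpseries q0 h0.
have [a1 b1] := is_cvg_cpseries q0 h1.
have [a2 b2] := is_cvg_cpseries q0 h2.
split; rewrite /cpseries/=.
  by rewrite -eR; apply: (@pseries_snd_diffs _ _ q); rewrite ?eR// (ger0_norm q0).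
by rewrite -eI; apply: (@pseries_snd_diffs _ _ q); rewrite ?eI// (ger0_norm q0).
Qed.

Lemma cdiffs_binc z : cdiffs (binc z) = (fun k => z * binc (z + 1) k).
Proof. by apply/funext => k; rewrite /cdiffs binc_diff. Qed.

Lemma cpseries_binc_derive z x : `|x| < 1 ->
  is_cderive x (cpseries (binc z)) (z * cpseries (binc (z + 1)) x).
Proof.
move=> x1; pose q := (`|x| + 1) / 2.
have q01 : 0 <= q < 1 by rewrite /q; have := normr_ge0 x; lra.
have xq : `|x| < q by rewrite /q; lra.
have hZ (c : R[i]) y : bdsum (fun k => cmod (c * binc y k) * q ^+ k).
  under eq_fun do rewrite cmodM -mulrA.
  exact: bdsumZ (cmod_ge0 _) (binc_bdsum _ _).
have -> : z * cpseries (binc (z + 1)) x = cpseries (cdiffs (binc z)) x.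
  rewrite cdiffs_binc; apply: (@ksum_unique _ (fun k => z * binc (z + 1) k * x%:C ^+ k)).
    have x01 : 0 <= `|x| < 1 by rewrite normr_ge0.
    apply: (ksum_eq (ksumZ z (cpseries_sum (binc_bdsum (z + 1) x01)))) => k.
    by rewrite mulrA.
  apply: cpseries_sum; under eq_fun do rewrite cmodM -mulrA.
  apply: bdsumZ (cmod_ge0 _) (binc_bdsum _ _).
  by rewrite normr_ge0.
apply: (cpseries_derive xq); first exact: binc_bdsum.
  by rewrite cdiffs_binc; exact: hZ.
have -> : cdiffs (cdiffs (binc z)) = (fun k => (z * (z + 1)) * binc (z + 1 + 1) k).
  apply/funext => k; rewrite cdiffs_binc /cdiffs mulrCA binc_diff.
  by rewrite mulrA.
exact: hZ.
Qed.

(** Pascal's rule [binc_rec] read on the series. Combined with the derivative it yields the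
    differential equation (1 - x) f' = z f. *)
Lemma cpseries_binc_rec z x : `|x| < 1 ->
  cpseries (binc z) x = (1 - x%:C) * cpseries (binc (z + 1)) x.
Proof.
move=> x1; have x01 : 0 <= `|x| < 1 by rewrite normr_ge0.
have h0 := cpseries_sum (binc_bdsum z x01).
have h1 := cpseries_sum (binc_bdsum (z + 1) x01).
apply: (ksum_unique h0); rewrite mulrBl mul1r.
have -> : cpseries (binc (z + 1)) x - x%:C * cpseries (binc (z + 1)) x =
  binc z 0 * x%:C ^+ 0 + (cpseries (binc (z + 1)) x -
     binc (z + 1) 0 * x%:C ^+ 0 - x%:C * cpseries (binc (z + 1)) x).
  by rewrite !binc0; ring.
apply: (ksum_recl (fun k => binc z k * x%:C ^+ k) _).1.
have h2 : ksum (fun k => binc (z + 1) k.+1 * x%:C ^+ k.+1)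
   (cpseries (binc (z + 1)) x - binc (z + 1) 0 * x%:C ^+ 0).
  apply: (ksum_recl (fun k => binc (z + 1) k * x%:C ^+ k) _).2.
  by rewrite /= subrKC; exact: h1.
apply: (ksum_eq (ksumB h2 (ksumZ x%:C h1))) => k.
by rewrite -(binc_rec z k) !exprS; ring.
Qed.

(** The series times (1 - x)^z has zero derivative on the unit interval around 0 and equals 1 at 0,
    hence is constantly 1. *)
Lemma binomial_series z x : `|x| < 1 ->
  ksum (fun k => binc z k * x%:C ^+ k) (cexp (- z * (ln (1 - x))%:C)).
Proof.
move=> x1; have x01 : 0 <= `|x| < 1 by rewrite normr_ge0.
have h0 := cpseries_sum (binc_bdsum z x01).
suff -> : cexp (- z * (ln (1 - x))%:C) = cpseries (binc z) x by [].
pose g t := cexp (z * (ln (1 - t))%:C) * cpseries (binc z) t.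
have dg t : `|t| < 1 -> is_cderive t g 0.
  move=> t1; have t1' : 0 < 1 - t by rewrite subr_gt0 (le_lt_trans (ler_norm _)).
  have dl : is_derive t 1 (fun t => ln (1 - t)) (- (1 - t)^-1).
    have l1 := is_derive1_ln t1'.
    have l2 : is_derive t 1 (fun t => 1 - t) (-1).
      have h := is_deriveB (is_derive_cst (1 : R) t (1 : R)) (is_derive_id t (1 : R)).
      by apply: (is_derive_eq h); rewrite sub0r.
    have h := @is_derive1_comp _ (@ln R) (fun t => 1 - t) t _ _ l1 l2.
    by apply: (is_derive_eq h); rewrite mulrN1.
  apply: (is_cderive_eq (is_cderiveM (is_cderive_cexp (is_cderiveZ z
    (is_cderive_real dl))) (cpseries_binc_derive z t1))).
  rewrite (cpseries_binc_rec z t1) rmorphN fmorphV rmorphB rmorph1/=.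
  have : 1 - t%:C != 0 by rewrite -(rmorph1 (real_complex R)) -rmorphB/=
     (inj_eq (@complexI R)) gt_eqF.
  by move=> ?; field.
have g0 : g 0 = 1.
  rewrite /g subr0 ln1 mulr0 cexp0 mul1r.
  have n0 : `|0 : R| < 1 by rewrite normr0.
  have n01 : 0 <= `|0 : R| < 1 by rewrite normr_ge0.
  apply: (ksum_unique (cpseries_sum (binc_bdsum z n01))).
  have -> : (1 : R[i]) = \sum_(0 <= k < 1) (binc z k * 0%:C ^+ k).
    by rewrite big_nat1 binc0 mulr1.
  by apply: ksum_finite => -[//|k] _; rewrite exprS mul0r mulr0.
have gx : g x = 1.
  rewrite -g0; have [x0|x0] := leP 0 x.
    apply/esym; apply: is_cderive0_cst x0 _ => t /andP[t0 tx].
    by apply: dg; rewrite ger0_norm// (le_lt_trans tx)// (le_lt_trans (ler_norm _)).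
  apply: is_cderive0_cst (ltW x0) _ => t /andP[xt t0].
  apply: dg; rewrite ler0_norm// (le_lt_trans _ x1)// (ltr0_norm x0).
  by rewrite lerN2.
by rewrite mulNr cexpN -[RHS](mulKf (cexp_neq0 (z * (ln (1 - x))%:C))) -/(g x) gx mulr1.
Qed.

End BinomialTheorem.

(** * Power series: uniqueness, recentring, identity principle *)

Section PowerSeries.
Context {R : realType}.
Implicit Types (c d w G : nat -> R[i]) (f g F : R -> R[i]) (x h q r : R).

Lemma ksum_bounded (u : nat -> R[i]) s : ksum u s ->
  exists M : R, forall k, cmod (u k) <= M.
Proof.
move=> /ksum_cvg0/kcvg_cmodl [h].
have cu : cvgn (fun k => cmod (u k)) by apply/cvg_ex; exists (cmod 0).
have [M hM] := cvg_has_ub cu.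
exists M => k; rewrite -(ger0_norm (cmod_ge0 (u k))).
by apply: hM; exists k.
Qed.

(** The constant term is the limit of the sums as x tends to 0 from the right. Along the points
    [y n], at most half of [x1], the terms are dominated by M / 2^k, where [M] bounds the terms at
    [x1]; [tannery] then takes the limit inside. *)
Lemma pseries0_coef0 d r : 0 < r ->
  (forall x, 0 < x < r -> ksum (fun k => d k * x%:C ^+ k) 0) -> d 0%N = 0.
Proof.
move=> r0 hd; pose x1 := r / 2.
have x10 : 0 < x1 by rewrite divr_gt0.
have hx1 : 0 < x1 < r by rewrite x10/= /x1; lra.
have [M hM] := ksum_bounded (hd _ hx1).
have M0 : 0 <= M := le_trans (cmod_ge0 _) (hM 0%N).
pose y n : R := x1 / 2 * harmonic n.
have hh n : 0 < (harmonic n : R) <= 1.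
  by rewrite harmonic_gt0/= invf_le1 ?ltr0n// ler1n.
have hy n : 0 < y n < r.
  have /andP[h0 h1] := hh n.
  have x2 : 0 < x1 / 2 by rewrite divr_gt0.
  rewrite /y mulr_gt0//= (le_lt_trans (ler_piMr (ltW x2) h1))//.
  by rewrite /x1; lra.
have yx n : y n / x1 <= 1 / 2.
  have /andP[h0 h1] := hh n.
  have x2 : 0 <= x1 / 2 by rewrite divr_ge0 ?ltW.
  by rewrite ler_pdivrMr// /y (le_trans (ler_piMr x2 h1))//; lra.
have q12 : 0 <= (1 / 2 : R) < 1 by lra.
have key := @tannery _ (fun n k => d k * (y n)%:C ^+ k) (fun=> 0)
  (fun k => if k is 0 then d 0%N else 0) (d 0%N) (fun k => M * (1 / 2) ^+ k)
  (bdsumZ M0 (bdsum_geometric q12)).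
suff : kcvg \oo (fun=> 0) (d 0%N) by move/(kcvg_unique (kcvg_cst 0)) <-.
apply: key.
- move=> n k; have -> : d k * (y n)%:C ^+ k = d k * x1%:C ^+ k * (y n / x1)%:C ^+ k.
    by rewrite -mulrA -exprMn -rmorphM/= mulrCA divff ?gt_eqF// mulr1.
  have yx0 : 0 <= y n / x1 by rewrite divr_ge0 ?ltW//; have /andP[] := hy n.
  rewrite cmodM ler_pM ?cmod_ge0// cmodX cmodR ger0_norm//.
  by rewrite lerXn2r ?nnegrE// divr_ge0.
- case=> [|k].
    by apply: (kcvg_eq (kcvg_cst (d 0%N))) => n; rewrite expr0 mulr1.
  have y0 : kcvg \oo (fun n => (y n)%:C) 0.
    apply: kcvg_real; split; rewrite -(mulr0 (x1 / 2)).
    by apply: cvgMr; exact: cvg_harmonic.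
  rewrite -(mulr0 (d k.+1)); apply: kcvgZl.
  elim: k => [|k IH]; first by under eq_fun do rewrite expr1.
  rewrite -(mulr0 0); under eq_fun do rewrite exprS; exact: kcvgM.
- by move=> n; exact: hd.
- have := @ksum_finite _ (fun k => if k is 0 then d 0%N else 0) 1.
  by rewrite big_nat1; apply; case.
Qed.

Lemma pseries0_coef d r : 0 < r ->
  (forall x, 0 < x < r -> ksum (fun k => d k * x%:C ^+ k) 0) ->
  forall k, d k = 0.
Proof.
move=> r0 hd; suff H m : (forall x, 0 < x < r ->
    ksum (fun k => d (m + k)%N * x%:C ^+ k) 0).
  by move=> k; have := pseries0_coef0 r0 (H k); rewrite addn0.
elim: m => [//|m IH] x xr.
have d0 : d m = 0 by have := pseries0_coef0 r0 IH; rewrite addn0.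
have x0 : x%:C != 0 by rewrite (inj_eq (@complexI R)) gt_eqF// (andP xr).1.
have h1 : ksum (fun k => d (m + k.+1)%N * x%:C ^+ k.+1) 0.
  apply: (ksum_recl (fun k => d (m + k)%N * x%:C ^+ k) _).2.
  by rewrite /= addn0 d0 mul0r add0r; exact: IH.
rewrite -(mulr0 x%:C^-1); apply: (ksum_eq (ksumZ _ h1)) => k.
by rewrite addnS exprS mulrCA mulKf.
Qed.

(** A connectedness argument on the half-line: agreement is pushed leftwards past the last point [s]
    down to which it holds. *)
Lemma analytic_identity_left f g (L r : R) : 0 < r ->
  (forall x, L < x <= 0 -> real_analytic_at f x) ->
  (forall x, L < x <= 0 -> real_analytic_at g x) ->
  (forall x, - r < x <= 0 -> f x = g x) ->
  forall x, L < x <= 0 -> f x = g x.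
Proof.
move=> r0 af ag fg x Lx.
apply: contrapT => fgx.
(* At s = inf S the two local expansions agree just to the right of s, hence have equal
   coefficients, hence agree also to the left of s, against the choice of s. The point [x] only
   serves to bound [S] from below. *)
pose S := [set y | y <= 0 /\ forall t, y < t <= 0 -> f t = g t].
have Slb y : S y -> x <= y.
  move=> [y0 hy]; rewrite leNgt; apply/negP => yx; apply: fgx; apply: hy.
  by rewrite yx (andP Lx).2.
have Sr : S (- r) by split; [rewrite oppr_le0 ltW|].
have hS : has_inf S by split; [exists (- r)|exists x => y /Slb].
pose s := inf S.
have xs : x <= s by apply: lb_le_inf; [exact: hS.1|move=> y /Slb].
have sr : s <= - r by apply: ge_inf => //; exact: hS.2.
have hs t : s < t <= 0 -> f t = g t.
  move=> /andP[st t0]; have [y [y0 hy] yt] := inf_lt hS.1 st.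
  by apply: hy; rewrite yt t0.
have Ls : L < s <= 0.
  by rewrite (lt_le_trans (andP Lx).1 xs) (le_trans sr)// oppr_le0 ltW.
have [c [r1 r10 hc]] := af _ Ls; have [d [r2 r20 hd]] := ag _ Ls.
pose e := Num.min r (Num.min r1 r2).
have e0 : 0 < e by rewrite !lt_min r0 r10.
have er1 : e <= r1 by rewrite /e !ge_min lexx orbT.
have er2 : e <= r2 by rewrite /e !ge_min lexx !orbT.
have er : e <= r by rewrite /e ge_min lexx.
have cd k : c k - d k = 0.
  apply: (pseries0_coef (d := fun k => c k - d k) e0) => t /andP[t0 te].
  have -> : (0 : R[i]) = f (t + s) - g (t + s).
    by rewrite hs ?subrr//; apply/andP; split; lra.
  have ht : `|t + s - s| = t by rewrite addrK gtr0_norm.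
  have h1 := hc (t + s); have h2 := hd (t + s).
  rewrite ht addrK in h1 h2.
  have {}h1 := (ksumP _ _).2 (h1 (lt_le_trans te er1)).
  have {}h2 := (ksumP _ _).2 (h2 (lt_le_trans te er2)).
  by apply: (ksum_eq (ksumB h1 h2)) => j; rewrite mulrBl.
have : S (s - e / 2).
  split; first by lra.
  move=> t /andP[set t0]; have [st|ts] := ltP s t; first by apply: hs; rewrite st.
  have ht : `|t - s| < e by rewrite ler0_norm ?subr_le0//; lra.
  have h1 := (ksumP _ _).2 (hc _ (lt_le_trans ht er1)).
  have h2 := (ksumP _ _).2 (hd _ (lt_le_trans ht er2)).
  apply: (ksum_unique h1); apply: (ksum_eq h2) => k.
  by move/eqP: (cd k); rewrite subr_eq0 => /eqP ->.
move/(ge_inf hS.2); rewrite -/s; lra.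
Qed.

Lemma double_ksum_col (U : nat -> nat -> R[i]) (c : nat -> R[i]) (M : R) :
  (forall n m, \sum_(0 <= i < n) \sum_(0 <= j < m) cmod (U i j) <= M) ->
  (forall j, ksum (U^~ j) (c j)) ->
  forall m, \sum_(0 <= j < m) cmod (c j) <= M.
Proof.
move=> hM hc m.
have h : kcvg \oo (fun n => \sum_(0 <= j < m) cmod (series (U^~ j) n))
    (\sum_(0 <= j < m) cmod (c j)).
  by apply: kcvg_sum => j; exact: (kcvg_cmodl (hc j)).
apply: (kcvg_le h); apply: nearW => n; apply: le_trans (hM n m).
by rewrite exchange_big/=; apply: ler_sum => j _; exact: cmod_sum.
Qed.

(** Expanding (x0 + h)^k by the binomial theorem gives a double series, absolutely summable as soon
    as |x0| + |h| stays below the radius; summing by columns gives the series in h. Summability at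
    the end point [r] itself is recorded for the later Moebius substitution. *)
Lemma pseries_recenter w F (rho x0 : R) :
  (forall q, 0 <= q < rho -> bdsum (fun k => cmod (w k) * q ^+ k)) ->
  (forall x, `|x| < rho -> ksum (fun k => w k * x%:C ^+ k) (F x)) ->
  `|x0| < rho ->
  exists G, exists2 r, 0 < r & bdsum (fun k => cmod (G k) * r ^+ k) /\
    forall h, `|h| <= r -> ksum (fun k => G k * h%:C ^+ k) (F (x0 + h)).
Proof.
move=> hw hF x0r; pose r := (rho - `|x0|) / 2.
have r0 : 0 < r by rewrite divr_gt0// subr_gt0.
have x0n := normr_ge0 x0.
have [|M hM] := hw (`|x0| + r).
  by rewrite addr_ge0 ?(ltW r0)//= /r; lra.
pose U (h : R) k j : R[i] := w k * ('C(k, j)%:R * x0%:C ^+ (k - j) * h%:C ^+ j).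
have bM h n m : `|h| <= r ->
    \sum_(0 <= i < n) \sum_(0 <= j < m) cmod (U h i j) <= M.
  move=> hr; apply: le_trans (hM n); apply: ler_sum => k _.
  rewrite /U; under eq_bigr do rewrite cmodM.
  rewrite -mulr_sumr ler_wpM2l ?cmod_ge0//.
  apply: (@le_trans _ _ (\sum_(0 <= j < m)
      'C(k, j)%:R * `|x0| ^+ (k - j) * r ^+ j)).
    apply: ler_sum => j _; rewrite !cmodM !cmodX !cmodR cmod_nat.
    rewrite ler_wpM2l ?mulr_ge0 ?exprn_ge0//.
    by rewrite lerXn2r ?nnegrE ?normr_ge0 ?(ltW r0).
  have pos j : 0 <= 'C(k, j)%:R * `|x0| ^+ (k - j) * r ^+ j.
    by rewrite !mulr_ge0 ?exprn_ge0// (ltW r0).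
  apply: (@le_trans _ _ (\sum_(0 <= j < maxn m k.+1)
      'C(k, j)%:R * `|x0| ^+ (k - j) * r ^+ j)).
    by rewrite [leRHS](big_cat_nat (n := m))//= ?leq_maxl// lerDl sumr_ge0.
  rewrite (big_cat_nat (n := k.+1))//= ?leq_maxr//.
  rewrite [X in _ + X]big_nat [X in _ + X]big1 ?addr0; last first.
    by move=> j /andP[kj _]; rewrite bin_small// !mul0r.
  rewrite exprDn big_mkord; apply: ler_sum => j _.
  by rewrite -[leRHS]mulr_natl mulrA.
have row h k : ksum (U h k) (w k * (x0 + h)%:C ^+ k).
  have -> : w k * (x0 + h)%:C ^+ k = \sum_(0 <= j < k.+1) U h k j.
    rewrite rmorphD exprDn mulr_sumr big_mkord; apply: eq_bigr => j _.
    by rewrite /U -[X in _ * X = _]mulr_natl mulrA.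
  by apply: ksum_finite => j kj; rewrite /U bin_small// !mul0r mulr0.
have rr : `|r| <= r by rewrite gtr0_norm.
have [_ [c [_ [_ hc _ _]]]] := double_ksum (fun n m => bM r n m rr).
have rC : r%:C != 0 by rewrite (inj_eq (@complexI R)) gt_eqF.
(* The coefficients are read off the column sums at h = r; for another h, column j is merely scaled
   by (h / r)^j. *)
exists (fun j => c j / r%:C ^+ j), r => //; split.
  exists M => m; apply: le_trans (double_ksum_col (fun n m => bM r n m rr) hc m).
  apply: ler_sum => j _; rewrite cmodM cmodV cmodX cmodR gtr0_norm//.
  by rewrite divfK// expf_neq0// gt_eqF.
move=> h hr.
have [R1 [c1 [s [hR1 hc1 hR1s hc1s]]]] := double_ksum (fun n m => bM h n m hr).
have R1E k : R1 k = w k * (x0 + h)%:C ^+ k by apply: ksum_unique (hR1 k) (row h k).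
have -> : F (x0 + h) = s.
  apply: ksum_unique (ksum_eq hR1s R1E); apply: hF.
  rewrite (le_lt_trans (ler_normD _ _))// (le_lt_trans (lerD (lexx _) hr))//.
  by rewrite /r; lra.
apply: (ksum_eq hc1s) => j; apply: ksum_unique (hc1 j) _.
have := ksumZ (h%:C ^+ j / r%:C ^+ j) (hc j).
have -> : c j / r%:C ^+ j * h%:C ^+ j = h%:C ^+ j / r%:C ^+ j * c j by ring.
move/ksum_eq; apply => k; rewrite /U.
have : r%:C ^+ j != 0 by rewrite expf_neq0.
by move=> ?; field.
Qed.

Lemma pseries_analytic w F (rho x0 : R) :
  (forall q, 0 <= q < rho -> bdsum (fun k => cmod (w k) * q ^+ k)) ->
  (forall x, `|x| < rho -> ksum (fun k => w k * x%:C ^+ k) (F x)) ->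
  `|x0| < rho -> real_analytic_at F x0.
Proof.
move=> hw hF hx0; have [G [r r0 [_ hG]]] := pseries_recenter hw hF hx0.
exists G, r => // x xr; apply/ksumP.
by have := hG (x - x0) (ltW xr); rewrite subrKC.
Qed.

End PowerSeries.

(** * Substituting h / (1 - h) into a power series *)

Section MoebiusSeries.
Context {R : realType}.
Implicit Types (G e : nat -> R[i]) (a : R[i]) (h rho : R).

Lemma sum_shift (V : nmodType) (v : nat -> V) i m :
  \sum_(0 <= j < m) (if (i <= j)%N then v (j - i)%N else 0) =
  \sum_(0 <= l < m - i) v l.
Proof.
elim: m => [|m IH]; first by rewrite sub0n !big_nil.
rewrite big_nat_recr//= IH; case: leqP => im.
  by rewrite subSn// big_nat_recr.
have := im; have := ltnW im; rewrite -!subn_eq0 => /eqP -> /eqP ->.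
by rewrite addr0.
Qed.

Lemma ksum_shift (v : nat -> R[i]) s i : ksum v s ->
  ksum (fun j => if (i <= j)%N then v (j - i)%N else 0) s.
Proof.
move=> vs; apply/(kcvg_shiftn _ i); apply: (kcvg_eq vs) => n.
by rewrite /series/= sum_shift addnK.
Qed.

(** Each (1 - h)^(-(a + i)) is expanded by the binomial series, and row i is shifted by i places so
    that column j collects h^j. The bound on |h| is equivalent to |h| / (1 - |h|) <= rho, which
    makes the double series absolutely summable. *)
Lemma moebius_pseries G a rho : 0 < rho ->
  bdsum (fun i => cmod (G i) * rho ^+ i) ->
  forall h, `|h| <= rho / (1 + rho) -> exists2 s,
    ksum (fun i => G i * h%:C ^+ i * cexp (- (a + i%:R) * (ln (1 - h))%:C)) s &
    ksum (fun j => (\sum_(0 <= i < j.+1) G i * binc (a + i%:R) (j - i)) *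
      h%:C ^+ j) s.
Proof.
move=> rho0 [M hM] h hr.
have rho1 : 0 < 1 + rho by rewrite addr_gt0.
have h1 : `|h| < 1.
  by rewrite (le_lt_trans hr)// ltr_pdivrMr// mul1r ltrDr.
have hq : 0 <= `|h| < 1 by rewrite normr_ge0.
have h1' : 0 < 1 - `|h| by rewrite subr_gt0.
have hrho : `|h| / (1 - `|h|) <= rho.
  rewrite ler_pdivrMr// mulrBr mulr1 lerBrDr -[X in X + _]mul1r.
  by rewrite -mulrDl mulrC -ler_pdivlMr.
(* A natural number above |a| bounds row i by (1 - |h|)^(-(N + i)), a power that splits into a
   constant and a geometric factor. *)
have [N aN] := natr_bound (cmod a).
pose V i l : R[i] := G i * h%:C ^+ i * (binc (a + i%:R) l * h%:C ^+ l).
pose U i j : R[i] := if (i <= j)%N then V i (j - i)%N else 0.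
have bM n m : \sum_(0 <= i < n) \sum_(0 <= j < m) cmod (U i j) <=
    ((1 - `|h|) ^+ N)^-1 * M.
  apply: (@le_trans _ _ (\sum_(0 <= i < n) (((1 - `|h|) ^+ N)^-1 *
      (cmod (G i) * rho ^+ i)))); last first.
    by rewrite -mulr_sumr ler_wpM2l// invr_ge0 exprn_ge0 ?(ltW h1').
  apply: ler_sum => i _.
  have -> : \sum_(0 <= j < m) cmod (U i j) = cmod (G i) * `|h| ^+ i *
      \sum_(0 <= l < m - i) cmod (binc (a + i%:R) l) * `|h| ^+ l.
    rewrite mulr_sumr -sum_shift; apply: eq_bigr => j _.
    by rewrite /U; case: leqP => _; rewrite ?cmod0// /V !cmodM !cmodX !cmodR.
  apply: (@le_trans _ _ (cmod (G i) * `|h| ^+ i * ((1 - `|h|) ^+ (N + i))^-1)).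
    rewrite ler_wpM2l ?mulr_ge0 ?cmod_ge0 ?exprn_ge0//.
    apply: le_trans (rising_sum_le (N + i) (m - i) hq).
    apply: ler_sum => l _; rewrite ler_wpM2r ?exprn_ge0//.
    apply: cmod_binc_le; rewrite natrD (le_trans (cmodD _ _))// cmod_nat.
    by rewrite lerD2r.
  have -> : cmod (G i) * `|h| ^+ i * ((1 - `|h|) ^+ (N + i))^-1 =
      ((1 - `|h|) ^+ N)^-1 * (cmod (G i) * (`|h| / (1 - `|h|)) ^+ i).
    by rewrite exprD invfM exprMn exprVn; ring.
  rewrite ler_wpM2l ?invr_ge0 ?exprn_ge0 ?(ltW h1')//.
  rewrite ler_wpM2l ?cmod_ge0// lerXn2r ?nnegrE ?(ltW rho0)//.
  by rewrite divr_ge0 ?(ltW h1').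
have row i : ksum (U i) (G i * h%:C ^+ i * cexp (- (a + i%:R) * (ln (1 - h))%:C)).
  exact/ksum_shift/ksumZ/binomial_series.
have [r [c [s [hr' hc rs cs]]]] := double_ksum bM.
exists s.
  by apply: (ksum_eq rs) => i; exact: ksum_unique (hr' i) (row i).
apply: (ksum_eq cs) => j; apply: (ksum_unique (hc j)).
have -> : (\sum_(0 <= i < j.+1) G i * binc (a + i%:R) (j - i)) * h%:C ^+ j =
    \sum_(0 <= i < j.+1) U i j.
  rewrite mulr_suml big_nat [RHS]big_nat; apply: eq_bigr => i /andP[_].
  rewrite ltnS => ij; rewrite /U ij /V -[in LHS](subnKC ij) exprD.
  by rewrite (subnKC ij); ring.
by apply: ksum_finite => i ji; rewrite /U leqNgt ji.
Qed.

End MoebiusSeries.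

(** * The Gauss series and its continuation by Pfaff's formula *)

Section GaussSeries.
Context {R : realType}.
Implicit Types (a b c : R[i]) (x y q : R).

Lemma ratio_bdsum (u : nat -> R) (t : R) N : 0 < t < 1 ->
  (forall k, 0 <= u k) -> (forall k, (N <= k)%N -> u k.+1 <= t * u k) -> bdsum u.
Proof.
move=> /andP[t0 t1] u0 ut.
have h j : u (N + j)%N <= u N * t ^+ j.
  elim: j => [|j IH]; first by rewrite addn0 mulr1.
  rewrite addnS (le_trans (ut _ _)) ?leq_addr// exprS mulrCA.
  by rewrite ler_wpM2l// ltW.
have t01 : 0 <= t < 1 by rewrite ltW.
apply: (@bdsum_le _ _ (fun k => u N / t ^+ N * t ^+ k) N).
- by move=> k; rewrite !mulr_ge0 ?invr_ge0 ?exprn_ge0 ?(ltW t0).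
- move=> k Nk; have := h (k - N)%N; rewrite subnKC// => /le_trans; apply.
  rewrite -mulrA ler_wpM2l// -[in leRHS](subnKC Nk) exprD mulKf//.
  by rewrite expf_neq0// gt_eqF.
- apply: bdsumZ; last exact: bdsum_geometric.
  by rewrite divr_ge0// exprn_ge0// ltW.
Qed.

Definition gcoef a b c k : R[i] := poch a k * poch b k / (poch c k * k`!%:R).

Lemma gcoef0 a b c : gcoef a b c 0 = 1.
Proof. by rewrite /gcoef !poch0 fact0 !mulr1 divr1. Qed.

Lemma gcoefS a b c k : gcoef a b c k.+1 =
  gcoef a b c k * ((a + k%:R) * (b + k%:R) / ((c + k%:R) * k.+1%:R)).
Proof. by rewrite /gcoef !pochS factS natrM !invfM; ring. Qed.

Lemma pFq_term_gauss a b c z k :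
  pFq_term [:: a; b] [:: c] z k = gcoef a b c k * z ^+ k.
Proof.
rewrite /pFq_term /gcoef !big_cons !big_nil !mulr1 invfM.
by ring.
Qed.

Lemma gcoef_bdsum a b c q : 0 < complex.Re c -> 0 <= q < 1 ->
  bdsum (fun k => cmod (gcoef a b c k) * q ^+ k).
Proof.
move=> c0 /andP[q0 q1].
(* Ratio test: the ratio is at most q (D + k)^2 / k^2, which falls below the midpoint [t] of q and 1
   once k >= (2D + D^2) / (t - q). *)
pose D := cmod a + cmod b; pose t := (1 + q) / 2.
have t01 : 0 < t < 1 by rewrite /t; lra.
have D0 : 0 <= D by rewrite addr_ge0 ?cmod_ge0.
have [N hN] := natr_bound ((2 * D + D ^+ 2) / (t - q)).
have tq : 0 < t - q by rewrite /t; lra.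
apply: (@ratio_bdsum _ t N.+1 t01).
  by move=> k; rewrite mulr_ge0 ?cmod_ge0 ?exprn_ge0.
move=> k Nk; rewrite gcoefS cmodM exprS.
set rt := cmod ((a + k%:R) * (b + k%:R) / ((c + k%:R) * k.+1%:R)).
have -> : cmod (gcoef a b c k) * rt * (q * q ^+ k) =
  (rt * q) * (cmod (gcoef a b c k) * q ^+ k) by ring.
rewrite ler_wpM2r ?mulr_ge0 ?cmod_ge0 ?exprn_ge0//.
have K1 : 1 <= k%:R :> R by rewrite ler1n (leq_trans _ Nk).
have hK : 2 * D + D ^+ 2 <= (t - q) * k%:R.
  rewrite -ler_pdivrMl// mulrC (le_trans hN)// ler_nat.
  exact: ltnW.
have ak : cmod (a + k%:R) <= D + k%:R.
  by rewrite (le_trans (cmodD _ _))// cmod_nat lerD2r lerDl cmod_ge0.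
have bk : cmod (b + k%:R) <= D + k%:R.
  by rewrite (le_trans (cmodD _ _))// cmod_nat lerD2r lerDr cmod_ge0.
have ck : k%:R <= cmod (c + k%:R).
  rewrite (le_trans _ (Re_le_cmod _))// cReD Re_nat (le_trans _ (ler_norm _))//.
  by rewrite lerDr ltW.
have ck0 : 0 < cmod (c + k%:R) by rewrite (lt_le_trans _ ck)// (lt_le_trans _ K1).
rewrite /rt cmodM cmodV !cmodM cmod_nat mulrAC ler_pdivrMr ?mulr_gt0//.
apply: (@le_trans _ _ ((D + k%:R) ^+ 2 * q)).
  by rewrite expr2 ler_wpM2r// ler_pM ?cmod_ge0.
apply: (@le_trans _ _ (t * (k%:R * k%:R))); last first.
  rewrite ler_wpM2l ?(ltW (andP t01).1)// ler_pM//.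
  by rewrite ler_nat.
set K : R := k%:R in K1 hK *.
have h1 : (2 * D + D ^+ 2) * K <= (t - q) * K * K.
  by rewrite ler_wpM2r// (le_trans _ K1).
have h2 : 2 * D * K * q <= 2 * D * K.
  by rewrite ler_piMr ?(ltW q1)// !mulr_ge0 ?(le_trans _ K1).
have h3 : D ^+ 2 * q <= D ^+ 2 * K.
  by rewrite ler_wpM2l ?exprn_ge0// (le_trans (ltW q1)).
have -> : (D + K) ^+ 2 * q = K * K * q + 2 * D * K * q + D ^+ 2 * q by ring.
have -> : t * (K * K) = K * K * q + (t - q) * K * K by ring.
have := lerD h2 h3; move: h1; rewrite mulrDl; lra.
Qed.

Definition gsum a b c x : R[i] := klim (fun k => gcoef a b c k * x%:C ^+ k).

Lemma gsumP a b c x : 0 < complex.Re c -> `|x| < 1 ->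
  ksum (fun k => gcoef a b c k * x%:C ^+ k) (gsum a b c x).
Proof.
move=> c0 x1; have [|s hs] := @abs_summable _ (fun k => gcoef a b c k * x%:C ^+ k).
  have x01 : 0 <= `|x| < 1 by rewrite normr_ge0.
  have [M hM] := gcoef_bdsum a b c0 x01; exists M => n.
  by under eq_bigr do rewrite /= cmodM cmodX cmodR.
by rewrite /gsum (ksum_lim hs).
Qed.

Lemma gsum_analytic a b c x0 : 0 < complex.Re c -> `|x0| < 1 ->
  real_analytic_at (gsum a b c) x0.
Proof.
move=> c0; apply: (@pseries_analytic _ (gcoef a b c)).
  by move=> q; exact: gcoef_bdsum.
by move=> x; exact: gsumP.
Qed.

(** (1 - x)^(-a) 2F1(a, c - b; c; x / (x - 1)). The inner argument stays in the unit disc for every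
    x < 1/2, so this continues the Gauss series to minus infinity. *)
Definition pfaff a b c x : R[i] :=
  cexp (- a * (ln (1 - x))%:C) * gsum a (c - b) c (x / (x - 1)).

(** With x = x0 + h (1 - x0) one has 1 - x = (1 - x0)(1 - h), and x / (x - 1) differs from its value
    at x0 by [k0] h / (1 - h). Both factors of [pfaff] thus take the shape handled by
    [moebius_pseries]. *)
Lemma pfaff_local a b c x0 (G : nat -> R[i]) r : x0 < 1 -> 0 < r ->
  bdsum (fun k => cmod (G k) * r ^+ k) ->
  (forall h, `|h| <= r -> ksum (fun k => G k * h%:C ^+ k)
     (gsum a (c - b) c (x0 / (x0 - 1) + h))) ->
  let rho := r * (1 - x0) in
  let k0 := - (1 - x0)^-1 in
  forall h, `|h| <= rho / (1 + rho) ->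
  ksum (fun j => cexp (- a * (ln (1 - x0))%:C) *
      (\sum_(0 <= i < j.+1) G i * k0%:C ^+ i * binc (a + i%:R) (j - i)) * h%:C ^+ j)
    (pfaff a b c (x0 + h * (1 - x0))).
Proof.
move=> x01 r0 hG hs rho k0 h hr.
have x0' : 0 < 1 - x0 by rewrite subr_gt0.
have rho0 : 0 < rho by rewrite mulr_gt0.
have rho1 : 0 < 1 + rho by rewrite addr_gt0.
have h1 : `|h| < 1.
  by rewrite (le_lt_trans hr)// ltr_pdivrMr// mul1r ltrDr.
have h1' : 0 < 1 - `|h| by rewrite subr_gt0.
have h2 : 0 < 1 - h by rewrite subr_gt0 (le_lt_trans (ler_norm _)).
have [|s s1 s2] := @moebius_pseries _ (fun i => G i * k0%:C ^+ i) a rho rho0 _ h hr.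
  have [M hM] := hG; exists M => n; apply: le_trans (hM n).
  apply: ler_sum => k _; rewrite cmodM cmodX cmodR /k0 normrN gtr0_norm ?invr_gt0//.
  by rewrite -mulrA -exprMn /rho mulrCA mulVf ?mulr1// gt_eqF.
have x1E : 1 - (x0 + h * (1 - x0)) = (1 - x0) * (1 - h) by ring.
have yE : (x0 + h * (1 - x0)) / (x0 + h * (1 - x0) - 1) =
    x0 / (x0 - 1) + k0 * (h / (1 - h)).
  have -> : x0 + h * (1 - x0) - 1 = - ((1 - x0) * (1 - h)) by ring.
  rewrite /k0; have -> : x0 - 1 = - (1 - x0) by ring.
  field; rewrite !gt_eqF ?oppr_eq0//.
have hk : `|k0 * (h / (1 - h))| <= r.
  rewrite normrM normrN normfV (gtr0_norm x0') ler_pdivrMl// [_ * r]mulrC -/rho.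
  rewrite normrM normfV (gtr0_norm h2).
  apply: (@le_trans _ _ (`|h| / (1 - `|h|))).
    rewrite ler_wpM2l// lef_pV2 ?posrE// lerD2l lerN2 ler_norm//.
  rewrite ler_pdivrMr// mulrBr mulr1 lerBrDr -[X in X + _]mul1r.
  by rewrite -mulrDl mulrC -ler_pdivlMr.
have s3 := hs _ hk.
suff -> : pfaff a b c (x0 + h * (1 - x0)) = cexp (- a * (ln (1 - x0))%:C) * s.
  by apply: (ksum_eq (ksumZ _ s2)) => j; rewrite mulrA.
rewrite /pfaff yE x1E lnM ?posrE// rmorphD mulrDr cexpD -mulrA; congr (_ * _).
apply: (ksum_unique (ksumZ _ s3)); apply: (ksum_eq s1) => i.
rewrite mulNr cexpN mulrDl cexpD invfM cexp_natl cexp_real lnK//.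
rewrite -cexpN -mulNr !rmorphM/= fmorphV exprMn exprMn exprVn; ring.
Qed.

Lemma pfaff_analytic a b c x0 : 0 < complex.Re c -> x0 < 1 / 2 ->
  real_analytic_at (pfaff a b c) x0.
Proof.
move=> c0 x0h; have x01 : x0 < 1 by lra.
have x0' : 0 < 1 - x0 by rewrite subr_gt0.
have y1 : `|x0 / (x0 - 1)| < 1.
  rewrite normrM normfV (ltr0_norm (_ : x0 - 1 < 0)) ?subr_lt0// opprB.
  by rewrite ltr_pdivrMr// mul1r ltr_norml; apply/andP; split; lra.
have [||G [r r0 [hG hs]]] := @pseries_recenter _ (gcoef a (c - b) c)
  (gsum a (c - b) c) 1 (x0 / (x0 - 1)) _ _ y1.
- by move=> q; exact: gcoef_bdsum.
- by move=> x; exact: gsumP.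
have key := pfaff_local x01 r0 hG hs.
pose e j : R[i] := cexp (- a * (ln (1 - x0))%:C) *
  (\sum_(0 <= i < j.+1) G i * (- (1 - x0)^-1)%:C ^+ i * binc (a + i%:R) (j - i)).
exists (fun j => e j * ((1 - x0)^-1)%:C ^+ j),
  (r * (1 - x0) / (1 + r * (1 - x0)) * (1 - x0)).
  by rewrite mulr_gt0// divr_gt0 ?mulr_gt0// addr_gt0// mulr_gt0.
move=> x xr; apply/ksumP.
have xE : x0 + (x - x0) / (1 - x0) * (1 - x0) = x.
  by rewrite divfK ?gt_eqF// subrKC.
have := key ((x - x0) / (1 - x0)); rewrite xE.
rewrite normrM normfV (gtr0_norm x0') ler_pdivrMr// => /(_ (ltW xr)).
move/ksum_eq; apply => j; rewrite -/(e j) -mulrA -exprMn -rmorphM/=.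
by congr (_ * (real_complex R _) ^+ _); rewrite mulrC.
Qed.

(** Coefficients of Pfaff's formula at 0. Factoring out (a)_j / (j! (c)_j) leaves a Vandermonde sum
    whose value involves c - (c - b) = b. *)
Lemma pfaff_coef a b c j : 0 < complex.Re c ->
  \sum_(0 <= i < j.+1) gcoef a (c - b) c i * (-1) ^+ i * binc (a + i%:R) (j - i)
  = gcoef a b c j.
Proof.
move=> c0; have pc k : poch c k != 0 by exact: poch_Re_gt0.
transitivity (poch a j / (j`!%:R * poch c j) *
   \sum_(0 <= i < j.+1) (-1) ^+ i * 'C(j, i)%:R * poch (c - b) i *
     poch (c + i%:R) (j - i)).
  rewrite mulr_sumr big_nat [RHS]big_nat; apply: eq_bigr => i /andP[_].
  rewrite ltnS => ij; rewrite /gcoef /binc.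
  have eC := bin_fact ij; have {}eC : 'C(j, i)%:R * (i`!%:R * (j - i)`!%:R) = j`!%:R :> R[i].
    by rewrite -!natrM eC.
  rewrite -eC (poch_split a ij) (poch_split c ij).
  have h1 := fact_neq0 R[i] i; have h2 := fact_neq0 R[i] (j - i).
  have h3 := pc i.
  have h4 : poch (c + i%:R) (j - i) != 0.
    by apply: poch_neq0 => k; rewrite -addrA -natrD Re_gt0_addn_neq0.
  have h5 : 'C(j, i)%:R != 0 :> R[i] by rewrite pnatr_eq0 -lt0n bin_gt0.
  by field; rewrite h1 h2 h3 h4 h5.
by rewrite vandermonde subKr /gcoef !invfM; ring.
Qed.

Lemma pfaff_gsum_near a b c : 0 < complex.Re c ->
  forall x, `|x| <= 1 / 3 -> pfaff a b c x = gsum a b c x.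
Proof.
move=> c0 x x3; have x1 : `|x| < 1 by rewrite (le_lt_trans x3)//; lra.
have h2 : 0 <= (1 / 2 : R) < 1 by lra.
have r12 : 0 < (1 / 2 : R) by lra.
have hs h : `|h| <= 1 / 2 -> ksum (fun k => gcoef a (c - b) c k * h%:C ^+ k)
    (gsum a (c - b) c (0 / (0 - 1) + h)).
  move=> hh; rewrite mul0r add0r; apply: gsumP => //.
  by rewrite (le_lt_trans hh)//; lra.
(* Origin of the radius 1/3: expanding the inner series up to rho = 1/2 allows |h| up to rho / (1 +
   rho). *)
have rE : 1 / 2 * (1 - 0) / (1 + 1 / 2 * (1 - 0)) = 1 / 3 :> R.
  by rewrite subr0; field.
have key := pfaff_local ltr01 r12 (gcoef_bdsum a (c - b) c0 h2) hs.
have := key x; rewrite rE => /(_ x3).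
rewrite !subr0 add0r mulr1 ln1 mulr0 cexp0 invr1 => h.
apply: (ksum_unique h); apply: (ksum_eq (gsumP a b c0 x1)) => j.
by rewrite mul1r rmorphN rmorph1 pfaff_coef.
Qed.

Lemma pfaff_gsum a b c x : 0 < complex.Re c -> -1 < x <= 0 ->
  pfaff a b c x = gsum a b c x.
Proof.
move=> c0; apply: (@analytic_identity_left _ _ _ (-1) (1 / 3)).
- by [].
- by move=> t /andP[_ t0]; apply: pfaff_analytic => //; lra.
- move=> t /andP[t1 t0]; apply: gsum_analytic => //.
  by rewrite ler0_norm//; lra.
- by move=> t /andP[t1 t0]; apply: pfaff_gsum_near => //; rewrite ler0_norm//; lra.
Qed.

Lemma real_analytic_near (f g : R -> R[i]) x0 r : 0 < r ->
  (forall x, `|x - x0| < r -> f x = g x) ->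
  real_analytic_at f x0 -> real_analytic_at g x0.
Proof.
move=> r0 fg [d [s s0 hd]]; exists d, (Num.min r s); first by rewrite lt_min r0.
by move=> x; rewrite lt_min => /andP[xr xs]; rewrite -fg//; exact: hd.
Qed.

Lemma gsum_pFq a b c x : pFq [:: a; b] [:: c] x%:C = gsum a b c x.
Proof.
rewrite /pFq /gsum -/(klim _); congr klim; apply/funext => k.
exact: pFq_term_gauss.
Qed.

(** The series on the unit interval is glued to Pfaff's formula on its left; the two agree on their
    overlap ]-1, 0]. *)
Lemma gauss2F1_exists a b c : 0 < complex.Re c -> exists F, is_gauss2F1 a b c F.
Proof.
move=> c0; exists (fun x : R => if `|x| < 1 then gsum a b c x else pfaff a b c x).
split=> [x x1|x0 x01]; first by rewrite x1 gsum_pFq.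
have [x0n|x0n] := ltP (-1) x0.
  have x0' : `|x0| < 1 by rewrite ltr_norml x0n.
  apply: (@real_analytic_near (gsum a b c) _ _ (1 - `|x0|)).
  - by rewrite subr_gt0.
  - move=> x xr; rewrite ifT// -[x](subrK x0) (le_lt_trans (ler_normD _ _))//.
    by rewrite -ltrBrDr.
  - exact: gsum_analytic.
(* Here x0 <= -1, so a neighbourhood of radius 1 stays negative, where both branches of the gluing
   equal [pfaff]. *)
apply: (@real_analytic_near (pfaff a b c) _ _ 1) => //.
- move=> x xr; case: ifPn => // x1; apply: pfaff_gsum => //.
  move: xr x1; rewrite !ltr_norml => /andP[_ h] /andP[-> _] /=; lra.
- by apply: pfaff_analytic => //; lra.
Qed.

(** Existence makes the chosen function satisfy its specification; it then coincides with [pfaff]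
    near 0 and, by the identity principle, on the whole negative half-line. *)
Lemma gauss2F1_pfaff a b c x : 0 < complex.Re c -> x <= 0 ->
  gauss2F1 a b c x = pfaff a b c x.
Proof.
move=> c0 x0; rewrite /gauss2F1; have [F0 hF0] := gauss2F1_exists a b c0.
have [F1 F2] : is_gauss2F1 a b c (xget (fun=> 0) [set F | is_gauss2F1 a b c F]).
  exact: (xgetI _ hF0).
set F := xget _ _ in F1 F2 *.
apply: (@analytic_identity_left _ _ _ (x - 1) (1 / 3)).
- by [].
- by move=> t /andP[_ t0]; apply: F2; lra.
- by move=> t /andP[_ t0]; apply: pfaff_analytic => //; lra.
- move=> t /andP[t1 t0]; have t3 : `|t| <= 1 / 3 by rewrite ler0_norm//; lra.
  rewrite (pfaff_gsum_near a b c0 t3) F1 ?gsum_pFq//.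
  by rewrite (le_lt_trans t3)//; lra.
- by rewrite x0 andbT; lra.
Qed.

End GaussSeries.

(** * Integrals of complex-valued functions *)

Section ComplexIntegral.
Context {R : realType}.
Local Notation mu := (@lebesgue_measure R).
Variable D : set R.
Hypothesis mD : measurable D.
Implicit Types (f g : R -> R[i]).

Definition Cmeasurable (A : set R) f : Prop :=
  measurable_fun A (fun x => complex.Re (f x)) /\
  measurable_fun A (fun x => complex.Im (f x)).

Lemma Cintegrable_measurable f : Cintegrable D f -> Cmeasurable D f.
Proof.
by move=> [/measurable_int/measurable_EFinP h1 /measurable_int/measurable_EFinP h2].
Qed.

Lemma Cintegrable_eq f g : {in D, f =1 g} -> Cintegrable D f -> Cintegrable D g.
Proof.
move=> fg [h1 h2]; split; [apply: eq_integrable h1|apply: eq_integrable h2] => //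
  x xD; by rewrite fg.
Qed.

Lemma Cintegral_eq f g : {in D, f =1 g} -> Cintegral D f = Cintegral D g.
Proof.
move=> fg; rewrite /Cintegral; congr (_ +i* _); apply: eq_Rintegral => x xD;
  by rewrite fg.
Qed.

Lemma CintegrableD f g : Cintegrable D f -> Cintegrable D g ->
  Cintegrable D (fun x => f x + g x).
Proof.
move=> [f1 f2] [g1 g2]; split.
  by under eq_fun do rewrite cReD EFinD; exact: integrableD.
by under eq_fun do rewrite cImD EFinD; exact: integrableD.
Qed.

Lemma CintegralD f g : Cintegrable D f -> Cintegrable D g ->
  Cintegral D (fun x => f x + g x) = Cintegral D f + Cintegral D g.
Proof.
move=> [f1 f2] [g1 g2]; apply: complex_eqP; rewrite ?cReD ?cImD /Cintegral/=.
  by under eq_Rintegral do rewrite cReD; exact: RintegralD.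
by under eq_Rintegral do rewrite cImD; exact: RintegralD.
Qed.

Lemma CintegrableZ f (c : R[i]) : Cintegrable D f ->
  Cintegrable D (fun x => c * f x).
Proof.
move=> [f1 f2]; split.
  under eq_fun do rewrite cReM EFinB !EFinM.
  by apply: integrableB => //; exact: integrableZl.
under eq_fun do rewrite cImM EFinD !EFinM.
by apply: integrableD => //; exact: integrableZl.
Qed.

Lemma CintegralZ f (c : R[i]) : Cintegrable D f ->
  Cintegral D (fun x => c * f x) = c * Cintegral D f.
Proof.
move=> [f1 f2]; have iZ (k : R) (h : R -> R) : mu.-integrable D (EFin \o h) ->
    mu.-integrable D (EFin \o (fun x => k * h x)).
  by move=> hh; exact: (@integrableZl _ _ _ mu D mD k _ hh).
apply: complex_eqP; rewrite ?[in RHS]cReM ?[in RHS]cImM /Cintegral/=.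
  under eq_Rintegral do rewrite cReM.
  by rewrite RintegralB ?RintegralZl//; exact: iZ.
under eq_Rintegral do rewrite cImM.
by rewrite RintegralD ?RintegralZl//; exact: iZ.
Qed.

Lemma Cintegrable0 : Cintegrable D (fun=> 0).
Proof. by split; exact: integrable0. Qed.

Lemma Cintegral0 : Cintegral D (fun=> 0) = 0.
Proof.
rewrite -[RHS](mul0r (Cintegral D (fun=> 0))) -(CintegralZ 0 Cintegrable0).
by apply: Cintegral_eq => x _; rewrite mul0r.
Qed.

Lemma Cintegrable_sum (I : Type) (r : seq I) (F : I -> R -> R[i]) :
  (forall i, Cintegrable D (F i)) -> Cintegrable D (fun x => \sum_(i <- r) F i x).
Proof.
move=> h; elim: r => [|i r IH].
  by under eq_fun do rewrite big_nil; exact: Cintegrable0.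
by under eq_fun do rewrite big_cons; exact: CintegrableD.
Qed.

Lemma Cintegral_sum (I : Type) (r : seq I) (F : I -> R -> R[i]) :
  (forall i, Cintegrable D (F i)) ->
  Cintegral D (fun x => \sum_(i <- r) F i x) = \sum_(i <- r) Cintegral D (F i).
Proof.
move=> h; elim: r => [|i r IH].
  by under eq_fun do rewrite big_nil; rewrite big_nil Cintegral0.
under eq_fun do rewrite big_cons.
by rewrite CintegralD ?IH ?big_cons//; exact: Cintegrable_sum.
Qed.

(** The real theorem is applied to each component. The majorant is extended-real because
    [Cintegral_series] takes for it an infinite sum of functions. *)
Lemma Cdominated_convergence (f_ : nat -> R -> R[i]) f (g : R -> \bar R) :
  (forall n, Cmeasurable D (f_ n)) ->
  (forall x, D x -> kcvg \oo (fun n => f_ n x) (f x)) ->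
  mu.-integrable D g ->
  (forall n x, D x -> ((cmod (f_ n x))%:E <= g x)%E) ->
  Cintegrable D f /\ kcvg \oo (fun n => Cintegral D (f_ n)) (Cintegral D f).
Proof.
move=> mf_ ff ig fg.
have aux (p : R[i] -> R) : (forall z, `|p z| <= cmod z) ->
    (forall n, measurable_fun D (fun x => p (f_ n x))) ->
    (forall x, D x -> kcvg \oo (fun n => p (f_ n x)) (p (f x))) ->
    mu.-integrable D (fun x => (p (f x))%:E) /\
    kcvg \oo (fun n => \int[mu]_(x in D) p (f_ n x))
       (\int[mu]_(x in D) p (f x)).
  move=> pz mp pp.
  have ppE x : D x -> (p (f_ n x))%:E @[n --> \oo] --> (p (f x))%:E.
    by move=> Dx; apply: cvg_EFin; [exact: nearW|have [] := pp _ Dx].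
  have mpf : measurable_fun D (fun x => (p (f x))%:E).
    apply: (emeasurable_fun_cvg (fun n x => (p (f_ n x))%:E)) => //.
    by move=> n; apply/measurable_EFinP.
  have [|||||i1 _ i2] := @dominated_convergence _ _ _ mu D mD
    (fun n x => (p (f_ n x))%:E) (fun x => (p (f x))%:E) g.
  - by move=> n; apply/measurable_EFinP; exact: (mp n).
  - exact: mpf.
  - by apply: aeW => x; exact: ppE.
  - exact: ig.
  - apply: aeW => x n Dx; apply: le_trans (fg n x Dx).
    by rewrite lee_fin.
  split=> //; split.
  have fin : (\int[mu]_(x in D) (p (f x))%:E)%E \is a fin_num by exact: integrable_fin_num.
  rewrite /Rintegral -[X in _ --> X]/(fine _).
  by apply: fine_cvg; rewrite fineK.
have [r1 r2] := aux (fun z => complex.Re z) Re_le_cmod (fun n => (mf_ n).1)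
  (fun x Dx => ((kcvg_ReIm _ _).1 (ff x Dx)).1).
have [m1 m2] := aux (fun z => complex.Im z) Im_le_cmod (fun n => (mf_ n).2)
  (fun x Dx => ((kcvg_ReIm _ _).1 (ff x Dx)).2).
by split => //; apply/kcvg_ReIm.
Qed.

Lemma CmeasurableD f g : Cmeasurable D f -> Cmeasurable D g ->
  Cmeasurable D (fun x => f x + g x).
Proof.
move=> [f1 f2] [g1 g2]; split.
  by under eq_fun do rewrite cReD; exact: measurable_funD.
by under eq_fun do rewrite cImD; exact: measurable_funD.
Qed.

Lemma Cmeasurable_sum (F : nat -> R -> R[i]) n : (forall k, Cmeasurable D (F k)) ->
  Cmeasurable D (fun x => \sum_(0 <= k < n) F k x).
Proof.
move=> h; elim: n => [|n IH].
  by under eq_fun do rewrite big_nil; split; exact: measurable_cst.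
by under eq_fun do rewrite big_nat_recr//=; exact: CmeasurableD.
Qed.

(** Dominated convergence applied to a constant sequence. *)
Lemma Cintegrable_le f (g : R -> R) : Cmeasurable D f ->
  (forall x, D x -> cmod (f x) <= g x) -> mu.-integrable D (EFin \o g) ->
  Cintegrable D f.
Proof.
move=> mf fg ig.
have cf x : D x -> kcvg \oo (fun=> f x) (f x) by move=> _; exact: kcvg_cst.
have fg' (n : nat) x : D x -> ((cmod (f x))%:E <= (EFin \o g) x)%E.
  by move=> Dx; rewrite lee_fin fg.
exact: (Cdominated_convergence (fun=> mf) cf ig fg').1.
Qed.

(** Monotone convergence makes the sum [G] of the majorants integrable, and [G] dominates all
    partial sums of the series. *)
Lemma Cintegral_series (f_ : nat -> R -> R[i]) f (g : nat -> R -> R) :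
  (forall k, Cmeasurable D (f_ k)) ->
  (forall k, mu.-integrable D (EFin \o g k)) ->
  (forall k x, D x -> cmod (f_ k x) <= g k x) ->
  bdsum (fun k => \int[mu]_(x in D) g k x) ->
  (forall x, D x -> ksum (fun k => f_ k x) (f x)) ->
  Cintegrable D f /\ ksum (fun k => Cintegral D (f_ k)) (Cintegral D f).
Proof.
move=> mf ig fg [M hM] fs.
have g0 k x : D x -> 0 <= g k x by move=> Dx; rewrite (le_trans (cmod_ge0 _) (fg _ _ Dx)).
have mg k : measurable_fun D (EFin \o g k) by exact: measurable_int (ig k).
pose G x := (\sum_(k <oo) (g k x)%:E)%E.
have Gpart n x : D x -> ((\sum_(0 <= k < n) g k x)%:E <= G x)%E.
  move=> Dx; rewrite -sumEFin; apply: nneseries_lim_ge => k _ _.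
  by rewrite lee_fin g0.
have intG : mu.-integrable D G.
  apply/integrableP; split.
    apply: (@ge0_emeasurable_sum _ _ _ D (fun k x => (g k x)%:E) xpredT).
      by move=> k x Dx _; rewrite lee_fin g0.
    by move=> k _; exact: mg.
  have -> : (\int[mu]_(x in D) `|G x| = \int[mu]_(x in D) G x)%E.
    apply: eq_integral => x; rewrite inE => Dx; rewrite gee0_abs//.
    by apply: nneseries_ge0 => k _ _; rewrite lee_fin g0.
  have g0E n x : D x -> (0 <= (g n x)%:E)%E by move=> Dx; rewrite lee_fin g0.
  rewrite (@integral_nneseries _ _ _ mu D mD (fun k x => (g k x)%:E) mg g0E).
  have -> : (\sum_(k <oo) \int[mu]_(x in D) (g k x)%:E)%E =
      (\sum_(k <oo) (\int[mu]_(x in D) g k x)%:E)%E.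
    apply: eq_eseriesr => k _; rewrite /Rintegral fineK//.
    exact: integrable_fin_num (ig k).
  apply: (@le_lt_trans _ _ M%:E); last exact: ltry.
  apply: lime_le.
    apply: is_cvg_nneseries => k _ _; rewrite lee_fin.
    by apply: Rintegral_ge0 => x Dx; exact: g0.
  by apply: nearW => n; rewrite sumEFin lee_fin.
have fI k : Cintegrable D (f_ k) by apply: Cintegrable_le (ig k) => // x; exact: fg.
have [||n x Dx|h1 h2] := @Cdominated_convergence
  (fun n x => \sum_(0 <= k < n) f_ k x) f G _ _ intG.
- by move=> n; exact: Cmeasurable_sum.
- by move=> x Dx; exact: fs.
- apply: le_trans (Gpart n x Dx); rewrite lee_fin (le_trans (cmod_sum _ _ _))//.
  by apply: ler_sum => k _; exact: fg.
split=> //; apply: (kcvg_eq h2) => n.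
by rewrite Cintegral_sum.
Qed.

End ComplexIntegral.

(** * Integrals over the positive half-line by compact exhaustion *)

Section HalfLine.
Context {R : realType}.
Local Notation mu := (@lebesgue_measure R).
Implicit Types (f F : R -> R[i]) (h H : R -> R) (D : set R) (E : nat -> set R)
  (x t : R).

Lemma Cintegral_exhaust D E f : measurable D -> (forall n, measurable (E n)) ->
  nondecreasing_seq E -> \bigcup_n E n = D -> Cintegrable D f ->
  kcvg \oo (fun n => Cintegral (E n) f) (Cintegral D f).
Proof.
move=> mD mE ndE ED fI; have [f1 f2] := fI.
have ED' n : E n `<=` D by rewrite -ED; exact: bigcup_sup.
have [mf1 mf2] := Cintegrable_measurable fI.
pose f_ n x : R[i] := ((fun t => complex.Re (f t)) \_ (E n)) x +i*
  ((fun t => complex.Im (f t)) \_ (E n)) x.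
pose g x := (`|complex.Re (f x)| + `|complex.Im (f x)|)%:E.
have ig : mu.-integrable D g.
  rewrite /g; under eq_fun do rewrite EFinD.
  apply: integrableD => //.
    exact: (@integrable_norm _ _ _ mu D (fun x => complex.Re (f x)) f1).
  exact: (@integrable_norm _ _ _ mu D (fun x => complex.Im (f x)) f2).
have f_E n x : E n x -> f_ n x = f x.
  by move=> Enx; rewrite /f_ !patchE mem_set//; case: (f x).
have f_0 n x : ~ E n x -> f_ n x = 0.
  by move=> Enx; rewrite /f_ !patchE memNset.
have mp h n : measurable_fun D h -> measurable_fun D (h \_ (E n)).
  by move=> mh; apply/measurable_restrict => //; exact: measurable_funS mh.
have mf_ n : Cmeasurable D (f_ n) by split; exact: mp.
have cf x : D x -> kcvg \oo (fun n => f_ n x) (f x).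
  rewrite -{1}ED => -[N _ ENx]; apply: (kcvg_near (kcvg_cst (f x))).
  exists N => // n /= Nn; rewrite f_E//.
  by have := ndE _ _ Nn; rewrite subsetEset; exact.
have bf n x : D x -> ((cmod (f_ n x))%:E <= g x)%E.
  move=> Dx; rewrite lee_fin; have [Enx|Enx] := pselect (E n x).
    by rewrite f_E// cmod_le_ReIm.
  by rewrite f_0// cmod0 addr_ge0.
have [_ /kcvg_eq] := Cdominated_convergence mD mf_ cf ig bf.
apply => n; rewrite /Cintegral/=.
by rewrite -!Rintegral_mkcondr (setIidr (ED' n)).
Qed.

(** Compact exhaustion of the open half-line; with n + 2 the first interval is already
    nondegenerate. *)
Definition hl (n : nat) : set R := `[n.+2%:R^-1, n.+2%:R]%classic.

Lemma hl_lt n : 0 < (n.+2%:R : R)^-1 < n.+2%:R.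
Proof.
rewrite invr_gt0 ltr0n/=; apply: (@lt_le_trans _ _ 1); last by rewrite ler1n.
by rewrite invf_lt1 ?ltr0n// ltr1n.
Qed.

Lemma hl_nd : nondecreasing_seq hl.
Proof.
move=> m n mn; rewrite subsetEset => x; rewrite /hl/= !in_itv/= => /andP[h1 h2].
have mn2 : m.+2%:R <= n.+2%:R :> R by rewrite ler_nat.
rewrite (le_trans h2 mn2) andbT (le_trans _ h1)//.
by rewrite lef_pV2// posrE ltr0n.
Qed.

Lemma hl_pos n x : hl n x -> 0 < x.
Proof.
rewrite /hl/= in_itv/= => /andP[h _].
by rewrite (lt_le_trans _ h)//; have /andP[] := hl_lt n.
Qed.

Lemma hl_bigcup : \bigcup_n hl n = `]0, +oo[%classic.
Proof.
apply/seteqP; split => [x [n _ /hl_pos]|x]; first by rewrite /= in_itv/= andbT.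
rewrite /= in_itv/= andbT => x0.
have [N hN] := natr_bound (Num.max x x^-1).
have : x <= N%:R by rewrite (le_trans _ hN)// le_max lexx.
have : x^-1 <= N%:R by rewrite (le_trans _ hN)// le_max lexx orbT.
have N2 : N%:R <= N.+2%:R :> R by rewrite ler_nat -addn2 leq_addr.
move=> /le_trans/(_ N2) h1 /le_trans/(_ N2) h2.
exists N => //; rewrite /hl/= in_itv/= h2 andbT.
by rewrite -[leRHS]invrK lef_pV2// posrE ?invr_gt0// ltr0n.
Qed.

Lemma hl_measurable n : measurable (hl n).
Proof. exact: measurable_itv. Qed.

Lemma measurable_0y : measurable (`]0, +oo[%classic : set R).
Proof. exact: measurable_itv. Qed.

Lemma continuous_measurable_0y h : (forall x, 0 < x -> {for x, continuous h}) ->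
  measurable_fun (`]0, +oo[%classic : set R) h.
Proof.
move=> ch; apply: open_continuous_measurable_fun; first exact: interval_open.
by move=> x; rewrite inE/= in_itv/= andbT => x0; exact: ch.
Qed.

Lemma ftc_segment H h (a b : R) : 0 < a < b ->
  (forall x, 0 < x -> is_derive x 1 H (h x)) ->
  (forall x, 0 < x -> {for x, continuous h}) ->
  (\int[mu]_(x in `[a, b]) (h x)%:E = (H b - H a)%:E)%E.
Proof.
move=> /andP[a0 ab] dH ch; rewrite EFinB.
have cH x : 0 < x -> {for x, continuous H} by move=> /dH; exact: is_derive_continuous.
apply: continuous_FTC2 => //.
- apply: continuous_in_subspaceT => x; rewrite inE/= in_itv/= => /andP[ax _].
  by apply: ch; exact: lt_le_trans ax.
- split.
  + by move=> x; rewrite in_itv/= => /andP[ax _]; have [] := dH _ (lt_trans a0 ax).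
  + by apply: cvg_at_right_filter; apply: cH.
  + by apply: cvg_at_left_filter; apply: cH; exact: lt_trans ab.
- move=> x; rewrite in_itv/= => /andP[ax _].
  have dx := dH _ (lt_trans a0 ax).
  by rewrite derive1E; exact: derive_val.
Qed.

(** A nonnegative function with a bounded primitive is integrable: its integral over each [hl n] is
    an increment of [H], at most 2M. *)
Lemma ftc_integrable H h (M : R) :
  (forall x, 0 < x -> is_derive x 1 H (h x)) ->
  (forall x, 0 < x -> {for x, continuous h}) ->
  (forall x, 0 < x -> 0 <= h x) -> (forall x, 0 < x -> `|H x| <= M) ->
  mu.-integrable `]0, +oo[ (EFin \o h).
Proof.
move=> dH ch h0 HM; have mh := continuous_measurable_0y ch.
apply/integrableP; split; first exact/measurable_EFinP.
have -> : (\int[mu]_(x in `]0%R, +oo[) `|(EFin \o h) x| =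
    \int[mu]_(x in \bigcup_n hl n) (h x)%:E)%E.
  rewrite hl_bigcup; apply: eq_integral => x; rewrite inE/= in_itv/= andbT => x0.
  by rewrite ger0_norm// h0.
have hc : (\int[mu]_(x in hl n) (h x)%:E)%E @[n --> \oo] -->
    (\int[mu]_(x in \bigcup_n hl n) (h x)%:E)%E.
  apply: ge0_nondecreasing_set_cvg_integral.
  - exact: hl_nd.
  - exact: hl_measurable.
  - move=> n; apply/measurable_EFinP; apply: measurable_funS mh => //.
    by move=> x /hl_pos; rewrite /= in_itv/= andbT.
  - by move=> n x /hl_pos x0; rewrite lee_fin h0.
apply: (@le_lt_trans _ _ (M + M)%:E); last exact: ltry.
rewrite -(cvg_lim _ hc)//; apply: lime_le.
  by apply/cvg_ex; eexists; exact: hc.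
apply: nearW => n; rewrite /hl (@ftc_segment H)//; last exact: hl_lt.
have /andP[n1 n2] := hl_lt n.
rewrite lee_fin (le_trans (ler_norm _))// (le_trans (ler_normB _ _))// lerD//.
  by apply: HM; exact: lt_trans n2.
exact: HM.
Qed.

Definition Ccontinuous x f : Prop :=
  {for x, continuous (fun t => complex.Re (f t))} /\
  {for x, continuous (fun t => complex.Im (f t))}.

Lemma is_cderive_continuous x f (d : R[i]) : is_cderive x f d -> Ccontinuous x f.
Proof. by move=> [h1 h2]; split; [exact: is_derive_continuous h1|exact: is_derive_continuous h2]. Qed.

Lemma Ccontinuous_measurable f : (forall x, 0 < x -> Ccontinuous x f) ->
  Cmeasurable `]0, +oo[ f.
Proof. by move=> cf; split; apply: continuous_measurable_0y => x /cf[]. Qed.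

Lemma Cftc F f (A B : R[i]) :
  (forall x, 0 < x -> is_cderive x F (f x)) ->
  (forall x, 0 < x -> Ccontinuous x f) -> Cintegrable `]0, +oo[ f ->
  kcvg \oo (fun n => F (n.+2%:R^-1)) A -> kcvg \oo (fun n => F (n.+2%:R)) B ->
  Cintegral `]0, +oo[ f = B - A.
Proof.
move=> dF cf fI hA hB.
have h1 := Cintegral_exhaust measurable_0y hl_measurable hl_nd hl_bigcup fI.
have h2 : kcvg \oo (fun n => F n.+2%:R - F n.+2%:R^-1) (B - A) by exact: kcvgB.
apply: (kcvg_unique h1); apply: (kcvg_eq h2) => n.
rewrite /Cintegral /Rintegral /hl.
rewrite (@ftc_segment (fun t => complex.Re (F t)) (fun t => complex.Re (f t)) _ _
  (hl_lt n) (fun x hx => (dF x hx).1) (fun x hx => (cf x hx).1)).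
rewrite (@ftc_segment (fun t => complex.Im (F t)) (fun t => complex.Im (f t)) _ _
  (hl_lt n) (fun x hx => (dF x hx).2) (fun x hx => (cf x hx).2)).
by rewrite /=; case: (F _) => ? ?; case: (F _).
Qed.

(** The change of variables holds on each compact interval; both integrals being absolutely
    convergent, exhaustion gives the limit on either side. *)
Lemma Csubstitution (phi phi' : R -> R) D f :
  (forall x, is_derive x 1 phi (phi' x)) -> continuous phi' ->
  {in `]0, +oo[ &, {homo phi : x y / x < y}} ->
  measurable D -> \bigcup_n `[phi n.+2%:R^-1, phi n.+2%:R]%classic = D ->
  (forall t, D t -> Ccontinuous t f) -> Cintegrable D f ->
  Cintegrable `]0, +oo[ (fun x => f (phi x) * (phi' x)%:C) ->
  Cintegral `]0, +oo[ (fun x => f (phi x) * (phi' x)%:C) = Cintegral D f.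
Proof.
move=> dphi cphi incr mD DE cf fI gI.
have pos n : 0 < n.+2%:R^-1 :> R by have /andP[] := hl_lt n.
have pos2 n : 0 < n.+2%:R :> R by rewrite ltr0n.
have incrle x y : 0 < x -> x <= y -> phi x <= phi y.
  move=> x0; rewrite le_eqVlt => /predU1P[->//|xy]; apply/ltW/incr => //;
    by rewrite in_itv/= andbT// (lt_trans x0).
have nd : nondecreasing_seq (fun n => `[phi n.+2%:R^-1, phi n.+2%:R]%classic).
  move=> m n mn; rewrite subsetEset => x/=; rewrite !in_itv/= => /andP[h1 h2].
  have mn2 : m.+2%:R <= n.+2%:R :> R by rewrite ler_nat.
  rewrite (le_trans _ h1) ?(le_trans h2)//; apply: incrle => //.
  by rewrite lef_pV2// posrE ltr0n.
have h1 := Cintegral_exhaust mD (fun n => measurable_itv _) nd DE fI.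
have h2 := Cintegral_exhaust measurable_0y hl_measurable hl_nd hl_bigcup gI.
apply: (kcvg_unique h2); apply: (kcvg_eq h1) => n.
have phiE : derive1 phi = phi'.
  by apply/funext => x; rewrite derive1E; apply: derive_val.
have cphi0 : continuous phi by move=> x; exact: is_derive_continuous (dphi x).
have key (h : R -> R) : (forall t, D t -> {for t, continuous h}) ->
    \int[mu]_(x in `[phi n.+2%:R^-1, phi n.+2%:R]) h x =
    \int[mu]_(x in hl n) (h (phi x) * phi' x).
  move=> ch; rewrite /Rintegral; congr fine.
  rewrite (@integration_by_substitution_increasing _ phi h).
  - by rewrite phiE.
  - by have /andP[_ /ltW] := hl_lt n.
  - move=> x y /hl_pos x0 /hl_pos y0; apply: incr; by rewrite in_itv/= andbT.
  - by rewrite phiE => x _; exact: cphi.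
  - rewrite phiE; apply/cvg_ex; exists (phi' n.+2%:R^-1).
    by apply: cvg_at_right_filter; exact: cphi.
  - rewrite phiE; apply/cvg_ex; exists (phi' n.+2%:R).
    by apply: cvg_at_left_filter; exact: cphi.
  - split.
    + by move=> x _; have [] := dphi x.
    + by apply: cvg_at_right_filter; exact: cphi0.
    + by apply: cvg_at_left_filter; exact: cphi0.
  - apply: continuous_in_subspaceT => x; rewrite inE => xI.
    by apply: ch; rewrite -DE; exists n.
rewrite /Cintegral; congr (_ +i* _).
  rewrite key; last by move=> t /cf[].
  by apply: eq_Rintegral => x _; rewrite cReM/= mulr0 subr0.
rewrite key; last by move=> t /cf[].
by apply: eq_Rintegral => x _; rewrite cImM/= mulr0 add0r.
Qed.

End HalfLine.

(** * Hyperbolic functions *)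

Section Hyperbolic.
Context {R : realType}.
Implicit Types (x : R).

Lemma is_derive_expRN x : is_derive x 1 (fun t : R => expR (- t)) (- expR (- x)).
Proof.
have h := @is_derive1_comp _ expR (fun t : R => - t) x _ _
  (is_derive_expR (- x)) (is_deriveNid x 1).
by apply: (is_derive_eq h); rewrite mulrN1.
Qed.

Lemma is_derive_sinh x : is_derive x 1 (@sinh R) (cosh x).
Proof.
have h := is_deriveZ (2^-1) (is_deriveB (is_derive_expR x) (is_derive_expRN x)).
have -> : @sinh R = 2^-1 \*: ((@expR R) - (fun t : R => expR (- t))).
  by apply/funext => t; rewrite /sinh mulrC.
by apply: (is_derive_eq h); rewrite /cosh opprK /GRing.scale/= mulrC.
Qed.

Lemma is_derive_cosh x : is_derive x 1 (@cosh R) (sinh x).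
Proof.
have h := is_deriveZ (2^-1) (is_deriveD (is_derive_expR x) (is_derive_expRN x)).
have -> : @cosh R = 2^-1 \*: ((@expR R) + (fun t : R => expR (- t))).
  by apply/funext => t; rewrite /cosh mulrC.
by apply: (is_derive_eq h); rewrite /sinh /GRing.scale/= mulrC.
Qed.

Lemma cosh_gt0 x : 0 < cosh x.
Proof. by rewrite /cosh divr_gt0// addr_gt0// expR_gt0. Qed.

Lemma cosh_neq0 x : cosh x != 0.
Proof. by rewrite gt_eqF// cosh_gt0. Qed.

Lemma cosh2_sinh2 x : cosh x ^+ 2 - sinh x ^+ 2 = 1.
Proof.
have e := expRxMexpNx_1 x; rewrite /cosh /sinh.
transitivity (expR x * expR (- x)); last by [].
by field.
Qed.

Lemma cosh2E x : cosh x ^+ 2 = 1 + sinh x ^+ 2.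
Proof. by rewrite -(cosh2_sinh2 x) subrK. Qed.

Lemma sinhN x : sinh (- x) = - sinh x.
Proof. by rewrite /sinh opprK -mulNr opprB. Qed.

Lemma coshN x : cosh (- x) = cosh x.
Proof. by rewrite /cosh opprK addrC. Qed.

Lemma tanhN x : tanh (- x) = - tanh x.
Proof. by rewrite /tanh sinhN coshN mulNr. Qed.

Lemma sinh0 : sinh 0 = 0 :> R.
Proof. by rewrite /sinh oppr0 subrr mul0r. Qed.

Lemma tanh0 : tanh 0 = 0 :> R.
Proof. by rewrite /tanh sinh0 mul0r. Qed.

Lemma sinh_gt0 x : 0 < x -> 0 < sinh x.
Proof.
move=> x0; rewrite /sinh divr_gt0// subr_gt0 ltr_expR.
by rewrite (lt_trans _ x0)// oppr_lt0.
Qed.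

Lemma tanh_gt0 x : 0 < x -> 0 < tanh x.
Proof. by move=> x0; rewrite /tanh divr_gt0 ?cosh_gt0// sinh_gt0. Qed.

Lemma onem_tanh2 x : 1 - tanh x ^+ 2 = (cosh x ^+ 2)^-1.
Proof.
rewrite /tanh exprMn exprVn -[1 in LHS](divff (expf_neq0 2 (cosh_neq0 x))).
by rewrite -mulrBl cosh2_sinh2 mul1r.
Qed.

Lemma tanh2_lt1 x : tanh x ^+ 2 < 1.
Proof. by rewrite -subr_gt0 onem_tanh2 invr_gt0 exprn_gt0 ?cosh_gt0. Qed.

Lemma tanh_lt1 x : tanh x < 1.
Proof.
have [x0|x0] := ltP (tanh x) 0; first by rewrite (lt_trans x0).
by have := tanh2_lt1 x; rewrite -[X in _ < X](expr1n R 2) ltr_pXn2r// ?nnegrE.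
Qed.

Lemma cosh_ge1 x : 1 <= cosh x.
Proof.
have h : 1 <= cosh x ^+ 2 by rewrite cosh2E lerDl sqr_ge0.
by rewrite -(@ler_pXn2r _ 2) ?nnegrE ?expr1n// ltW// cosh_gt0.
Qed.

Lemma is_derive_tanh x : is_derive x 1 (@tanh R) (cosh x ^+ 2)^-1.
Proof.
have hV := is_deriveV (cosh_neq0 x) (is_derive_cosh x).
have h := is_deriveM (is_derive_sinh x) hV.
apply: (is_derive_eq h); rewrite /GRing.scale/= -[RHS]onem_tanh2 /tanh.
have := cosh_neq0 x; by move: (cosh x) (sinh x) => c s c0; field.
Qed.

Lemma is_derive_ln_tanh x : 0 < x ->
  is_derive x 1 (fun t : R => ln (tanh t)) (tanh x * cosh x ^+ 2)^-1.
Proof.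
move=> x0; have h := @is_derive1_comp _ (@ln R) (@tanh R) x _ _
  (is_derive1_ln (tanh_gt0 x0)) (is_derive_tanh x).
by apply: (is_derive_eq h); rewrite [RHS]invfM.
Qed.

Lemma is_derive_ln_cosh x : is_derive x 1 (fun t : R => ln (cosh t)) (tanh x).
Proof.
have h := @is_derive1_comp _ (@ln R) (@cosh R) x _ _
  (is_derive1_ln (cosh_gt0 x)) (is_derive_cosh x).
by apply: (is_derive_eq h); rewrite /tanh mulrC.
Qed.

Lemma ln_cosh_ge0 x : 0 <= ln (cosh x).
Proof. by rewrite ln_ge0// cosh_ge1. Qed.

Lemma ln_tanh_le0 x : ln (tanh x) <= 0.
Proof. by rewrite ln_le0// ltW// tanh_lt1. Qed.

End Hyperbolic.

(** * The Beta kernel in the variable tanh^2 *)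

Section Kernel.
Context {R : realType}.
Local Notation mu := (@lebesgue_measure R).
Implicit Types (p q z : R[i]) (x a b : R).

(* [kpow a b] is [tanh ^ a * cosh ^ (- b)]; [hker p q] is the pull-back by
   [u = tanh ^ 2] of the Beta kernel [u ^ (p - 1) * (1 - u) ^ (q - 1) du]. *)
Definition kpow p q x : R[i] :=
  cexp (p * (ln (tanh x))%:C - q * (ln (cosh x))%:C).

Definition hker p q x : R[i] := 2 * kpow (2 * p - 1) (2 * q) x.

(** The modulus of [hker p q] when [a] and [b] are the real parts of [p] and [q]; see
    [cmod_hker]. *)
Definition rker a b x : R := 2 * expR ((2 * a - 1) * ln (tanh x) - 2 * b * ln (cosh x)).

Lemma kpow10 x : 0 < x -> kpow 1 0 x = (tanh x)%:C.
Proof.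
by move=> x0; rewrite /kpow mul1r mul0r subr0 cexp_real lnK// posrE tanh_gt0.
Qed.

Lemma kpow01 x : kpow 0 (-1) x = (cosh x)%:C.
Proof.
by rewrite /kpow mul0r sub0r mulN1r opprK cexp_real lnK// posrE cosh_gt0.
Qed.

Lemma kpow_split p q (m n : nat) x : 0 < x ->
  kpow (p + m%:R) (q - n%:R) x = kpow p q x * (tanh x)%:C ^+ m * (cosh x)%:C ^+ n.
Proof.
move=> x0; rewrite -(kpow10 x0) -(kpow01 x) -mulrA /kpow -!cexp_natl -!cexpD.
by congr cexp; ring.
Qed.

Lemma kpow_eq p1 q1 p2 q2 x : p1 = p2 -> q1 = q2 -> kpow p1 q1 x = kpow p2 q2 x.
Proof. by move=> -> ->. Qed.

Lemma cmod_kpow p q x : cmod (kpow p q x) =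
  expR (complex.Re p * ln (tanh x) - complex.Re q * ln (cosh x)).
Proof. by rewrite /kpow cmod_cexp cReD cReN !cReM/= !mulr0 !subr0. Qed.

Lemma cmod_hker p q x : cmod (hker p q x) = rker (complex.Re p) (complex.Re q) x.
Proof.
rewrite /hker /rker cmodM cmod_nat cmod_kpow; congr (_ * expR _).
by rewrite cReD cReN !cReM Re_nat Im_nat/= !mul0r !subr0.
Qed.

Lemma hker_real a b x : hker a%:C b%:C x = (rker a b x)%:C.
Proof.
rewrite /hker /rker /kpow rmorphM rmorph_nat/= -cexp_real; congr (_ * cexp _).
by rewrite rmorphB !rmorphM rmorphB !rmorphM !rmorph_nat.
Qed.

Lemma kpow_cderive p q x : 0 < x ->
  is_cderive x (kpow p q)
    ((p * ((tanh x * cosh x ^+ 2)^-1)%:C - q * (tanh x)%:C) * kpow p q x).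
Proof.
move=> x0; apply: is_cderive_cexp.
have h1 := is_cderiveZ p (is_cderive_real (is_derive_ln_tanh x0)).
have h2 := is_cderiveZ (- q) (is_cderive_real (is_derive_ln_cosh x)).
apply: (is_cderive_eq (f := fun t => p * (ln (tanh t))%:C - q * (ln (cosh t))%:C)
  (d := p * ((tanh x * cosh x ^+ 2)^-1)%:C + - q * (tanh x)%:C)); last first.
  by rewrite mulNr.
have -> : (fun t => p * (ln (tanh t))%:C - q * (ln (cosh t))%:C) =
    (fun t => p * (ln (tanh t))%:C + - q * (ln (cosh t))%:C).
  by apply/funext => t; rewrite mulNr.
exact: is_cderiveD.
Qed.

(** With u = tanh^2 this is the derivative of u^p (1 - u)^q, the source of the Beta recurrences. *)
Lemma kpow_hker_derive p q x : 0 < x ->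
  is_cderive x (kpow (2 * p) (2 * q)) (p * hker p (q + 1) x - q * hker (p + 1) q x).
Proof.
move=> x0; apply: (is_cderive_eq (kpow_cderive _ _ x0)).
have t0 : (tanh x)%:C != 0 by rewrite (inj_eq (@complexI R)) gt_eqF// tanh_gt0.
have c0 : (cosh x)%:C != 0 by rewrite (inj_eq (@complexI R)) cosh_neq0.
have e1 : kpow (2 * p) (2 * q) x = kpow (2 * p - 1) (2 * (q + 1)) x *
    (tanh x)%:C ^+ 1 * (cosh x)%:C ^+ 2.
  by rewrite -(kpow_split _ _ 1 2 x0); apply: kpow_eq; ring.
have e2 : kpow (2 * (p + 1) - 1) (2 * q) x = kpow (2 * p) (2 * q) x * (tanh x)%:C ^+ 1.
  by have := kpow_split (2 * p) (2 * q) 1 0 x0; rewrite expr0 mulr1 => <-;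
    apply: kpow_eq; ring.
have eTC : ((tanh x * cosh x ^+ 2)^-1)%:C = ((tanh x)%:C * (cosh x)%:C ^+ 2)^-1.
  by rewrite fmorphV rmorphM rmorphXn.
rewrite /hker e2 e1 eTC.
clear e1 e2 eTC; move: t0 c0; generalize (tanh x)%:C (cosh x)%:C => T C t0 c0.
by field; rewrite t0 c0.
Qed.

Lemma hker_split p q x : 0 < x -> hker p q x = hker (p + 1) q x + hker p (q + 1) x.
Proof.
move=> x0.
have c0 : (cosh x)%:C != 0 by rewrite (inj_eq (@complexI R)) cosh_neq0.
have e1 : kpow (2 * p - 1) (2 * q) x = kpow (2 * p - 1) (2 * (q + 1)) x *
    (tanh x)%:C ^+ 0 * (cosh x)%:C ^+ 2.
  by rewrite -(kpow_split _ _ 0 2 x0); apply: kpow_eq; ring.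
have e2 : kpow (2 * (p + 1) - 1) (2 * q) x = kpow (2 * p - 1) (2 * (q + 1)) x *
    (tanh x)%:C ^+ 2 * (cosh x)%:C ^+ 2.
  by rewrite -(kpow_split _ _ 2 2 x0); apply: kpow_eq; ring.
rewrite /hker e2 e1 -mulrDr; congr (_ * _).
have e : (tanh x)%:C ^+ 2 * (cosh x)%:C ^+ 2 + 1 = (cosh x)%:C ^+ 2 :> R[i].
  rewrite -!rmorphXn -rmorphM/= -(rmorph1 (real_complex R)) -rmorphD/=; congr (_%:C).
  by rewrite /tanh exprMn exprVn divfK ?expf_neq0 ?cosh_neq0// cosh2E addrC.
by rewrite expr0 mulr1 -mulrA -[in LHS]e mulrDr mulr1.
Qed.

Lemma hker_continuous p q x : 0 < x -> Ccontinuous x (hker p q).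
Proof.
move=> x0; exact: (is_cderive_continuous (is_cderiveZ 2 (kpow_cderive _ _ x0))).
Qed.

Lemma rker_continuous a b x : 0 < x -> {for x, continuous (rker a b)}.
Proof.
move=> x0; have -> : rker a b = (fun t => complex.Re (hker a%:C b%:C t)).
  by apply/funext => t; rewrite hker_real.
by have [] := hker_continuous a%:C b%:C x0.
Qed.

Lemma rker_ge0 a b x : 0 <= rker a b x.
Proof. by rewrite mulr_ge0// expR_ge0. Qed.

Lemma rker_a1_integrable a : 0 < a -> mu.-integrable `]0, +oo[ (EFin \o rker a 1).
Proof.
move=> a0.
(* The primitive u^a / a, obtained from [kpow_hker_derive] at q = 0. *)
pose H x := a^-1 * expR (2 * a * ln (tanh x)).
have HE t : complex.Re ((a^-1)%:C * kpow (2 * a%:C) (2 * 0) t) = H t.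
  rewrite /kpow mulr0 mul0r subr0 -(rmorph_nat (real_complex R) 2) -!rmorphM cexp_real.
  by rewrite -rmorphM.
have dH x : 0 < x -> is_derive x 1 H (rker a 1 x).
  move=> x0; have [+ _] := is_cderiveZ (a^-1)%:C (kpow_hker_derive a%:C 0 x0).
  have -> : (a^-1)%:C * (a%:C * hker a%:C (0 + 1) x - 0 * hker (a%:C + 1) 0 x) =
      (rker a 1 x)%:C.
    rewrite mul0r subr0 add0r -hker_real mulrA -rmorphM/= mulVf ?gt_eqF//.
    by rewrite mul1r.
  by have -> : (fun t => complex.Re ((a^-1)%:C * kpow (2 * a%:C) (2 * 0) t)) = H
    by apply/funext.
have HM x : 0 < x -> `|H x| <= a^-1.
  move=> x0; rewrite ger0_norm ?mulr_ge0 ?expR_ge0 ?invr_ge0 ?(ltW a0)//.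
  rewrite ler_piMr ?invr_ge0 ?(ltW a0)// expR_le1 mulr_ge0_le0 ?ln_tanh_le0//.
  by rewrite mulr_ge0// ltW.
have cr x : 0 < x -> {for x, continuous (rker a 1)} by exact: rker_continuous.
exact: (ftc_integrable dH cr (fun x _ => rker_ge0 a 1 x) HM).
Qed.

Lemma rker_1b_integrable b : 0 < b -> mu.-integrable `]0, +oo[ (EFin \o rker 1 b).
Proof.
move=> b0.
(* The primitive - (1 - u)^b / b, obtained from [kpow_hker_derive] at p = 0. *)
pose H x := - b^-1 * expR (- (2 * b * ln (cosh x))).
have HE t : complex.Re ((- b^-1)%:C * kpow (2 * 0) (2 * b%:C) t) = H t.
  rewrite /kpow mulr0 mul0r sub0r -(rmorph_nat (real_complex R) 2) -!rmorphM.
  by rewrite -rmorphN cexp_real -rmorphM.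
have dH x : 0 < x -> is_derive x 1 H (rker 1 b x).
  move=> x0; have [+ _] := is_cderiveZ (- b^-1)%:C (kpow_hker_derive 0 b%:C x0).
  have -> : (- b^-1)%:C * (0 * hker 0 (b%:C + 1) x - b%:C * hker (0 + 1) b%:C x) =
      (rker 1 b x)%:C.
    rewrite mul0r sub0r add0r -hker_real mulrN -mulNr mulrA -rmorphN -rmorphM/=.
    by rewrite opprK mulVf ?gt_eqF// mul1r.
  by have -> : (fun t => complex.Re ((- b^-1)%:C * kpow (2 * 0) (2 * b%:C) t)) = H
    by apply/funext.
have HM x : 0 < x -> `|H x| <= b^-1.
  move=> x0; rewrite normrM normrN !ger0_norm ?expR_ge0 ?invr_ge0 ?(ltW b0)//.
  rewrite ler_piMr ?invr_ge0 ?(ltW b0)// expR_le1 oppr_le0 mulr_ge0 ?ln_cosh_ge0//.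
  by rewrite mulr_ge0// ltW.
have cr x : 0 < x -> {for x, continuous (rker 1 b)} by exact: rker_continuous.
exact: (ftc_integrable dH cr (fun x _ => rker_ge0 1 b x) HM).
Qed.

(** Splitting at u = tanh^2 = 1/2: below it (1 - u)^(b - 1) is at most 2, above it u^(a - 1) is at
    most 2, since both exponents exceed -1. What is left are the two kernels with explicit
    primitives. *)
Lemma rker_le a b x : 0 < a -> 0 < b -> 0 < x ->
  rker a b x <= 2 * (rker a 1 x + rker 1 b x).
Proof.
move=> a0 b0 x0.
set L := ln (tanh x); set C := ln (cosh x).
have L0 : L <= 0 by exact: ln_tanh_le0.
have C0 : 0 <= C by exact: ln_cosh_ge0.
have ln20 : 0 < ln 2 :> R by rewrite ln_gt0// ltr1n.
have step (u v : R) : u <= ln 2 + v -> 2 * expR u <= 2 * (2 * expR v).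
  move=> uv; rewrite ler_pM2l// -[X in X * _](@lnK _ 2) ?posrE//.
  by rewrite -expRD ler_expR.
have [h|h] := leP (2 * C) (ln 2).
  apply: (@le_trans _ _ (2 * rker a 1 x)); last first.
    by rewrite ler_pM2l// lerDl rker_ge0.
  apply: step; rewrite -/L -/C.
  suff : (2 - 2 * b) * C <= ln 2 by lra.
  have : 0 <= b * C by rewrite mulr_ge0// ltW.
  lra.
apply: (@le_trans _ _ (2 * rker 1 b x)); last first.
  by rewrite ler_pM2l// lerDr rker_ge0.
apply: step; rewrite -/L -/C.
suff : (2 * a - 2) * L <= ln 2 by lra.
have hL : - 2 * L <= ln 2.
  have t2 : tanh x ^+ 2 \is Num.pos by rewrite posrE exprn_gt0// tanh_gt0.
  have eL : ln (tanh x ^+ 2) = 2 * L by rewrite lnXn ?tanh_gt0// mulr_natl.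
  have c2 : 0 < (cosh x ^+ 2)^-1 by rewrite invr_gt0 exprn_gt0 ?cosh_gt0.
  have eC : ln ((cosh x ^+ 2)^-1) = - (2 * C).
    by rewrite lnV ?posrE ?exprn_gt0 ?cosh_gt0// lnXn ?cosh_gt0// mulr_natl.
  have hC : (cosh x ^+ 2)^-1 < 2^-1.
    rewrite -ltr_ln ?posrE// eC lnV ?posrE//; lra.
  have hT : 2^-1 <= tanh x ^+ 2 by have := onem_tanh2 x; lra.
  by move: hT; rewrite -ler_ln ?posrE// lnV ?posrE// eL; lra.
have : a * L <= 0 by rewrite mulr_ge0_le0// ltW.
lra.
Qed.

Lemma rker_measurable a b : measurable_fun (`]0, +oo[%classic : set R) (rker a b).
Proof. by apply: continuous_measurable_0y => x x0; exact: rker_continuous. Qed.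

Lemma rker_integrable a b : 0 < a -> 0 < b ->
  mu.-integrable `]0, +oo[ (EFin \o rker a b).
Proof.
move=> a0 b0.
have h : mu.-integrable `]0, +oo[
    (fun x => (2%:E * ((EFin \o rker a 1) x + (EFin \o rker 1 b) x))%E).
  apply: integrableZl; first exact: measurable_0y.
  apply: integrableD; first exact: measurable_0y.
    exact: rker_a1_integrable.
  exact: rker_1b_integrable.
apply: (le_integrable _ _ _ h).
- exact: measurable_0y.
- by apply/measurable_EFinP; exact: rker_measurable.
- move=> x /=; rewrite in_itv/= andbT => x0.
  rewrite lee_fin ger0_norm ?rker_ge0// ger0_norm.
    exact: rker_le.
  by rewrite mulr_ge0// addr_ge0// rker_ge0.
Qed.

Lemma hker_integrable p q : 0 < complex.Re p -> 0 < complex.Re q ->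
  Cintegrable `]0, +oo[ (hker p q).
Proof.
move=> p0 q0.
apply: (Cintegrable_le measurable_0y _ _ (rker_integrable p0 q0)).
  by apply: Ccontinuous_measurable => x; exact: hker_continuous.
by move=> x _; rewrite cmod_hker.
Qed.

End Kernel.

(** * The Beta integral and its recurrences *)

Section BetaIntegral.
Context {R : realType}.
Implicit Types (p q z : R[i]) (x t a b s : R).

Lemma expR_ln_cvg0 (u : nat -> R) s : (forall n, 0 < u n) -> kcvg \oo u 0 ->
  0 < s -> kcvg \oo (fun n => expR (s * ln (u n))) 0.
Proof.
move=> u0 [/cvgrPdist_lt hu] s0; split; apply/cvgrPdist_lt => e e0.
apply: filterS (hu _ (expR_gt0 (ln e / s))) => n; rewrite !sub0r !normrN.
rewrite (gtr0_norm (u0 n)) gtr0_norm ?expR_gt0// => h.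
rewrite -[ltRHS]lnK ?posrE// ltr_expR -ltr_pdivlMl// mulrC.
by rewrite -(expRK (ln e / s)) ltr_ln ?posrE ?expR_gt0.
Qed.

Lemma kcvg_continuous (u : nat -> R) l (g : R -> R) : {for l, continuous g} ->
  kcvg \oo u l -> kcvg \oo (fun n => g (u n)) (g l).
Proof. by move=> cg [h]; split; exact: (cvg_comp _ _ h cg). Qed.

Lemma natV_cvg0 : kcvg \oo (fun n : nat => (n.+2%:R : R)^-1) 0.
Proof.
apply: (kcvg0_le (Kcvg (@cvg_harmonic R))) => n.
by rewrite invr_ge0 ler0n/= lef_pV2 ?posrE ?ltr0n// ler_nat.
Qed.

Lemma tanh_natV_cvg0 : kcvg \oo (fun n : nat => tanh (n.+2%:R : R)^-1) 0.
Proof.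
rewrite -(@tanh0 R); apply: (@kcvg_continuous _ _ (@tanh R)).
  exact: (is_derive_continuous (is_derive_tanh 0)).
exact: natV_cvg0.
Qed.

Lemma coshV_nat_cvg0 : kcvg \oo (fun n : nat => (cosh (n.+2%:R : R))^-1) 0.
Proof.
have h : kcvg \oo (fun n => 2 * @harmonic R n) (2 * 0).
  exact: (kcvgZl 2 (Kcvg (@cvg_harmonic R))).
rewrite mulr0 in h.
apply: (kcvg0_le h) => n; rewrite invr_ge0 (ltW (cosh_gt0 _))/=.
have -> : 2 * @harmonic R n = (n.+1%:R / 2)^-1 by rewrite invf_div.
have n20 : 0 < n.+1%:R / 2 :> R by rewrite divr_gt0.
rewrite lef_pV2 ?posrE ?cosh_gt0// /cosh ler_pM2r ?invr_gt0//.
rewrite (@le_trans _ _ (expR n.+2%:R))//; last by rewrite lerDl expR_ge0.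
rewrite (le_trans _ (expR_ge1Dx _))// (@le_trans _ _ n.+2%:R) ?ler_nat//.
by rewrite lerDr.
Qed.

Lemma kpow_cvg0_at0 p q : 0 < complex.Re p -> 0 <= complex.Re q ->
  kcvg \oo (fun n : nat => kpow p q (n.+2%:R : R)^-1) 0.
Proof.
move=> p0 q0; apply/kcvg_cmod.
have t0 (n : nat) : 0 < tanh (n.+2%:R : R)^-1 by rewrite tanh_gt0// invr_gt0.
apply: (kcvg0_le (expR_ln_cvg0 t0 tanh_natV_cvg0 p0)) => n.
rewrite cmod_ge0/= subr0 cmod_kpow ler_expR gerBl mulr_ge0//.
exact: ln_cosh_ge0.
Qed.

Lemma kpow_cvg0_at_infty p q : 0 <= complex.Re p -> 0 < complex.Re q ->
  kcvg \oo (fun n : nat => kpow p q (n.+2%:R : R)) 0.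
Proof.
move=> p0 q0; apply/kcvg_cmod.
have c0 (n : nat) : 0 < (cosh (n.+2%:R : R))^-1 by rewrite invr_gt0 cosh_gt0.
apply: (kcvg0_le (expR_ln_cvg0 c0 coshV_nat_cvg0 q0)) => n.
rewrite cmod_ge0/= subr0 cmod_kpow ler_expR lnV ?posrE ?cosh_gt0// mulrN.
by rewrite gerDr mulr_ge0_le0// ln_tanh_le0.
Qed.

Lemma kcvg_cexp (u : nat -> R[i]) l : kcvg \oo u l ->
  kcvg \oo (fun n => cexp (u n)) (cexp l).
Proof.
move=> /kcvg_ReIm[h1 h2].
have e : kcvg \oo (fun n => expR (complex.Re (u n))) (expR (complex.Re l)).
  by apply: (@kcvg_continuous _ _ (@expR R)) => //; exact: continuous_expR.
have c : kcvg \oo (fun n => cos (complex.Im (u n))) (cos (complex.Im l)).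
  by apply: (@kcvg_continuous _ _ (@cos R)) => //; exact: continuous_cos.
have s : kcvg \oo (fun n => sin (complex.Im (u n))) (sin (complex.Im l)).
  by apply: (@kcvg_continuous _ _ (@sin R)) => //; exact: continuous_sin.
apply/kcvg_ReIm; rewrite Re_cexp Im_cexp; split.
  by apply: (kcvg_eq (kcvgM e c)) => n; rewrite Re_cexp.
by apply: (kcvg_eq (kcvgM e s)) => n; rewrite Im_cexp.
Qed.

Lemma kpow_cvg1_at_infty p : kcvg \oo (fun n : nat => kpow p 0 (n.+2%:R : R)) 1.
Proof.
have h1 : kcvg \oo (fun n : nat => ln (tanh (n.+2%:R : R))) 0.
  have h2 : kcvg \oo (fun n : nat => 1 - (cosh (n.+2%:R : R))^-1 ^+ 2) 1.
    rewrite -[X in kcvg _ _ X]subr0; apply: kcvgB; first exact: kcvg_cst.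
    under eq_fun do rewrite expr2; rewrite -(mulr0 0).
    by apply: kcvgM; exact: coshV_nat_cvg0.
  have h3 : kcvg \oo (fun n : nat => ln (1 - (cosh (n.+2%:R : R))^-1 ^+ 2)) 0.
    rewrite -(@ln1 R); apply: (@kcvg_continuous _ _ (@ln R)) => //.
    exact: continuous_ln.
  have h4 : kcvg \oo (fun n : nat => 2^-1 * ln (1 - (cosh (n.+2%:R : R))^-1 ^+ 2))
      (2^-1 * 0).
    exact: (kcvgZl 2^-1 h3).
  rewrite mulr0 in h4.
  apply: (kcvg_eq h4) => n.
  rewrite exprVn -onem_tanh2 subKr lnXn ?tanh_gt0//.
  by move: (ln _) => y; lra.
have h5 : kcvg \oo (fun n : nat => cexp (p * (ln (tanh (n.+2%:R : R)))%:C)) (cexp (p * 0)).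
  exact: (kcvg_cexp (kcvgZl p (kcvg_real h1))).
rewrite mulr0 cexp0 in h5; apply: (kcvg_eq h5) => n.
by rewrite /kpow mul0r subr0.
Qed.

(** After u = tanh^2 this is Euler's Beta integral B(p, q). *)
Definition hbeta p q : R[i] := Cintegral `]0, +oo[ (hker p q).

Lemma hker_diff_continuous p q x : 0 < x ->
  Ccontinuous x (fun t => p * hker p (q + 1) t - q * hker (p + 1) q t).
Proof.
move=> x0; have h1 := is_cderiveZ p (is_cderiveZ 2 (kpow_cderive (2 * p - 1) (2 * (q + 1)) x0)).
have h2 := is_cderiveZ (- q) (is_cderiveZ 2 (kpow_cderive (2 * (p + 1) - 1) (2 * q) x0)).
have [c1 c2] := is_cderive_continuous (is_cderiveD h1 h2).
have -> : (fun t => p * hker p (q + 1) t - q * hker (p + 1) q t) =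
   (fun t => p * (2 * kpow (2 * p - 1) (2 * (q + 1)) t) +
     - q * (2 * kpow (2 * (p + 1) - 1) (2 * q) t)).
  by apply/funext => t; rewrite mulNr.
by split.
Qed.

Lemma Re_D1 z : complex.Re (z + 1) = complex.Re z + 1.
Proof. by rewrite cReD. Qed.

(** Integration of the derivative in [kpow_hker_derive]; u^p (1 - u)^q vanishes at both ends. *)
Lemma hbeta_ibp p q : 0 < complex.Re p -> 0 < complex.Re q ->
  p * hbeta p (q + 1) = q * hbeta (p + 1) q.
Proof.
move=> p0 q0.
have p1 : 0 < complex.Re (p + 1) by rewrite Re_D1 addr_gt0.
have q1 : 0 < complex.Re (q + 1) by rewrite Re_D1 addr_gt0.
have two (z : R[i]) : complex.Re (2 * z) = 2 * complex.Re z.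
  by rewrite cReM Re_nat Im_nat mul0r subr0.
have i1 := CintegrableZ measurable_0y p (hker_integrable p0 q1).
have i2 := CintegrableZ measurable_0y (- q) (hker_integrable p1 q0).
have e : (fun x => p * hker p (q + 1) x - q * hker (p + 1) q x) =
    (fun x => p * hker p (q + 1) x + - q * hker (p + 1) q x).
  by apply/funext => x; rewrite mulNr.
have i12 : Cintegrable `]0, +oo[ (fun x => p * hker p (q + 1) x - q * hker (p + 1) q x).
  by rewrite e; apply: CintegrableD => //; exact: measurable_0y.
have l0 : kcvg \oo (fun n : nat => kpow (2 * p) (2 * q) (n.+2%:R : R)^-1) 0.
  by apply: kpow_cvg0_at0; rewrite two ?mulr_gt0// mulr_ge0// ltW.
have ly : kcvg \oo (fun n : nat => kpow (2 * p) (2 * q) (n.+2%:R : R)) 0.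
  by apply: kpow_cvg0_at_infty; rewrite two ?mulr_gt0// mulr_ge0// ltW.
have := Cftc (fun x => @kpow_hker_derive _ p q x) (fun x => @hker_diff_continuous p q x) i12 l0 ly.
rewrite subr0 e (CintegralD measurable_0y i1 i2).
rewrite (CintegralZ measurable_0y _ (hker_integrable p0 q1)).
rewrite (CintegralZ measurable_0y _ (hker_integrable p1 q0)).
by rewrite mulNr => /eqP; rewrite subr_eq0 => /eqP.
Qed.

Lemma hbeta_split p q : 0 < complex.Re p -> 0 < complex.Re q ->
  hbeta p q = hbeta (p + 1) q + hbeta p (q + 1).
Proof.
move=> p0 q0.
have p1 : 0 < complex.Re (p + 1) by rewrite Re_D1 addr_gt0.
have q1 : 0 < complex.Re (q + 1) by rewrite Re_D1 addr_gt0.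
rewrite /hbeta -(CintegralD measurable_0y) ?hker_integrable//.
- apply: Cintegral_eq => x; rewrite inE/= in_itv/= andbT => x0.
  exact: hker_split.
- exact: hker_integrable.
- exact: hker_integrable.
Qed.

Lemma hbetaSr p q : 0 < complex.Re p -> 0 < complex.Re q ->
  (p + q) * hbeta p (q + 1) = q * hbeta p q.
Proof.
move=> p0 q0; rewrite mulrDl (hbeta_ibp p0 q0) -mulrDr.
by rewrite -(hbeta_split p0 q0).
Qed.

Lemma hbetaSl p q : 0 < complex.Re p -> 0 < complex.Re q ->
  (p + q) * hbeta (p + 1) q = p * hbeta p q.
Proof.
move=> p0 q0; rewrite mulrDl -(hbeta_ibp p0 q0) -mulrDr.
by rewrite -(hbeta_split p0 q0).
Qed.

(** Same primitive with q = 0: it still vanishes at 0 but tends to 1 at infinity. *)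
Lemma hbeta1 p : 0 < complex.Re p -> p * hbeta p 1 = 1.
Proof.
move=> p0.
have r1 : 0 < complex.Re (1 : R[i]) by exact: ltr01.
have i1 := CintegrableZ measurable_0y p (hker_integrable p0 r1).
have two (z : R[i]) : complex.Re (2 * z) = 2 * complex.Re z.
  by rewrite cReM Re_nat Im_nat mul0r subr0.
have e : (fun x => p * hker p (0 + 1) x - 0 * hker (p + 1) 0 x) =
    (fun x => p * hker p 1 x).
  by apply/funext => x; rewrite mul0r subr0 add0r.
have l0 : kcvg \oo (fun n : nat => kpow (2 * p) (2 * 0) (n.+2%:R : R)^-1) 0.
  by apply: kpow_cvg0_at0; rewrite two ?mulr_gt0// mulr0.
have ly : kcvg \oo (fun n : nat => kpow (2 * p) (2 * 0) (n.+2%:R : R)) 1.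
  by rewrite mulr0; exact: kpow_cvg1_at_infty.
have := Cftc (fun x => @kpow_hker_derive _ p 0 x) (fun x => @hker_diff_continuous p 0 x).
rewrite e => /(_ _ _ i1 l0 ly).
by rewrite subr0 (CintegralZ measurable_0y _ (hker_integrable p0 r1)).
Qed.

Lemma hbetaDr p q n : 0 < complex.Re p -> 0 < complex.Re q ->
  hbeta p (q + n%:R) = hbeta p q * (poch q n / poch (p + q) n).
Proof.
move=> p0 q0; have pq0 : 0 < complex.Re (p + q) by rewrite cReD addr_gt0.
elim: n => [|n IH]; first by rewrite addr0 !poch0 divr1 mulr1.
have qn : 0 < complex.Re (q + n%:R) by rewrite cReD Re_nat ltr_wpDr.
have pqn : p + (q + n%:R) != 0.
  by apply: Re_gt0_neq0; rewrite cReD addr_gt0.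
apply: (mulfI pqn); rewrite -natr1 (addrA q) hbetaSr// IH !pochS.
have -> : p + (q + n%:R) = p + q + n%:R by ring.
have {}pqn : p + q + n%:R != 0 by exact: Re_gt0_addn_neq0.
have := poch_Re_gt0 n pq0 => h.
by field; rewrite pqn h.
Qed.

Lemma hbetaDl p q n : 0 < complex.Re p -> 0 < complex.Re q ->
  hbeta (p + n%:R) q = hbeta p q * (poch p n / poch (p + q) n).
Proof.
move=> p0 q0; have pq0 : 0 < complex.Re (p + q) by rewrite cReD addr_gt0.
elim: n => [|n IH]; first by rewrite addr0 !poch0 divr1 mulr1.
have pn : 0 < complex.Re (p + n%:R) by rewrite cReD Re_nat ltr_wpDr.
have pqn : (p + n%:R) + q != 0.
  by apply: Re_gt0_neq0; rewrite cReD addr_gt0.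
apply: (mulfI pqn); rewrite -natr1 (addrA p) hbetaSl// IH !pochS.
have -> : p + n%:R + q = p + q + n%:R by ring.
have {}pqn : p + q + n%:R != 0 by exact: Re_gt0_addn_neq0.
have := poch_Re_gt0 n pq0 => h.
by field; rewrite pqn h.
Qed.

End BetaIntegral.

(** * The integrand of the Gamma integral *)

Section GammaKernel.
Context {R : realType}.
Local Notation mu := (@lebesgue_measure R).
Implicit Types (p q z : R[i]) (t a : R) (n : nat).

Definition gker z t : R[i] := cexp ((z - 1) * (ln t)%:C - t%:C).

Definition rgker a t : R := expR ((a - 1) * ln t - t).

Lemma Gamma_gker z : Gamma z = Cintegral `]0, +oo[ (gker z).
Proof.
apply: Cintegral_eq => t; rewrite inE/= in_itv/= andbT => t0.
by rewrite cpowR_cexp// -cexp_real -cexpD rmorphN.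
Qed.

Lemma is_cderive_cln z t : 0 < t ->
  is_cderive t (fun s => z * (ln s)%:C) (z * (t^-1)%:C).
Proof. by move=> t0; exact: (is_cderiveZ z (is_cderive_real (is_derive1_ln t0))). Qed.

Lemma gker_continuous z t : 0 < t -> Ccontinuous t (gker z).
Proof.
move=> t0.
have h1 := is_cderiveD (is_cderive_cln (z - 1) t0)
  (is_cderiveZ (- 1) (is_cderive_real (is_derive_id t 1))).
have -> : gker z = (fun s => cexp ((z - 1) * (ln s)%:C + -1 * (id s)%:C)).
  by apply/funext => s; rewrite /gker mulN1r.
exact: (is_cderive_continuous (is_cderive_cexp h1)).
Qed.

Lemma rgker_continuous a t : 0 < t -> {for t, continuous (rgker a)}.
Proof.
move=> t0; have -> : rgker a = (fun t => complex.Re (gker a%:C t)).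
  apply/funext => s.
  have -> : gker a%:C s = cexp ((a - 1) * ln s - s)%:C.
    by rewrite /gker rmorphB rmorphM rmorphB rmorph1.
  by rewrite cexp_real.
by have [] := gker_continuous a%:C t0.
Qed.

(** The comparison function [h] is t^(a - 1) (1 + t)^(-a - 1), whose primitive (t / (1 + t))^a / a
    is bounded; exp(-t) is at most a constant times (1 + t)^(-a - 1). *)
Lemma rgker_integrable a : 0 < a -> mu.-integrable `]0, +oo[ (EFin \o rgker a).
Proof.
move=> a0.
pose H t := a^-1 * expR (a * ln t - a * ln (1 + t)).
pose h t := expR ((a - 1) * ln t - (a + 1) * ln (1 + t)).
have dl t : 0 < t -> is_derive t 1 (fun s : R => ln (1 + s)) (1 + t)^-1.
  move=> t0; have t1 : 0 < 1 + t by rewrite addr_gt0.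
  have h1 := is_deriveD (is_derive_cst (1 : R) t (1 : R)) (is_derive_id t (1 : R)).
  have h2 := @is_derive1_comp _ (@ln R) (fun s => 1 + s) t _ _ (is_derive1_ln t1) h1.
  by apply: (is_derive_eq h2); rewrite add0r mulr1.
have dH t : 0 < t -> is_derive t 1 H (h t).
  move=> t0; have t1 : 0 < 1 + t by rewrite addr_gt0.
  have d1 := is_cderiveD (is_cderive_cln a%:C t0)
    (is_cderiveZ (- a)%:C (is_cderive_real (dl _ t0))).
  have [+ _] := is_cderiveZ (a^-1)%:C (is_cderive_cexp d1).
  have -> : (fun s => complex.Re ((a^-1)%:C *
      cexp (a%:C * (ln s)%:C + (- a)%:C * (ln (1 + s))%:C))) = H.
    apply/funext => s; rewrite -!rmorphM -rmorphD cexp_real -rmorphM/=.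
    by rewrite mulNr.
  have -> // : complex.Re ((a^-1)%:C * ((a%:C * (t^-1)%:C + (- a)%:C * ((1 + t)^-1)%:C) *
      cexp (a%:C * (ln t)%:C + (- a)%:C * (ln (1 + t))%:C))) = h t.
  rewrite -!rmorphM -!rmorphD cexp_real -!rmorphM/= /h.
  have -> : (a - 1) * ln t - (a + 1) * ln (1 + t) =
    (a * ln t + - a * ln (1 + t)) - ln t - ln (1 + t) by ring.
  rewrite [in RHS]expRD [in RHS]expRD !expRN !lnK ?posrE//.
  have t0' : t != 0 by rewrite gt_eqF. have t1' : 1 + t != 0 by rewrite gt_eqF.
  have a0' : a != 0 by rewrite gt_eqF.
  by field; rewrite t0' t1' a0'.
have ch t : 0 < t -> {for t, continuous h}.
  move=> t0.
  have d1 := is_cderiveD (is_cderive_cln (a - 1)%:C t0)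
    (is_cderiveZ (- (a + 1))%:C (is_cderive_real (dl _ t0))).
  have [+ _] := is_cderive_continuous (is_cderive_cexp d1).
  have -> // : (fun s => complex.Re
      (cexp ((a - 1)%:C * (ln s)%:C + (- (a + 1))%:C * (ln (1 + s))%:C))) = h.
  by apply/funext => s; rewrite -!rmorphM -rmorphD cexp_real/= mulNr.
have h0 t : 0 < t -> 0 <= h t by move=> _; exact: expR_ge0.
have HM t : 0 < t -> `|H t| <= a^-1.
  move=> t0; rewrite ger0_norm ?mulr_ge0 ?expR_ge0 ?invr_ge0 ?(ltW a0)//.
  rewrite ler_piMr ?invr_ge0 ?(ltW a0)// expR_le1 -mulrBr mulr_ge0_le0 ?(ltW a0)//.
  by rewrite subr_le0 ler_ln ?posrE ?addr_gt0// lerDr.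
have hI := ftc_integrable dH ch h0 HM.
(* From ln y <= y - 1 at y = (1 + t) / N one gets N ln (1 + t) <= 1 + t - N + N ln N; this is where
   [K] comes from. *)
have [N hN] := natr_bound (a + 1).
pose N1 : R := N%:R; have N0 : 0 < N1 by rewrite (lt_le_trans _ hN)// addr_gt0.
pose K := expR (1 + N1 * ln N1).
have KI : mu.-integrable `]0, +oo[ (fun t => (K%:E * (EFin \o h) t)%E).
  by apply: integrableZl => //; exact: measurable_0y.
apply: (le_integrable _ _ _ KI).
- exact: measurable_0y.
- apply/measurable_EFinP; apply: continuous_measurable_0y => t t0.
  exact: rgker_continuous.
- move=> t; rewrite /= in_itv/= andbT => t0.
  rewrite lee_fin ger0_norm ?expR_ge0// ger0_norm ?mulr_ge0 ?expR_ge0//.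
  rewrite /rgker /K /h -expRD ler_expR.
  have t1 : 0 < 1 + t by rewrite addr_gt0.
  have l0 : 0 <= ln (1 + t) by rewrite ln_ge0// lerDl ltW.
  suff : (a + 1) * ln (1 + t) <= 1 + t + N1 * ln N1 by lra.
  apply: (@le_trans _ _ (N1 * ln (1 + t))); first by rewrite ler_wpM2r.
  have q0 : 0 < (1 + t) / N1 by rewrite divr_gt0.
  have := @le_ln1Dx _ ((1 + t) / N1 - 1).
  rewrite subrKC ln_div ?posrE// => /(_ _) hl.
  have {}hl : ln (1 + t) - ln N1 <= (1 + t) / N1 - 1 by apply: hl; lra.
  have := ler_wpM2l (ltW N0) hl.
  have -> : N1 * ((1 + t) / N1 - 1) = 1 + t - N1 by field; rewrite gt_eqF.
  by lra.
Qed.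

Lemma Cintegral_patch (D A : set R) (f : R -> R[i]) : A `<=` D ->
  Cintegral D (fun x => if x \in A then f x else 0) = Cintegral A f.
Proof.
move=> AD; rewrite /Cintegral -[in RHS](setIidr AD) !Rintegral_mkcondr.
by congr (_ +i* _); apply: eq_Rintegral => x _; rewrite patchE; case: ifP.
Qed.

Lemma Cmeasurable_patch (D A : set R) (f : R -> R[i]) : measurable D ->
  measurable A -> A `<=` D -> Cmeasurable A f ->
  Cmeasurable D (fun x => if x \in A then f x else 0).
Proof.
move=> mD mA AD [m1 m2]; split.
  have -> : (fun x => complex.Re (if x \in A then f x else 0)) =
      (fun x => complex.Re (f x)) \_ A.
    by apply/funext => x; rewrite patchE; case: ifP.
  by apply/measurable_restrict => //; rewrite (setIidr AD).
have -> : (fun x => complex.Im (if x \in A then f x else 0)) =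
    (fun x => complex.Im (f x)) \_ A.
  by apply/funext => x; rewrite patchE; case: ifP.
by apply/measurable_restrict => //; rewrite (setIidr AD).
Qed.

End GammaKernel.

(** * Gamma as a limit of rescaled Beta integrals *)

Section GammaLimit.
Context {R : realType}.
Variables (p q : R[i]).
Hypotheses (p0 : 0 < complex.Re p) (q1 : 1 <= complex.Re q).
Implicit Types (t x : R) (n : nat).

Local Notation N n := (n.+1%:R : R).

(** t^(p - 1) (1 - t / N)^(N + q - 1) with N = n + 1, which approximates t^(p - 1) exp(-t) on ]0,
    N[. *)
Let fN n t : R[i] := cexp ((p - 1) * (ln t)%:C +
  (n.+1%:R + q - 1) * (ln (1 - t / N n))%:C).

(** The substitution t = N tanh^2 x carries the half-line onto ]0, N[ and turns [fN] into a Beta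
    kernel. *)
Let phi n x : R := N n * tanh x ^+ 2.
Let phi' n x : R := N n * (2 * tanh x * (cosh x ^+ 2)^-1).

Lemma onem_div_gt0 n t : t < N n -> 0 < 1 - t / N n.
Proof. by move=> tn; rewrite subr_gt0 ltr_pdivrMr// mul1r. Qed.

Lemma ln_onem_le n t : t < N n -> N n * ln (1 - t / N n) <= - t.
Proof.
move=> tn; have h0 := onem_div_gt0 tn.
have h := @le_ln1Dx _ (- (t / N n)).
have {}h : ln (1 - t / N n) <= - (t / N n) by apply: h; rewrite ltrN2 -subr_gt0.
have := ler_wpM2l (ler0n R n.+1) h.
by rewrite mulrN mulrCA divff// mulr1.
Qed.

(** With v = t / N, - ln (1 - v) = ln (1 + v / (1 - v)) <= v / (1 - v). Together with [ln_onem_le]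
    this squeezes N ln (1 - t / N) towards - t. *)
Lemma ln_onem_ge n t : t < N n -> - (t / (1 - t / N n)) <= N n * ln (1 - t / N n).
Proof.
move=> tn; have h0 := onem_div_gt0 tn.
have n0 : (n.+1%:R : R) != 0 by rewrite pnatr_eq0.
have h := @le_ln1Dx _ ((t / N n) / (1 - t / N n)).
have e : 1 + t / N n / (1 - t / N n) = (1 - t / N n)^-1.
  apply: (mulIf (lt0r_neq0 h0)); rewrite mulVf ?lt0r_neq0// mulrDl.
  by rewrite divfK ?lt0r_neq0// mul1r subrK.
rewrite e lnV ?posrE// in h.
have {}h : - ln (1 - t / N n) <= t / N n / (1 - t / N n).
  apply: h; rewrite -subr_gt0 opprK addrC e invr_gt0//.
have := ler_wpM2l (ler0n R n.+1) h.
have -> : n.+1%:R * (t / n.+1%:R / (1 - t / n.+1%:R)) = t / (1 - t / n.+1%:R) :> R.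
  by rewrite mulrA mulrCA divff// mulr1.
by lra.
Qed.

Lemma divN_cvg0 t : kcvg \oo (fun n => t / N n) 0.
Proof.
have h : kcvg \oo (fun n => t * @harmonic R n) (t * 0).
  exact: (kcvgZl t (Kcvg (@cvg_harmonic R))).
by rewrite mulr0 in h.
Qed.

Lemma near_ltN t : \forall n \near \oo, t < N n.
Proof.
have [M hM] := natr_bound t; exists M => // n /= Mn.
by rewrite (le_lt_trans hM)// ltr_nat ltnS.
Qed.

Lemma N_ln_cvg t : kcvg \oo (fun n => N n * ln (1 - t / N n)) (- t).
Proof.
have h1 : kcvg \oo (fun n => 1 - t / N n) (1 - 0).
  exact: (kcvgB (kcvg_cst _) (divN_cvg0 t)).
rewrite subr0 in h1.
have h2 : kcvg \oo (fun n => - (t * (1 - t / N n)^-1)) (- (t * 1^-1)).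
  by apply: kcvgN; apply: kcvgZl; apply: kcvgV => //; exact: oner_neq0.
rewrite invr1 mulr1 in h2.
split; apply: (@squeeze_cvgr _ _ _ _ (fun n => - (t * (1 - t / N n)^-1)) (fun=> - t)).
- have := near_ltN t; apply: filterS => n tn.
  by rewrite ln_onem_ge//= ln_onem_le.
- by have [] := h2.
- exact: cvg_cst.
Qed.

Lemma ln_onem_cvg0 t : kcvg \oo (fun n => ln (1 - t / N n)) 0.
Proof.
have h1 : kcvg \oo (fun n => 1 - t / N n) (1 - 0).
  exact: (kcvgB (kcvg_cst _) (divN_cvg0 t)).
rewrite subr0 in h1.
by rewrite -(@ln1 R); apply: (@kcvg_continuous _ _ _ (@ln R)) => //; exact: continuous_ln.
Qed.

Lemma fN_cvg t : kcvg \oo (fun n => fN n t) (gker p t).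
Proof.
apply: kcvg_cexp; apply: kcvgD; first exact: kcvg_cst.
have h1 : kcvg \oo (fun n => (N n * ln (1 - t / N n))%:C +
    (q - 1) * (ln (1 - t / N n))%:C) ((- t)%:C + (q - 1) * 0%:C).
  apply: kcvgD; first exact: kcvg_real (N_ln_cvg t).
  by apply: kcvgZl; exact: kcvg_real (ln_onem_cvg0 t).
rewrite mulr0 addr0 rmorphN in h1; apply: (kcvg_eq h1) => n.
by rewrite rmorphM rmorph_nat -mulrDl addrA.
Qed.

(** As Re q >= 1, the extra factor (1 - t / N)^(q - 1) has modulus at most 1, so the bound does not
    depend on [n]. *)
Lemma cmod_fN n t : 0 < t < N n -> cmod (fN n t) <= rgker (complex.Re p) t.
Proof.
move=> /andP[t0 tn]; rewrite /fN /rgker cmod_cexp ler_expR.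
have -> : complex.Re ((p - 1) * (ln t)%:C + (n.+1%:R + q - 1) * (ln (1 - t / N n))%:C)
  = (complex.Re p - 1) * ln t + N n * ln (1 - t / N n) +
    (complex.Re q - 1) * ln (1 - t / N n).
  rewrite !(cReD, cReN, cReM) Re_nat/=; ring.
have h := ln_onem_le tn.
have : (complex.Re q - 1) * ln (1 - t / N n) <= 0.
  rewrite mulr_ge0_le0 ?subr_ge0// ln_le0// gerBl divr_ge0//; exact: ltW.
lra.
Qed.

Lemma fN_continuous n t : 0 < t < N n -> Ccontinuous t (fN n).
Proof.
move=> /andP[t0 tn]; have h0 := onem_div_gt0 tn.
have dl : is_derive t 1 (fun s : R => ln (1 - s / N n)) ((1 - t / N n)^-1 * - (N n)^-1).
  have e : is_derive t 1 (fun s : R => 1 - s / N n) (- (N n)^-1).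
    have h1 := is_deriveB (is_derive_cst (1 : R) t (1 : R))
      (is_deriveZ (N n)^-1 (is_derive_id t (1 : R))).
    have -> : (fun s : R => 1 - s / N n) = cst 1 - (N n)^-1 \*: id.
      by apply/funext => s; rewrite /= mulrC.
    by apply: (is_derive_eq h1); rewrite sub0r /GRing.scale/= mulr1.
  exact: (@is_derive1_comp _ (@ln R) (fun s => 1 - s / N n) t _ _ (is_derive1_ln h0) e).
have d1 := is_cderiveD (is_cderive_cln (p - 1) t0)
  (is_cderiveZ (n.+1%:R + q - 1) (is_cderive_real dl)).
exact: (is_cderive_continuous (is_cderive_cexp d1)).
Qed.

Lemma phi_gt0 n x : 0 < x -> 0 < phi n x < N n.
Proof.
move=> x0; rewrite /phi mulr_gt0 ?exprn_gt0 ?tanh_gt0//=.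
by rewrite -[ltRHS]mulr1 ltr_pM2l// tanh2_lt1.
Qed.

Lemma is_derive_phi n x : is_derive x 1 (phi n) (phi' n x).
Proof.
have h := is_deriveZ (N n) (is_deriveX 2 (is_derive_tanh x)).
have -> : phi n = N n \*: (@tanh R ^+ 2) by apply/funext.
by apply: (is_derive_eq h); rewrite /phi' /GRing.scale/= expr1.
Qed.

Lemma phi'_continuous n : continuous (phi' n).
Proof.
move=> x.
have ct := is_derive_continuous (is_derive_tanh x).
have cc := is_derive_continuous (is_derive_cosh x).
have c2 : {for x, continuous (fun x : R => (cosh x ^+ 2)^-1)}.
  apply: cvgV; first by rewrite expf_neq0// cosh_neq0.
  by under eq_fun do rewrite expr2; rewrite expr2; exact: cvgM.
apply: cvgM; first exact: cvg_cst.
by apply: cvgM => //; apply: cvgM => //; exact: cvg_cst.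
Qed.

Lemma phi_incr n : {in `]0, +oo[ &, {homo phi n : x y / x < y}}.
Proof.
move=> x y; rewrite !in_itv/= !andbT => x0 y0 xy.
rewrite /phi ltr_pM2l// -ltrN2 -(ltrD2l 1) !onem_tanh2 ltf_pV2 ?posrE ?exprn_gt0 ?cosh_gt0//.
rewrite !cosh2E ltrD2l ltr_pXn2r// ?nnegrE ?ltW ?sinh_gt0//.
rewrite /sinh ltr_pM2r ?invr_gt0// ltrB// ltr_expR//.
by rewrite ltrN2.
Qed.

Lemma phi_bigcup n : \bigcup_m `[phi n m.+2%:R^-1, phi n m.+2%:R]%classic = `]0, N n[%classic.
Proof.
apply/seteqP; split => t.
  move=> [m _] /=; rewrite !in_itv/= => /andP[h1 h2].
  have x0 : 0 < (m.+2%:R : R)^-1 by rewrite invr_gt0.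
  have /andP[a0 _] := phi_gt0 n x0.
  have m0 : 0 < (m.+2%:R : R) by [].
  have /andP[_ b0] := phi_gt0 n m0.
  by rewrite (lt_le_trans a0 h1) (le_lt_trans h2 b0).
rewrite /= in_itv/= => /andP[t0 tn].
have h1 : kcvg \oo (fun m : nat => phi n (m.+2%:R)^-1) (N n * (0 * 0)).
  apply: kcvgZl; under eq_fun do rewrite expr2.
  by apply: kcvgM; exact: tanh_natV_cvg0.
have h2 : kcvg \oo (fun m : nat => phi n m.+2%:R) (N n * (1 - 0 * 0)).
  apply: kcvgZl.
  have h3 : kcvg \oo (fun m : nat => 1 - (cosh (m.+2%:R : R))^-1 * (cosh (m.+2%:R : R))^-1)
      (1 - 0 * 0).
    apply: kcvgB; first exact: kcvg_cst.
    by apply: kcvgM; exact: coshV_nat_cvg0.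
  by apply: (kcvg_eq h3) => m; rewrite -expr2 exprVn -onem_tanh2 subKr.
rewrite mulr0 mulr0 in h1; rewrite mulr0 subr0 mulr1 in h2.
have g1 : \forall m \near \oo, phi n (m.+2%:R)^-1 < t.
  by have [/cvgr_lt] := h1; apply.
have g2 : \forall m \near \oo, t < phi n m.+2%:R.
  by have [/cvgr_gt] := h2; apply.
have [m [m1 m2]] : exists m : nat, phi n (m.+2%:R)^-1 < t /\ t < phi n m.+2%:R.
  by have [m] := filter_ex (filterI g1 g2); exists m.
by exists m => //=; rewrite in_itv/= !ltW.
Qed.

Lemma fN_subst n x : 0 < x -> fN n (phi n x) * (phi' n x)%:C =
  cexp (p * (ln (N n))%:C) * hker p (q + n.+1%:R) x.
Proof.
move=> x0; have t0 := tanh_gt0 x0; have c0 := cosh_gt0 x.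
have e1 : ln (phi n x) = ln (N n) + 2 * ln (tanh x).
  rewrite /phi lnM ?posrE// ?exprn_gt0// lnXn// mulr_natl//.
have e2 : ln (1 - phi n x / N n) = - (2 * ln (cosh x)).
  have -> : phi n x / N n = tanh x ^+ 2 by rewrite /phi mulrC mulKf.
  by rewrite onem_tanh2 lnV ?posrE ?exprn_gt0// lnXn// mulr_natl.
have e3 : (phi' n x)%:C = 2 * cexp ((ln (N n) + ln (tanh x) - 2 * ln (cosh x))%:C).
  rewrite cexp_real expRD expRD expRN expRM_natl !lnK ?posrE//.
  rewrite /phi' -(rmorph_nat (real_complex R) 2) -rmorphM/=; congr (_%:C).
  by ring.
rewrite /fN e1 e2 e3 /hker /kpow mulrCA [RHS]mulrCA -!cexpD; congr (_ * cexp _).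
by rewrite !(rmorph_nat, rmorphD, rmorphN, rmorphM)/=; ring.
Qed.

(** The sequence is the integral of [fN n] over ]0, N[ after the substitution [phi]. Extended by 0
    beyond N, these integrands are dominated by [rgker] and converge to the Gamma integrand. *)
Lemma hbeta_Gamma : kcvg \oo (fun n => cexp (p * (ln (N n))%:C) * hbeta p (q + n.+1%:R))
  (Gamma p).
Proof.
have mD n : measurable (`]0, N n[%classic : set R) by exact: measurable_itv.
have sub n : (`]0, N n[%classic : set R) `<=` `]0, +oo[%classic.
  by move=> t; rewrite /= !in_itv/= andbT => /andP[].
have cf n t : `]0, N n[%classic t -> Ccontinuous t (fN n).
  by rewrite /= in_itv/= => h; exact: fN_continuous.
have mf n : Cmeasurable `]0, N n[%classic (fN n).
  split; apply: open_continuous_measurable_fun; (try exact: interval_open);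
    by move=> t; rewrite inE => /cf[].
have fI n : Cintegrable `]0, N n[%classic (fN n).
  apply: (@Cintegrable_le _ _ (mD n) _ (rgker (complex.Re p)) (mf n)).
    by move=> t; rewrite /= in_itv/= => h; exact: cmod_fN.
  apply: integrableS (rgker_integrable p0) => //; exact: measurable_0y.
have gI n : Cintegrable `]0, +oo[ (fun x => fN n (phi n x) * (phi' n x)%:C).
  apply: (@Cintegrable_eq _ _ measurable_0y
     (fun x => cexp (p * (ln (N n))%:C) * hker p (q + n.+1%:R) x)).
    by move=> x; rewrite inE/= in_itv/= andbT => x0; exact/esym/fN_subst.
  apply: CintegrableZ; first exact: measurable_0y.
  apply: hker_integrable => //.
  by rewrite cReD Re_nat addr_gt0// (lt_le_trans _ q1).
have e n : cexp (p * (ln (N n))%:C) * hbeta p (q + n.+1%:R) =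
    Cintegral `]0, N n[%classic (fN n).
  rewrite -(Csubstitution (fun x => is_derive_phi n x) (@phi'_continuous n)
    (@phi_incr n) (mD n) (phi_bigcup n) (cf n) (fI n) (gI n)).
  rewrite /hbeta -CintegralZ; last 2 first.
  - exact: measurable_0y.
  - apply: hker_integrable => //.
    by rewrite cReD Re_nat addr_gt0// (lt_le_trans _ q1).
  apply: Cintegral_eq => x; rewrite inE/= in_itv/= andbT => x0.
  exact/esym/fN_subst.
rewrite Gamma_gker.
have [||||_ h] := @Cdominated_convergence _ _ measurable_0y
  (fun n t => if t \in `]0, N n[%classic then fN n t else 0) (gker p)
  (EFin \o rgker (complex.Re p)).
- by move=> n; apply: Cmeasurable_patch => //; exact: measurable_0y.
- move=> t; rewrite /= in_itv/= andbT => t0.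
  apply: (kcvg_near (fN_cvg t)); apply: filterS (near_ltN t) => n tn.
  by rewrite ifT// inE/= in_itv/= t0.
- exact: rgker_integrable.
- move=> n t _; rewrite lee_fin; case: ifPn => [|_].
    by rewrite inE/= in_itv/= => /cmod_fN.
  by rewrite cmod0 expR_ge0.
by apply: (kcvg_eq h) => n; rewrite Cintegral_patch// -e.
Qed.

End GammaLimit.

(** * Euler's limit, functional equation and non-vanishing of Gamma *)

Section GammaFacts.
Context {R : realType}.
Local Notation mu := (@lebesgue_measure R).
Implicit Types (z : R[i]) (x : R) (n : nat).

Definition gpow z n : R[i] := cexp (z * (ln (n.+1%:R : R))%:C).

Lemma gpowD z1 z2 n : gpow (z1 + z2) n = gpow z1 n * gpow z2 n.
Proof. by rewrite /gpow mulrDl cexpD. Qed.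

Lemma gpow1 n : gpow 1 n = n.+1%:R.
Proof. by rewrite /gpow mul1r cexp_real lnK ?posrE// rmorph_nat. Qed.

(** Euler's approximation N^z N! / (z (z + 1) ... (z + N)) at N = n + 1; its denominator has N + 1 =
    n + 2 factors. *)
Definition geuler z n : R[i] := gpow z n * ((n.+1)`!%:R / poch z n.+2).

(** The case q = 1 of [hbeta_Gamma]: there B(z, 1 + N) = N! / (z)_(N + 1). *)
Lemma Gamma_euler z : 0 < complex.Re z -> kcvg \oo (geuler z) (Gamma z).
Proof.
move=> z0; have q1 : 1 <= complex.Re (1 : R[i]) by exact: lexx.
have q0 : 0 < complex.Re (1 : R[i]) by exact: ltr01.
apply: (kcvg_eq (hbeta_Gamma z0 q1)) => n.
rewrite hbetaDr// /geuler /gpow -poch1; congr (_ * _).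
have zn : z != 0 by exact: Re_gt0_neq0.
apply: (mulfI zn); rewrite mulrA hbeta1// mul1r [poch z _]pochSl invfM.
by rewrite [RHS]mulrCA mulVKf.
Qed.

Lemma natD_inv_cvg1 z : 0 < complex.Re z ->
  kcvg \oo (fun n => (n.+1%:R / (z + n.+1%:R) : R[i])) 1.
Proof.
move=> z0.
have h : kcvg \oo (fun n => z * (@harmonic R n)%:C + 1) (z * 0%:C + 1).
  apply: kcvgD; last exact: kcvg_cst.
  by apply: kcvgZl; apply: kcvg_real; apply: Kcvg; exact: cvg_harmonic.
rewrite mulr0 add0r in h.
have h2 : kcvg \oo (fun n => (z * (@harmonic R n)%:C + 1)^-1) 1^-1.
  by apply: kcvgV => //; exact: oner_neq0.
rewrite invr1 in h2; apply: (kcvg_eq h2) => n.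
have n0 : (n.+1%:R : R[i]) != 0 by rewrite pnatr_eq0.
have zn : z + n.+1%:R != 0 by exact: Re_gt0_addn_neq0.
have -> : (@harmonic R n)%:C = n.+1%:R^-1.
  by rewrite fmorphV rmorph_nat.
have -> : z * n.+1%:R^-1 + 1 = (z + n.+1%:R) / n.+1%:R.
  by rewrite mulrDl divff.
by rewrite invf_div.
Qed.

(** The Euler approximations at z + 1 and z differ by the factor z N / (z + 1 + N), which tends to
    z. *)
Lemma Gamma_add1 z : 0 < complex.Re z -> Gamma (z + 1) = z * Gamma z.
Proof.
move=> z0; have z1 : 0 < complex.Re (z + 1) by rewrite Re_D1 addr_gt0.
have h1 := Gamma_euler z1.
have h2 : kcvg \oo (fun n => n.+1%:R / (z + 1 + n.+1%:R) * (z * geuler z n))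
    (1 * (z * Gamma z)).
  exact: (kcvgM (natD_inv_cvg1 z1) (kcvgZl z (Gamma_euler z0))).
rewrite mul1r in h2.
apply: (kcvg_unique h1); apply: (kcvg_eq h2) => n.
rewrite /geuler gpowD gpow1 [poch (z + 1) _]pochS [poch z _]pochSl.
have zn : z != 0 by exact: Re_gt0_neq0.
move: (poch_Re_gt0 n.+1 z1) (@Re_gt0_addn_neq0 _ _ n.+1 z1).
move: (poch _ _) (_ + n.+1%:R) => y w y0 w0; move: (n.+1%:R : R[i]) => m.
by field; rewrite zn y0 w0.
Qed.

Lemma Gamma_addn z n : 0 < complex.Re z -> Gamma (z + n%:R) = Gamma z * poch z n.
Proof.
move=> z0; elim: n => [|n IH]; first by rewrite addr0 poch0 mulr1.
have zn : 0 < complex.Re (z + n%:R) by rewrite cReD Re_nat ltr_wpDr.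
by rewrite -natr1 addrA Gamma_add1// IH pochS; ring.
Qed.

Lemma Gamma_real_neq0 x : 0 < x -> Gamma x%:C != 0 :> R[i].
Proof.
move=> x0; apply: Re_gt0_neq0; rewrite Gamma_gker.
have e t : complex.Re (gker x%:C t) = rgker x t.
  have -> : gker x%:C t = cexp ((x - 1) * ln t - t)%:C.
    by rewrite /gker rmorphB rmorphM rmorphB rmorph1.
  by rewrite cexp_real.
have -> : complex.Re (Cintegral `]0, +oo[ (gker x%:C)) =
    \int[mu]_(t in `]0, +oo[) rgker x t.
  by apply: eq_Rintegral => t _; rewrite e.
have hI := rgker_integrable x0.
(* A lower bound of the integrand on [1, 2], where 0 <= ln t <= 1 and t <= 2. *)
pose m := expR (- `|x - 1| - 2).
have m0 : 0 < m by exact: expR_gt0.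
have s12 : (`[1, 2]%classic : set R) `<=` `]0, +oo[%classic.
  by move=> t; rewrite /= !in_itv/= andbT => /andP[t1 _]; rewrite (lt_le_trans _ t1).
have fin : (\int[mu]_(t in `]0%R, +oo[) (rgker x t)%:E)%E \is a fin_num.
  exact: integrable_fin_num hI.
rewrite -lte_fin /Rintegral fineK//.
have mr : measurable_fun (`]0, +oo[%classic : set R) (rgker x).
  by apply: continuous_measurable_0y => t; exact: rgker_continuous.
apply: (@lt_le_trans _ _ (\int[mu]_(t in `[1%R, 2%R]) (cst m%:E t))%E).
  rewrite integral_cst//= lebesgue_measure_itv/= lte_fin ltr1n/= -EFinB -EFinM lte_fin.
  by rewrite mulr_gt0//; lra.
apply: (@le_trans _ _ (\int[mu]_(t in `[1%R, 2%R]) (rgker x t)%:E)%E).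
  apply: ge0_le_integral => //.
  - by move=> t _; rewrite /= lee_fin ltW.
  - by apply/measurable_EFinP; apply: measurable_funS mr => //; exact: measurable_0y.
  - move=> t; rewrite /= in_itv/= => /andP[t1 t2]; rewrite lee_fin /m /rgker ler_expR.
    have l0 : 0 <= ln t by rewrite ln_ge0.
    have l1 : ln t <= 1.
      have := @le_ln1Dx _ (t - 1); rewrite subrKC => h.
      have := h; rewrite ltrBrDr; lra.
    have : - `|x - 1| <= (x - 1) * ln t.
      rewrite lerNl -mulNr (le_trans (ler_norm _))// normrM normrN.
      by rewrite ler_piMr// ger0_norm.
    by lra.
apply: ge0_subset_integral => //.
- by apply/measurable_EFinP.
- by move=> t _; rewrite lee_fin expR_ge0.
Qed.

End GammaFacts.

(** * The hypergeometric series at 1 *)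

Section GaussSummation.
Context {R : realType}.
Implicit Types (A B C : R[i]) (u : nat -> R) (k n : nat).

(** The hypothesis reads e u_k <= k u_k - (k + 1) u_(k + 1), so the partial sums telescope. *)
Lemma kummer_test u (e : R) N : 0 < e -> (forall k, 0 <= u k) ->
  (forall k, (N <= k)%N -> k.+1%:R * u k.+1 <= (k%:R - e) * u k) -> bdsum u.
Proof.
move=> e0 u0 hu.
have h n : e * \sum_(N <= k < N + n) u k <= N%:R * u N - (N + n)%:R * u (N + n)%N.
  elim: n => [|n IH]; first by rewrite addn0 big_geq// mulr0 subrr.
  rewrite addnS big_nat_recr ?leq_addr//= mulrDr.
  have := hu (N + n)%N (leq_addr _ _); lra.
exists (\sum_(0 <= k < N) u k + N%:R * u N / e) => n.
have [nN|Nn] := leqP n N.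
  apply: (@le_trans _ _ (\sum_(0 <= k < N) u k)).
    by rewrite [leRHS](big_cat_nat (n := n))//= lerDl sumr_ge0.
  by rewrite lerDl divr_ge0 ?mulr_ge0 ?(ltW e0).
rewrite (big_cat_nat (n := N))//= ?(ltnW Nn)// lerD2l ler_pdivlMr// mulrC.
have := h (n - N)%N; rewrite subnKC ?(ltnW Nn)// => /le_trans; apply.
by rewrite gerBl mulr_ge0.
Qed.

(** From rank N on, k u_k decreases while u is summable; a nonzero limit would make u behave like 1
    / k. *)
Lemma kummer_cvg0 u (e : R) N : 0 < e -> (forall k, 0 <= u k) ->
  (forall k, (N <= k)%N -> k.+1%:R * u k.+1 <= (k%:R - e) * u k) ->
  kcvg \oo (fun k => k%:R * u k) 0.
Proof.
move=> e0 u0 hu; have bu := kummer_test e0 u0 hu.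
have dec k : (N <= k)%N -> k.+1%:R * u k.+1 <= k%:R * u k.
  move=> Nk; apply: le_trans (hu k Nk) _.
  by rewrite ler_wpM2r// gerBl ltW.
have decn m k : (N <= m)%N -> (m <= k)%N -> k%:R * u k <= m%:R * u m.
  move=> Nm; elim: k => [|k IH]; first by rewrite leqn0 => /eqP ->.
  rewrite leq_eqVlt => /predU1P[->//|]; rewrite ltnS => mk.
  by apply: le_trans (IH mk); apply: dec; exact: leq_trans mk.
split; apply/cvgrPdist_le => d d0.
have d4 : 0 < d / 2 by rewrite divr_gt0.
have [M hM] := bdsum_tail u0 bu d4.
pose L := (maxn (maxn N M) 1).
have NL : (N <= L)%N by rewrite /L !leq_max leqnn.
have ML : (M <= L)%N by rewrite /L !leq_max leqnn orbT.
have L0 : (0 < L)%N by rewrite /L leq_max leqnn orbT.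
exists (L + L)%N => // k /= Lk; rewrite sub0r normrN ger0_norm ?mulr_ge0//.
apply: (@le_trans _ _ ((L + L)%:R * u (L + L)%N)).
  by apply: decn => //; rewrite (leq_trans NL)// leq_addr.
(* Every term of the block from L to 2L is at least u_(2L), so L u_(2L) is bounded by a tail of the
   series. *)
have step : L%:R * u (L + L)%N <= \sum_(L <= j < L + L) u j.
  apply: (@le_trans _ _ (\sum_(L <= j < L + L) u (L + L)%N)).
    by rewrite sumr_const_nat addnK mulr_natl.
  rewrite big_nat [leRHS]big_nat; apply: ler_sum => j /andP[Lj jL].
  have j0 : 0 < j%:R :> R by rewrite ltr0n (leq_trans L0).
  have h := decn j (L + L)%N (leq_trans NL Lj) (ltnW jL).
  rewrite -(ler_pM2l j0) (le_trans _ h)// ler_wpM2r// ler_nat.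
  exact: ltnW.
have h2 : \sum_(L <= j < L + L) u j <= d / 2.
  apply: le_trans (hM (L + L)%N).
  by rewrite [leRHS](big_cat_nat (n := L))//= ?leq_addr// lerDr sumr_ge0.
rewrite natrD mulrDl; lra.
Qed.

(** The numerators keep |(A)_k| instead of (|A|)_k: only then does the ratio see Re A, on which the
    convergence condition bears. The real [c] gives one majorant for all lower parameters with real
    part at least c. *)
Definition gmaj A B (c : R) k : R :=
  cmod (poch A k) * cmod (poch B k) / (poch c k * k`!%:R).

Lemma gmaj_ge0 A B c k : 0 < c -> 0 <= gmaj A B c k.
Proof.
by move=> c0; rewrite /gmaj divr_ge0 ?mulr_ge0 ?cmod_ge0// ltW// poch_gt0.
Qed.

(** For large k the imaginary part contributes only O(1 / k) to the modulus: Im(A)^2 <= e (Re A + k)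
    is enough. *)
Lemma cmod_addn_le A (e : R) : 0 < e -> exists M, forall k, (M <= k)%N ->
  cmod (A + k%:R) <= complex.Re A + k%:R + e.
Proof.
move=> e0; pose y := `|complex.Re A| + complex.Im A ^+ 2 / e.
have [M hM] := natr_bound y; exists M => k Mk.
have hk : y <= k%:R by rewrite (le_trans hM)// ler_nat.
have i0 : 0 <= complex.Im A ^+ 2 / e by rewrite divr_ge0 ?sqr_ge0 ?ltW.
have hr := ler_norm (- complex.Re A); rewrite normrN in hr.
have x0 : complex.Im A ^+ 2 / e <= complex.Re A + k%:R by move: hk; rewrite /y; lra.
have s0 : 0 <= complex.Re A + k%:R + e by lra.
rewrite -[leRHS]ger0_norm// -sqrtr_sqr /cmod ler_wsqrtr// cReD cImD Re_nat Im_nat addr0.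
rewrite ler_pdivrMr// in x0.
have : 0 <= (complex.Re A + k%:R) * e.
  by rewrite (le_trans _ x0)// sqr_ge0.
by have := sqr_ge0 e; nra.
Qed.

Lemma gmaj_kummer A B c : 0 < c -> complex.Re (A + B) < c ->
  exists e N, 0 < e /\ forall k, (N <= k)%N ->
    k.+1%:R * gmaj A B c k.+1 <= (k%:R - e) * gmaj A B c k.
Proof.
move=> c0; rewrite cReD => hc.
(* The excess is cut into five: one part for each modulus estimate, one for the margin in Kummer's
   test, and two whose multiple by k absorbs the constant terms. *)
pose e := (c - complex.Re A - complex.Re B) / 5.
have e0 : 0 < e by rewrite divr_gt0//; lra.
have [M1 h1] := cmod_addn_le A e0; have [M2 h2] := cmod_addn_le B e0.
pose a1 := complex.Re A + e; pose b1 := complex.Re B + e.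
have [M3 h3] := natr_bound ((`|a1 * b1| + e * c) / (2 * e)).
exists e, (maxn M1 (maxn M2 M3)); split=> // k; rewrite !geq_max => /and3P[k1 k2 k3].
have ck : 0 < c + k%:R by rewrite ltr_wpDr.
have -> : k.+1%:R * gmaj A B c k.+1 =
    cmod (A + k%:R) * cmod (B + k%:R) / (c + k%:R) * gmaj A B c k.
  rewrite /gmaj !pochS !cmodM factS natrM.
  have p0 : poch c k != 0 by rewrite gt_eqF ?poch_gt0.
  have f0 := fact_neq0 R k; have s0 : k.+1%:R != 0 :> R by rewrite pnatr_eq0.
  have ck' : c + k%:R != 0 by rewrite gt_eqF.
  by field; rewrite ck' nat1r s0 f0 p0.
rewrite ler_wpM2r ?gmaj_ge0// ler_pdivrMr//.
have {}h1 := h1 k k1; have {}h2 := h2 k k2.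
apply: (@le_trans _ _ ((a1 + k%:R) * (b1 + k%:R))).
  by rewrite ler_pM ?cmod_ge0// /a1 /b1; lra.
have {}h3 : `|a1 * b1| + e * c <= k%:R * (2 * e).
  have e2 : 0 < 2 * e by rewrite mulr_gt0.
  by rewrite -(ler_pdivrMr _ _ e2); apply: le_trans h3 _; rewrite ler_nat.
have hab := ler_norm (a1 * b1).
have eE : c - complex.Re A - complex.Re B = 5 * e by rewrite /e; field.
have -> : (k%:R - e) * (c + k%:R) = k%:R ^+ 2 + k%:R * (c - e) - e * c by ring.
have -> : (a1 + k%:R) * (b1 + k%:R) = k%:R ^+ 2 + k%:R * (a1 + b1) + a1 * b1 by ring.
have -> : a1 + b1 = (c - e) - 2 * e by rewrite /a1 /b1; lra.
rewrite mulrBr; lra.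
Qed.

Lemma gmaj_bdsum A B c : 0 < c -> complex.Re (A + B) < c -> bdsum (gmaj A B c).
Proof.
move=> c0 hc; have [e [N [e0 h]]] := gmaj_kummer c0 hc.
by apply: (kummer_test e0 _ h) => k; exact: gmaj_ge0.
Qed.

Lemma cmod_gcoef_le A B C c k : 0 < c -> c <= complex.Re C ->
  cmod (gcoef A B C k) <= gmaj A B c k.
Proof.
move=> c0 cC; rewrite /gcoef /gmaj !cmodM cmodV cmodM cmod_nat.
rewrite ler_wpM2l ?mulr_ge0 ?cmod_ge0// lef_pV2 ?posrE; last 2 first.
- rewrite mulr_gt0 ?ltr0n ?fact_gt0// (lt_le_trans (poch_gt0 k (lt_le_trans c0 cC)))//.
  by rewrite poch_le_cmod// (le_trans (ltW c0)).
- by rewrite mulr_gt0 ?ltr0n ?fact_gt0// poch_gt0.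
rewrite ler_wpM2r// (le_trans (ler_poch _ (ltW c0) cC))//.
by rewrite poch_le_cmod// (le_trans (ltW c0)).
Qed.

Definition gauss1 A B C : R[i] := klim (gcoef A B C).

Lemma gauss1P A B C : 0 < complex.Re C -> complex.Re (A + B) < complex.Re C ->
  ksum (gcoef A B C) (gauss1 A B C).
Proof.
move=> C0 hC; have [|s hs] := @abs_summable _ (gcoef A B C).
  apply: (@bdsum_le _ _ (gmaj A B (complex.Re C)) 0) (gmaj_bdsum C0 hC).
    by move=> k; exact: gmaj_ge0.
  by move=> k _; exact: cmod_gcoef_le.
by rewrite /gauss1 (ksum_lim hs).
Qed.

(** The difference of the two partial sums of rank n collapses to - C n times the n-th coefficient,
    and this boundary term tends to 0 by [kummer_cvg0]. *)
Lemma gauss1_contiguous A B C : 0 < complex.Re C ->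
  complex.Re (A + B) < complex.Re C ->
  C * (C - A - B) * gauss1 A B C = (C - A) * (C - B) * gauss1 A B (C + 1).
Proof.
move=> C0 hC.
have C1 : 0 < complex.Re (C + 1) by rewrite Re_D1 addr_gt0.
have hC1 : complex.Re (A + B) < complex.Re (C + 1) by rewrite Re_D1 ltr_wpDr.
have s1 := ksumZ (C * (C - A - B)) (gauss1P C0 hC).
have s2 := ksumZ ((C - A) * (C - B)) (gauss1P C1 hC1).
have s12 := ksumB s1 s2.
apply/eqP; rewrite -subr_eq0; apply/eqP; apply: (kcvg_unique s12).
have w0 : kcvg \oo (fun k => k%:R * gcoef A B C k) 0.
  have [e [N [e0 h]]] := gmaj_kummer C0 hC.
  have g0 k := gmaj_ge0 A B k C0.
  apply/kcvg_cmod; apply: (kcvg0_le (kummer_cvg0 e0 g0 h)) => k.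
  rewrite cmod_ge0 subr0 cmodM cmod_nat ler_wpM2l//.
  exact: cmod_gcoef_le.
have w1 : kcvg \oo (fun k => - C * (k%:R * gcoef A B C k)) (- C * 0).
  exact: kcvgZl.
rewrite mulr0 in w1; apply: (kcvg_eq w1) => n.
rewrite /series/=; elim: n => [|n IH]; first by rewrite big_nil mul0r mulr0.
rewrite big_nat_recr//= -IH gcoefS.
have -> : gcoef A B (C + 1) n = gcoef A B C n * (C / (C + n%:R)).
  have e : poch C n * (C + n%:R) = C * poch (C + 1) n by rewrite -pochS pochSl.
  have p0 := poch_Re_gt0 n C0; have p1 := poch_Re_gt0 n C1.
  have c0 := Re_gt0_neq0 C0; have cn := @Re_gt0_addn_neq0 _ _ n C0.
  have f0 := fact_neq0 R[i] n.
  rewrite /gcoef.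
  have -> : poch (C + 1) n = poch C n * (C + n%:R) / C by rewrite e mulrAC divff// mul1r.
  by field; rewrite f0 p0 cn c0.
have cn := @Re_gt0_addn_neq0 _ _ n C0.
have s0 : n.+1%:R != 0 :> R[i] by rewrite pnatr_eq0.
move: (gcoef A B C n) => g.
have -> : - C * (n.+1%:R * (g * ((A + n%:R) * (B + n%:R) / ((C + n%:R) * n.+1%:R)))) =
    - C * (g * ((A + n%:R) * (B + n%:R) / (C + n%:R))).
  by congr (_ * _); rewrite mulrCA; congr (_ * _); field; rewrite nat1r s0 cn.
by field.
Qed.

Lemma poch_ge1 (x : R) m : 1 <= x -> 1 <= poch x m.
Proof.
move=> x1; elim: m => [|m IH]; first by rewrite poch0.
by rewrite pochS mulr_ege1// (le_trans x1)// lerDl.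
Qed.

(** Each coefficient of positive rank is O(1 / n), and [gmaj] at Re C dominates all these series at
    once. *)
Lemma gauss1_cvg1 A B C : 0 < complex.Re C -> complex.Re (A + B) < complex.Re C ->
  kcvg \oo (fun n => gauss1 A B (C + n%:R)) 1.
Proof.
move=> C0 hC.
have Cn n : complex.Re C <= complex.Re (C + n%:R) by rewrite cReD Re_nat lerDl.
apply: (@tannery _ (fun n k => gcoef A B (C + n%:R) k) _
  (fun k => if k is 0 then 1 else 0) 1 (gmaj A B (complex.Re C))).
- exact: gmaj_bdsum.
- by move=> n k; exact: cmod_gcoef_le.
- case=> [|k].
    by apply: (kcvg_eq (kcvg_cst 1)) => n; rewrite gcoef0.
  have h : kcvg \oo (fun n => cmod (poch A k.+1) * cmod (poch B k.+1) *
      (@harmonic R n * (1 + (complex.Re C)^-1)))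
      (cmod (poch A k.+1) * cmod (poch B k.+1) * (0 * (1 + (complex.Re C)^-1))).
    apply: kcvgZl; apply: kcvgM (kcvg_cst _); exact: Kcvg (@cvg_harmonic R).
  rewrite mul0r mulr0 in h; apply/kcvg_cmod; apply: (kcvg0_le h) => n.
  rewrite cmod_ge0/= subr0 /gcoef !cmodM cmodV cmodM cmod_nat.
  have Cn0 := lt_le_trans C0 (Cn n).
  rewrite ler_wpM2l ?mulr_ge0 ?cmod_ge0//.
  have hp : complex.Re (C + n%:R) <= cmod (poch (C + n%:R) k.+1) * k.+1`!%:R.
    apply: (@le_trans _ _ (poch (complex.Re (C + n%:R)) k.+1)); last first.
      rewrite (le_trans (poch_le_cmod _ (ltW Cn0)))// ler_peMr ?cmod_ge0//.
      by rewrite ler1n fact_gt0.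
    rewrite pochSl ler_peMr ?(ltW Cn0)//.
    by apply: poch_ge1; rewrite lerDr ltW.
  have e : 0 < complex.Re C + n%:R by rewrite ltr_wpDr.
  apply: (@le_trans _ _ (complex.Re C + n%:R)^-1).
    rewrite lef_pV2 ?posrE ?(lt_le_trans Cn0 hp)//.
    by move: hp; rewrite cReD Re_nat.
  have n0 : 0 < n.+1%:R :> R by rewrite ltr0n.
  rewrite /harmonic/= ler_pdivlMl// ler_pdivrMr//.
  have cV : (complex.Re C)^-1 * complex.Re C = 1 by rewrite mulVf// gt_eqF.
  have cn : 0 <= (complex.Re C)^-1 * n%:R by rewrite mulr_ge0// invr_ge0 ltW.
  rewrite mulrDl mul1r mulrDr cV -natr1; have := ltW C0; lra.
- move=> n; apply: gauss1P; first exact: lt_le_trans (Cn n).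
  exact: lt_le_trans (Cn n).
- have := @ksum_finite _ (fun k => if k is 0 then 1 else 0 : R[i]) 1.
  by rewrite big_nat1; apply; case.
Qed.

End GaussSummation.

(** * Integrating the Beta kernel against a 2F1 *)

Section KernelSeries.
Context {R : realType}.
Local Notation mu := (@lebesgue_measure R).
Implicit Types (a b P : R[i]) (c x : R) (k n : nat).

Lemma tanh2_itv x : `|tanh x ^+ 2| < 1.
Proof. by rewrite ger0_norm ?sqr_ge0// tanh2_lt1. Qed.

Lemma hker_addn (p q : R[i]) k x : 0 < x ->
  hker (p + k%:R) q x = hker p q x * ((tanh x ^+ 2)%:C) ^+ k.
Proof.
move=> x0; rewrite /hker -mulrA; congr (_ * _).
have := kpow_split (2 * p - 1) (2 * q) (2 * k) 0 x0.
rewrite expr0 mulr1 subr0 => e.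
rewrite rmorphXn -exprM -e; apply: kpow_eq => //.
by rewrite natrM; ring.
Qed.

Definition jker a b c P x : R[i] :=
  hker c%:C P x * gsum a (c%:C - b) c%:C (tanh x ^+ 2).

Lemma Rintegral_rker c (q : R) k : 0 < c -> 0 < q ->
  \int[mu]_(x in `]0, +oo[) rker (c + k%:R) q x =
  (\int[mu]_(x in `]0, +oo[) rker c q x) * (poch c k / poch (c + q) k).
Proof.
move=> c0 q0.
have e (d : R) : hbeta d%:C q%:C = (\int[mu]_(x in `]0, +oo[) rker d q x)%:C.
  have -> : hbeta d%:C q%:C = Cintegral `]0, +oo[ (fun x => (rker d q x)%:C).
    by apply: Cintegral_eq => x _; exact: hker_real.
  apply: complex_eqP => //; rewrite /Cintegral [LHS]/= [RHS]/=.
  by rewrite Rintegral_cst ?mul0r//; exact: measurable_0y.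
suff h : (\int[mu]_(x in `]0, +oo[) rker (c + k%:R) q x)%:C =
    (\int[mu]_(x in `]0, +oo[) rker c q x)%:C * (poch c k / poch (c + q) k)%:C.
  by move: h; rewrite -rmorphM => /complexI.
rewrite -!e.
have c0C : 0 < complex.Re c%:C by [].
have q0C : 0 < complex.Re q%:C by [].
have := hbetaDl k c0C q0C; rewrite rmorphD rmorph_nat => ->.
by rewrite -rmorphD -!real_poch rmorphM fmorphV.
Qed.

(** Integrating the k-th term multiplies it by (c)_k / (c + P)_k, which replaces the lower parameter
    c by c + P and the variable by 1. The same happens to the moduli, giving [gmaj] with lower
    parameter c + Re P; it is summable because the excess P + b - a has positive real part. *)
Lemma jker_integral a b c P : 0 < c -> 0 < complex.Re P ->
  0 < complex.Re (P + b - a) ->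
  Cintegrable `]0, +oo[ (jker a b c P) /\
  Cintegral `]0, +oo[ (jker a b c P) =
    hbeta c%:C P * gauss1 a (c%:C - b) (c%:C + P).
Proof.
move=> c0 P0 Q0; set B := c%:C - b.
have c0C : 0 < complex.Re c%:C by [].
pose f_ k x : R[i] := gcoef a B c%:C k * hker (c%:C + k%:R) P x.
pose g_ k x := cmod (gcoef a B c%:C k) * rker (c + k%:R) (complex.Re P) x.
have ck k : 0 < c + k%:R by rewrite ltr_wpDr.
have ckC k : 0 < complex.Re (c%:C + k%:R) by rewrite cReD Re_nat.
have fI k : Cintegrable `]0, +oo[ (f_ k).
  by apply: CintegrableZ; [exact: measurable_0y|exact: hker_integrable].
have gI k : mu.-integrable `]0, +oo[ (EFin \o g_ k).
  have h := rker_integrable (ck k) P0.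
  exact: (@integrableZl _ _ _ mu _ measurable_0y _ _ h).
have fg k x : `]0, +oo[%classic x -> cmod (f_ k x) <= g_ k x.
  by move=> _; rewrite /f_ cmodM cmod_hker cReD Re_nat.
have hC : complex.Re (a + B) < c + complex.Re P.
  move: Q0; rewrite /B !(cReD, cReN)/=; lra.
have cP0 : 0 < c + complex.Re P by rewrite addr_gt0.
have bg : bdsum (fun k => \int[mu]_(x in `]0, +oo[) g_ k x).
  have e k : \int[mu]_(x in `]0, +oo[) g_ k x =
     (\int[mu]_(x in `]0, +oo[) rker c (complex.Re P) x) *
       gmaj a B (c + complex.Re P) k.
    rewrite /g_ RintegralZl; [|exact: measurable_0y|exact: rker_integrable].
    rewrite Rintegral_rker// /gcoef /gmaj !cmodM cmodV cmodM cmod_nat.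
    rewrite -real_poch cmodR ger0_norm ?(ltW (poch_gt0 _ _))//.
    have p0 : poch c k != 0 by rewrite gt_eqF ?poch_gt0.
    have p1 : poch (c + complex.Re P) k != 0 by rewrite gt_eqF ?poch_gt0.
    have f0 := fact_neq0 R k.
    by field; rewrite f0 p1 p0.
  under eq_fun do rewrite e.
  apply: bdsumZ; last exact: gmaj_bdsum.
  by apply: Rintegral_ge0 => x _; exact: rker_ge0.
have fs x : `]0, +oo[%classic x -> ksum (fun k => f_ k x) (jker a b c P x).
  rewrite /= in_itv/= andbT => x0.
  apply: (ksum_eq (ksumZ (hker c%:C P x) (gsumP a B c0C (tanh2_itv x)))) => k.
  by rewrite /f_ hker_addn// mulrCA.
have [I1 I2] := Cintegral_series measurable_0y
  (fun k => Cintegrable_measurable (fI k)) gI fg bg fs.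
split=> //; apply: (ksum_unique I2).
have cPC : 0 < complex.Re (c%:C + P) by rewrite cReD.
have hC' : complex.Re (a + B) < complex.Re (c%:C + P) by rewrite [ltRHS]cReD.
apply: (ksum_eq (ksumZ (hbeta c%:C P) (gauss1P cPC hC'))) => k.
rewrite /f_ CintegralZ; [|exact: measurable_0y|exact: hker_integrable].
rewrite -/(hbeta _ _) hbetaDl// /gcoef.
have p0 := poch_Re_gt0 k c0C; have p1 := poch_Re_gt0 k cPC.
have f0 := fact_neq0 R[i] k.
by field; rewrite f0 p1 p0.
Qed.

Definition jint a b c P : R[i] := hbeta c%:C P * gauss1 a (c%:C - b) (c%:C + P).

(** The Beta recurrence in P and the contiguous relation at C = c + P both carry a factor c + P,
    which cancels. *)
Lemma jint_rec a b c P : 0 < c -> 0 < complex.Re P -> 0 < complex.Re (P + b - a) ->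
  P * (P + b - a) * jint a b c P =
  (P + c%:C - a) * (P + b) * jint a b c (P + 1).
Proof.
move=> c0 P0 Q0; have c0C : 0 < complex.Re c%:C by [].
have C0 : 0 < complex.Re (c%:C + P) by rewrite cReD addr_gt0.
have hC : complex.Re (a + (c%:C - b)) < complex.Re (c%:C + P).
  by move: Q0; rewrite !(cReD, cReN)/=; lra.
have h1 := gauss1_contiguous C0 hC; have h2 := hbetaSr c0C P0.
have C0n := Re_gt0_neq0 C0.
apply: (mulfI C0n); rewrite /jint addrA.
have e1 : c%:C + P - a - (c%:C - b) = P + b - a by ring.
have e2 : c%:C + P - (c%:C - b) = P + b by ring.
have e3 : P + c%:C - a = c%:C + P - a by ring.
rewrite e1 e2 in h1; rewrite e3.
transitivity (P * hbeta c%:C P * ((c%:C + P) * (P + b - a) *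
  gauss1 a (c%:C - b) (c%:C + P))); first by ring.
by rewrite h1 -h2; ring.
Qed.

Lemma jint_addn a b c P n : 0 < c -> 0 < complex.Re P ->
  0 < complex.Re (P + b - a) ->
  poch P n * poch (P + b - a) n * jint a b c P =
  poch (P + c%:C - a) n * poch (P + b) n * jint a b c (P + n%:R).
Proof.
move=> c0 P0 Q0; elim: n => [|n IH]; first by rewrite !poch0 !mul1r addr0.
have Pn : 0 < complex.Re (P + n%:R) by rewrite cReD Re_nat ltr_wpDr.
have Qn : 0 < complex.Re (P + n%:R + b - a).
  have -> : P + n%:R + b - a = P + b - a + n%:R by ring.
  by rewrite cReD Re_nat ltr_wpDr.
have := jint_rec c0 Pn Qn.
rewrite -natr1 !pochS (addrA P).
have -> : P + n%:R + b - a = P + b - a + n%:R by ring.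
have -> : P + n%:R + c%:C - a = P + c%:C - a + n%:R by ring.
have -> : P + n%:R + b = P + b + n%:R by ring.
move=> h.
transitivity ((P + n%:R) * (P + b - a + n%:R) *
  (poch P n * poch (P + b - a) n * jint a b c P)); first by ring.
rewrite IH.
transitivity (poch (P + c%:C - a) n * poch (P + b) n *
  ((P + n%:R) * (P + b - a + n%:R) * jint a b c (P + n%:R))); first by ring.
by rewrite h; ring.
Qed.

(** The limit of [jint_addn] along shifts n + 2: each Pochhammer symbol becomes a Gamma value by
    Euler's limit, and the shifted integral reduces to its Beta factor. *)
Lemma jint_Gamma a b c P : 0 < c -> 0 < complex.Re P ->
  0 < complex.Re (P + b - a) -> 0 < complex.Re (P + c%:C - a) ->
  0 < complex.Re (P + b) ->
  jint a b c P * (Gamma (P + c%:C - a) * Gamma (P + b)) =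
  Gamma c%:C * Gamma P * Gamma (P + b - a).
Proof.
move=> c0 P0 Q0 s0 t0; have c0C : 0 < complex.Re c%:C by [].
have C0 : 0 < complex.Re (c%:C + P) by rewrite cReD addr_gt0.
have hC : complex.Re (a + (c%:C - b)) < complex.Re (c%:C + P).
  by move: Q0; rewrite !(cReD, cReN)/=; lra.
set s := P + c%:C - a in s0 *; set t := P + b in t0 *; set Q := t - a in Q0 *.
have L : kcvg \oo (fun n => jint a b c P * (geuler s n * geuler t n))
    (jint a b c P * (Gamma s * Gamma t)).
  by apply: kcvgZl; apply: kcvgM; exact: Gamma_euler.
(* Taking q = P + 1 in [hbeta_Gamma] meets its bound on Re q and makes the total shift n + 2, the
   length of the products in [geuler]. *)
have P1 : 1 <= complex.Re (P + 1) by rewrite Re_D1 lerDr ltW.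
have hG := hbeta_Gamma c0C P1.
have hS : kcvg \oo (fun n => gauss1 a (c%:C - b) (c%:C + P + n.+2%:R)) 1.
  have h := (kcvg_shiftn _ 2 _).2 (gauss1_cvg1 C0 hC).
  by apply: (kcvg_eq h) => n; rewrite addn2.
have Rr : kcvg \oo (fun n => gpow c%:C n * hbeta c%:C (P + 1 + n.+1%:R) *
    gauss1 a (c%:C - b) (c%:C + P + n.+2%:R) * geuler P n * geuler Q n)
    (Gamma c%:C * 1 * Gamma P * Gamma Q).
  apply: kcvgM; last exact: Gamma_euler.
  apply: kcvgM; last exact: Gamma_euler.
  exact: kcvgM.
rewrite mulr1 in Rr; apply: (kcvg_unique L); apply: (kcvg_eq Rr) => n.
have key := jint_addn n.+2 c0 P0 Q0; rewrite -/s -/t -/Q in key.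
have hP := poch_Re_gt0 n.+2 P0; have hQ := poch_Re_gt0 n.+2 Q0.
have hs := poch_Re_gt0 n.+2 s0; have ht := poch_Re_gt0 n.+2 t0.
have -> : gpow c%:C n * hbeta c%:C (P + 1 + n.+1%:R) *
    gauss1 a (c%:C - b) (c%:C + P + n.+2%:R) =
    gpow c%:C n * jint a b c (P + n.+2%:R).
  rewrite /jint -mulrA (addrA c%:C).
  by have -> : P + 1 + n.+1%:R = P + n.+2%:R by rewrite -[n.+2%:R]natr1; ring.
have -> : jint a b c (P + n.+2%:R) = poch P n.+2 * poch Q n.+2 * jint a b c P /
    (poch s n.+2 * poch t n.+2).
  by rewrite key mulrC mulKf// mulf_neq0.
(* The powers of n + 1 cancel because s + t = c + P + Q. *)
have e : gpow s n * gpow t n = gpow c%:C n * gpow P n * gpow Q n.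
  have e : s + t = c%:C + P + Q by rewrite /Q /s /t; ring.
  by rewrite -!gpowD e.
rewrite /geuler; clear L Rr key.
move: hP hQ hs ht; move: (poch P _) (poch Q _) (poch s _) (poch t _) => p q v w.
move: ((n.+1)`!%:R) => F; move: e.
move: (gpow s n) (gpow t n) (gpow P n) (gpow Q n) (gpow c%:C n) (jint a b c P).
move=> gs gt gP gQ gc J e hP hQ hs ht.
transitivity (gs * gt * J * (F ^+ 2 / (v * w))); last by field; rewrite ht hs.
by rewrite e; field; rewrite hs ht hQ hP.
Qed.

End KernelSeries.

(** * From the line to the half-line *)

Section LineIntegral.
Context {R : realType}.
Local Notation mu := (@lebesgue_measure R).
Local Notation half_line := (`]0%R, +oo[%classic : set R).

(** Lebesgue measure is its own image under negation, so the claim is integration against a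
    pushforward. *)
Lemma reflection_integral (h : R -> \bar R) : mu.-integrable setT h ->
  mu.-integrable setT (fun x => h (- x)) /\
  (\int[mu]_x h (- x)%R = \int[mu]_x h x)%E.
Proof.
move=> ih; have mh := measurable_int mu ih.
pose N (x : measurableTypeR R) : measurableTypeR R := - (x : R).
pose hN (x : measurableTypeR R) := h (- (x : R)).
have mN : measurable_fun setT N by exact: (@oppr_measurable R setT).
have mhN : measurable_fun setT hN by exact: (measurableT_comp mh mN).
have hNN : hN \o N = h by apply/funext => x; rewrite /hN /N /= opprK.
have push (f : measurableTypeR R -> \bar R) :
    (\int[mu]_x f x = \int[pushforward mu N]_x f x)%E.
  by apply: eq_measure_integral => A mA _; exact/esym/lebesgue_measureN.
have ihN : mu.-integrable (N @^-1` setT) (hN \o N) by rewrite hNN preimage_setT.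
have h1 := integrable_pushforward mN mhN ihN measurableT.
have h2 := integral_pushforward mN mhN ihN measurableT.
rewrite hNN preimage_setT in h2; split; last by rewrite (push hN) h2.
move/integrableP : h1 => [m1 m2]; apply/integrableP; split => //.
by rewrite (push (fun x => `|hN x|%E)).
Qed.

Lemma line_integral (h : R -> \bar R) :
  mu.-integrable half_line h -> mu.-integrable half_line (fun x => h (- x)) ->
  mu.-integrable setT h /\
  (\int[mu]_x h x =
   \int[mu]_(x in half_line) h x + \int[mu]_(x in half_line) h (- x)%R)%E.
Proof.
move=> i1 i2; have mA := @measurable_0y R.
have i0 : mu.-integrable [set (0 : R)] h.
  apply/integrableP; split; first exact: measurable_fun_set1.
  by rewrite integral_set1 ltry.
have j1 := (@integrable_mkcond _ _ _ mu _ h mA).1 i1.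
have j0 := (@integrable_mkcond _ _ _ mu _ h (measurable_set1 0)).1 i0.
have [j2 e2] := reflection_integral ((@integrable_mkcond _ _ _ mu _ _ mA).1 i2).
have hE : h = (fun x => (h \_ half_line) x +
    (((fun x => h (- x)%R) \_ half_line) (- x)%R + (h \_ [set 0%R]) x))%E.
  have m1 (y : R) : (y \in half_line) = (0 < y).
    by apply/idP/idP; rewrite inE/= in_itv/= andbT.
  have m0 (y : R) : (y \in [set (0 : R)]) = (y == 0).
    by apply/idP/idP; rewrite inE => /eqP.
  apply/funext => x; rewrite /patch opprK !m1 m0 oppr_gt0.
  by have [x0|x0|x0] := ltgtP x 0; rewrite ?add0e ?adde0.
have j3 := integrableD measurableT j2 j0.
split; first by rewrite hE; exact: integrableD.
rewrite [in LHS]hE integralD//= integralD//=.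
by rewrite e2 -!integral_mkcond integral_set1 adde0.
Qed.

Lemma Cintegral_line (f : R -> R[i]) :
  Cintegrable half_line f -> Cintegrable half_line (fun x => f (- x)) ->
  Cintegrable setT f /\
  Cintegral setT f = Cintegral half_line f + Cintegral half_line (fun x => f (- x)).
Proof.
move=> [f1 f2] [g1 g2].
have [r1 r2] := line_integral f1 g1; have [s1 s2] := line_integral f2 g2.
have mA := @measurable_0y R.
split; first by split.
apply: complex_eqP; rewrite ?cReD ?cImD /Cintegral/= /Rintegral.
  by rewrite r2 fineD// integrable_fin_num.
by rewrite s2 fineD// integrable_fin_num.
Qed.

End LineIntegral.

(** * Jacobi functions against powers of cosh *)

Section JacobiKernel.
Context {R : realType}.
Implicit Types (alpha beta s x : R) (lam : R[i]).

Definition spa alpha beta lam : R[i] := ((rho alpha beta)%:C + 'i * lam) / 2.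
Definition spb alpha beta lam : R[i] := ((rho alpha beta)%:C - 'i * lam) / 2.
(** The exponent of 1 - tanh^2 in the Beta kernel attached to the weight of index [s];
    [spP s (- lam)] is the excess of the resulting series at 1. *)
Definition spP s lam : R[i] := (s%:C + 1 + 'i * lam) / 2.

(** The division by 2 undoes the factor 2 that [hker] carries from du = 2 tanh x / cosh^2 x dx. *)
Definition wker alpha beta s lam x : R[i] :=
  jker (spa alpha beta lam) (spb alpha beta lam) (alpha + 1) (spP s lam) x / 2.

Lemma jacobi_fun_pfaff alpha beta lam x : -1 < alpha ->
  jacobi_fun alpha beta lam x =
  cexp (- (2 * spa alpha beta lam) * (ln (cosh x))%:C) *
  gsum (spa alpha beta lam) ((alpha + 1)%:C - spb alpha beta lam) (alpha + 1)%:C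
    (tanh x ^+ 2).
Proof.
move=> a1; have c0 : 0 < complex.Re (alpha + 1)%:C by rewrite /= -ltrBlDr sub0r.
have s0 : - sinh x ^+ 2 <= 0 by rewrite oppr_le0 sqr_ge0.
have eL : ln (1 - - sinh x ^+ 2) = 2 * ln (cosh x).
  by rewrite opprK -cosh2E lnXn ?cosh_gt0// mulr_natl.
have eT : - sinh x ^+ 2 / (- sinh x ^+ 2 - 1) = tanh x ^+ 2.
  by rewrite -opprD [_ + 1]addrC -cosh2E invrN mulrNN -expr_div_n.
have eA : - spa alpha beta lam * (2 * ln (cosh x))%:C =
    - (2 * spa alpha beta lam) * (ln (cosh x))%:C.
  by rewrite rmorphM rmorph_nat; ring.
transitivity (pfaff (spa alpha beta lam) (spb alpha beta lam) (alpha + 1)%:C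
  (- sinh x ^+ 2)); first exact: (gauss2F1_pfaff _ _ c0 s0).
by rewrite /pfaff eL eT -eA.
Qed.

Lemma ln_sinh x : 0 < x -> ln (sinh x) = ln (tanh x) + ln (cosh x).
Proof.
move=> x0; rewrite -lnM ?posrE ?cosh_gt0 ?tanh_gt0//.
by rewrite /tanh divfK ?cosh_neq0.
Qed.

Lemma wkerE alpha beta s lam x : -1 < alpha -> 0 < x ->
  (cosh x `^ (- alpha - beta - s - 2))%:C * jacobi_fun alpha beta lam x *
    (Aweight alpha beta x)%:C = wker alpha beta s lam x.
Proof.
move=> a1 x0; have s0 := sinh_gt0 x0.
have eW : (Aweight alpha beta x)%:C =
    cexp ((2 * alpha + 1)%:C * (ln (tanh x) + ln (cosh x))%:C) *
    cexp ((2 * beta + 1)%:C * (ln (cosh x))%:C).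
  by rewrite -ln_sinh// -!powR_cexp ?cosh_gt0// -rmorphM.
rewrite (jacobi_fun_pfaff beta lam x a1) eW powR_cexp ?cosh_gt0//.
rewrite /wker /jker /hker /kpow.
set G := gsum _ _ _ _; set T := ln (tanh x); set C := ln (cosh x).
have e : (- alpha - beta - s - 2)%:C * C%:C +
    - (2 * spa alpha beta lam) * C%:C + ((2 * alpha + 1)%:C * (T + C)%:C +
    (2 * beta + 1)%:C * C%:C) = (2 * (alpha + 1)%:C - 1) * T%:C - 2 * spP s lam * C%:C.
  rewrite /spa /spP /rho !(rmorphD, rmorphN, rmorphM, rmorph1, rmorph_nat)/=.
  by field.
rewrite -e !cexpD; move: (cexp _) (cexp _) (cexp _) (cexp _) => u v w z.
by move: G => G; field.
Qed.

End JacobiKernel.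

Section JacobiKernelIntegral.
Context {R : realType}.
Local Notation mu := (@lebesgue_measure R).
Implicit Types (alpha beta s x : R) (lam : R[i]).

Lemma Re_iM (z : R[i]) : complex.Re ('i * z) = - complex.Im z.
Proof. by case: z => u v; rewrite cReM/= mul0r mul1r sub0r. Qed.

Lemma Re_half (z : R[i]) : complex.Re (z / 2) = complex.Re z / 2.
Proof.
have -> : (2 : R[i])^-1 = (2^-1)%:C by rewrite fmorphV rmorph_nat.
by rewrite cReM/= mulr0 subr0.
Qed.

Lemma spP_Re s lam : complex.Re (spP s lam) = (s + 1 - complex.Im lam) / 2.
Proof. by rewrite /spP Re_half !cReD Re_iM. Qed.

Lemma spP_Re_gt0 s lam : `|complex.Im lam| < s + 1 -> 0 < complex.Re (spP s lam).
Proof.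
by rewrite ltr_norml => /andP[_ h]; rewrite spP_Re divr_gt0// subr_gt0.
Qed.

Lemma wker_integral alpha beta s lam : -1 < alpha ->
  `|complex.Im lam| < s + 1 ->
  0 < alpha - beta + s + 2 -> 0 < alpha + beta + s + 2 ->
  Cintegrable `]0, +oo[ (wker alpha beta s lam) /\
  Cintegral `]0, +oo[ (wker alpha beta s lam) *
    (2 * (Gamma ((alpha - beta + s + 2) / 2)%:C *
          Gamma ((alpha + beta + s + 2) / 2)%:C)) =
  Gamma (alpha + 1)%:C * Gamma (spP s lam) * Gamma (spP s (- lam)).
Proof.
move=> a1 hl hs ht; set a := spa alpha beta lam; set b := spb alpha beta lam.
have c0 : 0 < alpha + 1 by rewrite -ltrBlDr sub0r.
have P0 := spP_Re_gt0 hl.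
have eQ : spP s lam + b - a = spP s (- lam).
  by rewrite /a /b /spa /spb /spP; field.
have es : spP s lam + (alpha + 1)%:C - a = ((alpha - beta + s + 2) / 2)%:C.
  rewrite /a /spa /spP /rho; rewrite [RHS]rmorphM fmorphV.
  by rewrite !(rmorphD, rmorphN, rmorph1, rmorph_nat)/=; field.
have et : spP s lam + b = ((alpha + beta + s + 2) / 2)%:C.
  rewrite /b /spb /spP /rho; rewrite [RHS]rmorphM fmorphV.
  by rewrite !(rmorphD, rmorphN, rmorph1, rmorph_nat)/=; field.
have Q0 : 0 < complex.Re (spP s lam + b - a).
  by rewrite eQ spP_Re_gt0// cImN normrN.
have s0 : 0 < complex.Re (spP s lam + (alpha + 1)%:C - a).
  by rewrite es/= divr_gt0.
have t0 : 0 < complex.Re (spP s lam + b) by rewrite et/= divr_gt0.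
have [I1 I2] := jker_integral c0 P0 Q0.
have -> : wker alpha beta s lam =
    (fun x => 2^-1 * jker a b (alpha + 1) (spP s lam) x).
  by apply/funext => x; rewrite mulrC.
split; first by apply: CintegrableZ I1; exact: measurable_0y.
rewrite CintegralZ; [|exact: measurable_0y|exact: I1].
have := jint_Gamma c0 P0 Q0 s0 t0; rewrite eQ es et => <-.
rewrite I2 /jint; move: (_ * gauss1 _ _ _) (Gamma _) (Gamma _) => X Y Z.
by field.
Qed.

Lemma gsum_bounded (a b c : R[i]) : 0 < complex.Re c ->
  exists M, forall y : R, `|y| <= 2^-1 -> cmod (gsum a b c y) <= M.
Proof.
move=> c0; have q1 : 0 <= (2^-1 : R) < 1 by lra.
have [M hM] := gcoef_bdsum a b c0 q1; exists M => y hy.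
have y1 : `|y| < 1 by lra.
apply: (ksum_cmod_le _ (gsumP a b c0 y1)) => n.
apply: le_trans (hM n); apply: ler_sum => k _.
by rewrite cmodM cmodX cmodR ler_wpM2l ?cmod_ge0// lerXn2r// nnegrE.
Qed.

(** Needed for the sinh(2x) part of the kernel, which is a shifted [wker] over tanh. Where tanh >=
    1/2 the division costs a factor 2. Elsewhere the 2F1 is bounded, and the division lowers the
    first Beta exponent from alpha + 1 to alpha + 1/2, still positive. *)
Lemma wker_tanh_integrable alpha beta s lam : - 2^-1 < alpha ->
  `|complex.Im lam| < s + 1 ->
  0 < alpha - beta + s + 2 -> 0 < alpha + beta + s + 2 ->
  Cintegrable `]0, +oo[
    (fun x => wker alpha beta s lam x * ((tanh x)^-1)%:C).
Proof.
move=> a1 hl hs ht; have a1' : -1 < alpha by lra.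
have c0 : 0 < complex.Re (alpha + 1)%:C by rewrite /=; lra.
have [wI _] := wker_integral a1' hl hs ht.
have [m1 m2] := Cintegrable_measurable wI.
have [M hM] := gsum_bounded (spa alpha beta lam)
  ((alpha + 1)%:C - spb alpha beta lam) c0.
have P0 := spP_Re_gt0 hl; set P := spP s lam in P0 *.
have mt : measurable_fun (`]0, +oo[%classic : set R) (fun x => (tanh x)^-1).
  apply: continuous_measurable_0y => x x0.
  have t0 : tanh x != 0 by rewrite gt_eqF// tanh_gt0.
  exact: (is_derive_continuous (is_deriveV t0 (is_derive_tanh x))).
pose g x := 2 * (`|complex.Re (wker alpha beta s lam x)| +
    `|complex.Im (wker alpha beta s lam x)|) +
  `|M| * rker (alpha + 2^-1) (complex.Re P) x.
have gI : mu.-integrable `]0, +oo[ (EFin \o g).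
  have [w1 w2] := wI.
  have i1 := @integrableD _ _ _ mu _ measurable_0y _ _
    (@integrable_norm _ _ _ mu _ _ w1) (@integrable_norm _ _ _ mu _ _ w2).
  have a0 : 0 < alpha + 2^-1 by lra.
  have i2 := rker_integrable a0 P0.
  have h := @integrableD _ _ _ mu _ measurable_0y _ _
    (@integrableZl _ _ _ mu _ measurable_0y 2 _ i1)
    (@integrableZl _ _ _ mu _ measurable_0y `|M| _ i2).
  exact: h.
apply: (Cintegrable_le measurable_0y _ _ gI).
  split.
    have -> : (fun x => complex.Re (wker alpha beta s lam x * ((tanh x)^-1)%:C)) =
        (fun x => complex.Re (wker alpha beta s lam x) * (tanh x)^-1).
      by apply/funext => x; rewrite cReM [complex.Im _%:C]/= mulr0 subr0.
    exact: measurable_funM.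
  have -> : (fun x => complex.Im (wker alpha beta s lam x * ((tanh x)^-1)%:C)) =
      (fun x => complex.Im (wker alpha beta s lam x) * (tanh x)^-1).
    by apply/funext => x; rewrite cImM [complex.Im _%:C]/= mulr0 add0r.
  exact: measurable_funM.
move=> x /=; rewrite in_itv/= andbT => x0.
have t0 := tanh_gt0 x0.
rewrite cmodM cmodR ger0_norm ?invr_ge0 ?(ltW t0)// /g.
have r0 : 0 <= `|M| * rker (alpha + 2^-1) (complex.Re P) x.
  by rewrite mulr_ge0// rker_ge0.
have [h|h] := leP 2^-1 (tanh x).
  rewrite [X in X <= _]mulrC; apply: (@le_trans _ _ (2 * cmod (wker alpha beta s lam x))).
    by rewrite ler_wpM2r ?cmod_ge0// invf_ple ?posrE.
  by apply: ler_wpDr => //; rewrite ler_pM2l// cmod_le_ReIm.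
apply: (@le_trans _ _ (`|M| * rker (alpha + 2^-1) (complex.Re P) x)); last first.
  by rewrite lerDr mulr_ge0// addr_ge0.
have gM : cmod (gsum (spa alpha beta lam) ((alpha + 1)%:C - spb alpha beta lam)
    (alpha + 1)%:C (tanh x ^+ 2)) <= `|M|.
  apply: le_trans (ler_norm M); apply: hM.
  rewrite ger0_norm ?sqr_ge0// expr2.
  have := tanh_lt1 x; nra.
have er : rker (alpha + 1) (complex.Re P) x * (tanh x)^-1 =
    rker (alpha + 2^-1) (complex.Re P) x.
  rewrite /rker -mulrA -[(tanh x)^-1]lnK ?posrE ?invr_gt0// -expRD lnV ?posrE//.
  by congr (_ * expR _); field.
rewrite /wker cmodM /jker cmodM cmod_hker -er.
have -> : cmod (2^-1 : R[i]) = 2^-1 by rewrite cmodV cmod_nat.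
rewrite [leLHS](_ : _ = (rker (alpha + 1) (complex.Re P) x * (tanh x)^-1) * (2^-1 *
   cmod (gsum (spa alpha beta lam) ((alpha + 1)%:C - spb alpha beta lam)
    (alpha + 1)%:C (tanh x ^+ 2)))); last by ring.
rewrite mulrC ler_wpM2r//; first by rewrite er rker_ge0.
apply: le_trans gM; rewrite ler_piMl ?cmod_ge0//; lra.
Qed.

End JacobiKernelIntegral.

(** * Terminating hypergeometric sums *)

Section TerminatingSums.
Context {K : numFieldType}.
Implicit Types (a b c e z : K) (n j k : nat).

Lemma pFq_terminating n (l den : seq K) z :
  pFq (- n%:R :: l) den z =
  \sum_(0 <= k < n.+1) pFq_term (- n%:R :: l) den z k.
Proof.
rewrite /pFq -/(klim _); apply: ksum_lim; apply: ksum_finite => k nk.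
by rewrite /pFq_term big_cons poch_Nnat bin_small// mulr0 !mul0r.
Qed.

Lemma bin_trinomial n i j : (i + j <= n)%N ->
  ('C(n, j + i) * 'C(j + i, j) = 'C(n, j) * 'C(n - j, i))%N.
Proof.
rewrite addnC => ijn; have jn := leq_trans (leq_addr i j) ijn.
have h1 := bin_fact ijn; have h2 := bin_fact (leq_addr i j).
have h3 := bin_fact jn.
have h4 : (i <= n - j)%N by rewrite leq_subRL.
have {h4} := bin_fact h4; rewrite -subnDA => h4; rewrite addKn in h2.
apply/eqP; rewrite -(eqn_pmul2r (_ : 0 < (j`! * i`! * (n - (j + i))`!)))%N; last first.
  by rewrite !muln_gt0 !fact_gt0.
apply/eqP; rewrite -h4 in h3.
transitivity n`!; last by rewrite -h3; ring.
by rewrite -h1 -h2; ring.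
Qed.

(** Terms with k < j vanish; for the others C(n, k) C(k, j) = C(n, j) C(n - j, k - j), which leaves
    [vandermonde] with b and c raised by j. *)
Lemma jacobi_coef_inv n b c j : (j <= n)%N ->
  \sum_(0 <= k < n.+1) (-1) ^+ k * 'C(n, k)%:R * poch b k * poch (c + k%:R) (n - k) *
    'C(k, j)%:R =
  (-1) ^+ j * 'C(n, j)%:R * poch b j * poch (c - b) (n - j).
Proof.
move=> jn; rewrite (big_cat_nat _ (n := j))//=; last exact: leqW.
rewrite big_nat big1 ?add0r => [|k /andP[_ kj]]; last by rewrite (bin_small kj) mulr0.
rewrite -{1}[j]add0n big_addn subSn//.
have := vandermonde (n - j) (b + j%:R) (c + j%:R).
have -> : c + j%:R - (b + j%:R) = c - b by ring.
move=> <-; rewrite mulr_sumr; rewrite big_nat [RHS]big_nat; apply: eq_bigr => i.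
rewrite ltnS => /andP[_ ij].
have ijn : (i + j <= n)%N by rewrite addnC -leq_subRL.
have h : 'C(n, j + i)%:R * 'C(j + i, j)%:R = 'C(n, j)%:R * 'C(n - j, i)%:R :> K.
  by rewrite -!natrM bin_trinomial.
rewrite [(i + j)%N]addnC exprD pochD subnDA natrD addrA.
move: h; move: (poch _ _) (poch _ _) (poch _ _) => x y w.
move: 'C(n, j + i)%:R 'C(j + i, j)%:R 'C(n, j)%:R 'C(n - j, i)%:R => p q r s h.
transitivity ((-1) ^+ j * (-1) ^+ i * x * y * w * (p * q)); first by ring.
by rewrite h; ring.
Qed.

End TerminatingSums.

(** * Jacobi polynomials expanded at the opposite end point *)

Section JacobiPolynomial.
Context {R : realType}.
Implicit Types (a b u : R) (n : nat).

(* Chu-Vandermonde turns the expansion of [P_n] at [u = 0] into that at [u = 1]. *)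
Lemma jacobi_poly_reflection n a b u : -1 < a ->
  jacobi_poly n a b (1 - 2 * u) = (-1) ^+ n / n`!%:R *
  \sum_(0 <= j < n.+1) (-1) ^+ j * 'C(n, j)%:R * poch (a + b + n%:R + 1) j *
    poch (b + 1 + j%:R) (n - j) * (1 - u) ^+ j.
Proof.
move=> a1; have a0 : 0 < a + 1 by rewrite -ltrBlDr sub0r.
rewrite /jacobi_poly pFq_terminating; set N := a + b + n%:R + 1.
have -> : (1 - (1 - 2 * u)) / 2 = u by field.
have e1 : poch (a + 1) n *
    \sum_(0 <= k < n.+1) pFq_term [:: - n%:R; N] [:: a + 1] u k =
  \sum_(0 <= k < n.+1) \sum_(0 <= j < n.+1) (-1) ^+ k * 'C(n, k)%:R * poch N k *
    poch (a + 1 + k%:R) (n - k) * 'C(k, j)%:R * ((-1) ^+ j * (1 - u) ^+ j).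
  rewrite mulr_sumr big_nat [RHS]big_nat; apply: eq_bigr => k /andP[_]; rewrite ltnS => kn.
  have eu : u ^+ k = \sum_(0 <= j < n.+1) 'C(k, j)%:R * ((-1) ^+ j * (1 - u) ^+ j).
    rewrite (big_cat_nat _ (n := k.+1))//= [X in _ + X]big_nat.
    rewrite [X in _ + X]big1 ?addr0; last first.
      by move=> j /andP[kj _]; rewrite (bin_small kj) mul0r.
    rewrite -[in LHS](subKr 1 u) exprBn big_mkord; apply: eq_bigr => j _.
    by rewrite expr1n mulr1 mulr_natl.
  transitivity ((-1) ^+ k * 'C(n, k)%:R * poch N k * poch (a + 1 + k%:R) (n - k) * u ^+ k).
    rewrite /pFq_term !big_cons !big_nil poch_Nnat (poch_split _ kn).
    have := poch_gt0 k a0; rewrite lt0r => /andP[h _].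
    have := fact_neq0 R k; move: h.
    move: (k`!%:R) (poch _ _) (poch _ _) (poch _ _) => f p q r p0 f0.
    by field; rewrite p0 f0.
  by rewrite eu mulr_sumr; apply: eq_bigr => j _; ring.
rewrite mulrAC e1 exchange_big/= [RHS]mulrAC; congr (_ / _).
rewrite mulr_sumr big_nat [RHS]big_nat; apply: eq_bigr => j /andP[_]; rewrite ltnS => jn.
rewrite -mulr_suml jacobi_coef_inv//.
have -> : a + 1 - N = 1 - (b + 1 + j%:R) - (n - j)%:R by rewrite natrB// /N; ring.
rewrite poch_rev; have -> : (-1) ^+ (n - j) = (-1) ^+ n * (-1) ^+ j :> R.
  by rewrite -[in RHS](subnK jn) exprD -mulrA -expr2 sqrr_sign mulr1.
have := sqrr_sign R j; move: ((-1) ^+ j) ((-1) ^+ n) => s t.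
move: (poch _ _) (poch _ _) ((1 - u) ^+ j) ('C(n, j)%:R) => x y z w h.
by transitivity (s ^+ 2 * (s * w * x * (t * y) * z)); [ring|rewrite h; ring].
Qed.

End JacobiPolynomial.

(** * Wilson polynomials as sums of Gamma quotients *)

Section WilsonSum.
Context {R : realType}.
Implicit Types (s : R) (lam a b c d e t : R[i]) (n k : nat).

(** Only t^2 enters, so the square root chosen in [wilson] may be traded for i lam / 2. *)
Lemma poch_even_part a t k :
  poch (a + t) k * poch (a - t) k = \prod_(i < k) ((a + i%:R) ^+ 2 - t ^+ 2).
Proof. by rewrite /poch -big_split/=; apply: eq_bigr => i _; ring. Qed.

Lemma i_sqr : ('i : R[i]) ^+ 2 = -1.
Proof. by rewrite expr2; apply: complex_eqP; rewrite ?cReM ?cImM/=; ring. Qed.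

(** The prefactors absorb the denominators of the 4F3 through (x)_n / (x)_k = (x + k)_(n - k). *)
Lemma wilson_sum n s lam b c d (a := ((s + 1) / 2)%:C) :
  0 < complex.Re (a + b) -> 0 < complex.Re (a + c) -> 0 < complex.Re (a + d) ->
  wilson n (- (lam ^+ 2 / 4)) a b c d =
  \sum_(0 <= k < n.+1) (-1) ^+ k * 'C(n, k)%:R *
    poch (a + b + c + d + n%:R - 1) k *
    (poch (spP s lam) k * poch (spP s (- lam)) k) *
    (poch (a + b + k%:R) (n - k) * poch (a + c + k%:R) (n - k) *
     poch (a + d + k%:R) (n - k)).
Proof.
move=> b0 c0 d0; rewrite /wilson pFq_terminating mulr_sumr.
rewrite big_nat [RHS]big_nat; apply: eq_bigr => k /andP[_]; rewrite ltnS => kn.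
set t := sqrtC _; set N := a + b + c + d + n%:R - 1.
have eP : poch (spP s lam) k * poch (spP s (- lam)) k = poch (a + t) k * poch (a - t) k.
  have ea : a = (s%:C + 1) / 2.
    by rewrite /a rmorphM fmorphV rmorphD rmorph1 rmorph_nat.
  have e1 : spP s lam = a + 'i * lam / 2 by rewrite ea /spP; field.
  have e2 : spP s (- lam) = a - 'i * lam / 2 by rewrite ea /spP; field.
  rewrite e1 e2 !poch_even_part sqrtCK !exprMn i_sqr.
  by have -> : (-1 * lam ^+ 2 * 2^-1 ^+ 2) = - (lam ^+ 2 / 4) by field.
rewrite eP /pFq_term !big_cons !big_nil poch_Nnat.
rewrite (poch_split (a + b) kn) (poch_split (a + c) kn) (poch_split (a + d) kn).
have := fact_neq0 R[i] k; have := poch_Re_gt0 k d0.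
have := poch_Re_gt0 k c0; have := poch_Re_gt0 k b0; rewrite expr1n.
move: (poch (a + b) k) (poch (a + c) k) (poch (a + d) k) => x y z.
move: (poch (a + b + k%:R) (n - k)) (poch (a + c + k%:R) (n - k)) => u v.
move: (poch (a + d + k%:R) (n - k)) (poch N k) (poch (a + t) k) => w M p.
move: (poch (a - t) k) (k`!%:R) ('C(n, k)%:R) ((-1) ^+ k) => q f C S x0 y0 z0 f0.
by field; rewrite x0 y0 z0 f0.
Qed.

Lemma spP_addn s lam j : spP (s + 2 * j%:R) lam = spP s lam + j%:R.
Proof. by rewrite /spP rmorphD rmorphM !rmorph_nat; field. Qed.

(** All terms are brought to the common denominator Gamma(y + n) Gamma(z + n); the missing factors
    are the rising factorials of length n - j. The parameters stay abstract so that both parities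
    are instances. *)
Lemma gamma_wilson_sum n s lam (y z : R) (N e A : R[i]) (G : nat -> R[i]) :
  0 < y -> 0 < z -> `|complex.Im lam| < s + 1 ->
  (forall j, G j * (Gamma (y + j%:R)%:C * Gamma (z + j%:R)%:C) =
     A * Gamma (spP s lam + j%:R) * Gamma (spP s (- lam) + j%:R)) ->
  \sum_(0 <= j < n.+1) (-1) ^+ j * 'C(n, j)%:R * poch N j *
    poch (e + j%:R) (n - j) * G j =
  A * Gamma (spP s lam) * Gamma (spP s (- lam)) /
    (Gamma (z + n%:R)%:C * Gamma (y + n%:R)%:C) *
  \sum_(0 <= k < n.+1) (-1) ^+ k * 'C(n, k)%:R * poch N k *
    (poch (spP s lam) k * poch (spP s (- lam)) k) *
    (poch (e + k%:R) (n - k) * poch (z%:C + k%:R) (n - k) *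
     poch (y%:C + k%:R) (n - k)).
Proof.
move=> y0 z0 hl hG; rewrite mulr_sumr big_nat [RHS]big_nat.
apply: eq_bigr => j /andP[_]; rewrite ltnS => jn.
have P0 := spP_Re_gt0 hl.
have Q0 : 0 < complex.Re (spP s (- lam)) by rewrite spP_Re_gt0// cImN normrN.
have := hG j; rewrite (Gamma_addn _ P0) (Gamma_addn _ Q0).
have yn : 0 < y + n%:R by rewrite ltr_wpDr.
have zn : 0 < z + n%:R by rewrite ltr_wpDr.
have gy := Gamma_real_neq0 yn; have gz := Gamma_real_neq0 zn.
have ey : Gamma (y + n%:R)%:C =
    Gamma (y + j%:R)%:C * poch (y%:C + j%:R) (n - j).
  have yj : 0 < complex.Re (y%:C + j%:R) by rewrite cReD Re_nat ltr_wpDr.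
  by rewrite !rmorphD !rmorph_nat -(Gamma_addn _ yj) -addrA -natrD subnKC.
have ez : Gamma (z + n%:R)%:C =
    Gamma (z + j%:R)%:C * poch (z%:C + j%:R) (n - j).
  have zj : 0 < complex.Re (z%:C + j%:R) by rewrite cReD Re_nat ltr_wpDr.
  by rewrite !rmorphD !rmorph_nat -(Gamma_addn _ zj) -addrA -natrD subnKC.
move: gy gz; rewrite ey ez; move: (Gamma _) (Gamma _) (Gamma _) (Gamma _).
move=> g1 g2 g3 g4.
move: (poch (y%:C + j%:R) (n - j)) (poch (z%:C + j%:R) (n - j)) => u v.
move: (poch (spP s lam) j) (poch (spP s (- lam)) j) (poch (e + j%:R) (n - j)) => p q w.
move: (poch N j) ('C(n, j)%:R) ((-1) ^+ j) => M C S.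
rewrite !mulf_eq0 !negb_or => /andP[g40 u0] /andP[g30 v0] h.
have -> : G j = A * (g2 * p) * (g1 * q) / (g4 * g3) by rewrite -h mulfK// mulf_neq0.
by field; rewrite g40 g30 u0 v0.
Qed.

End WilsonSum.

(** * The functions H and the Opdam-Cherednik kernel in terms of [wker] *)

Section OpdamCherednik.
Context {R : realType}.
Implicit Types (alpha beta delta s x N e : R) (lam : R[i]) (n j : nat).

(** The coefficient of cosh^(-2j) in P_n^(a,b)(1 - 2 tanh^2), with N = a + b + n + 1 and e = b +
    1. *)
Definition hcoef n N e j : R := (-1) ^+ n / n`!%:R *
  ((-1) ^+ j * 'C(n, j)%:R * poch N j * poch (e + j%:R) (n - j)).

Definition coshw alpha beta s x : R := cosh x `^ (- alpha - beta - s - 2).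

Lemma coshw_addn alpha beta s j x :
  coshw alpha beta s x * (1 - tanh x ^+ 2) ^+ j = coshw alpha beta (s + 2 * j%:R) x.
Proof.
have c0 := cosh_neq0 x; have cp := cosh_gt0 x.
rewrite onem_tanh2 /coshw exprVn -exprM -powR_mulrn ?(ltW cp)// -powRN.
by rewrite -powRD ?c0 ?implybT// natrM; congr (_ `^ _); ring.
Qed.

Lemma Hfun_double alpha beta delta n x : -1 < alpha ->
  Hfun alpha beta delta n.*2 x =
  \sum_(0 <= j < n.+1) hcoef n (alpha + delta + n%:R + 1) (delta + 1) j *
    coshw alpha beta (delta + 2 * j%:R) x.
Proof.
move=> a1; rewrite /Hfun odd_double doubleK jacobi_poly_reflection//.
rewrite mulrA mulr_sumr; apply: eq_bigr => j _.
rewrite -coshw_addn /hcoef /coshw; ring.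
Qed.

Lemma Hfun_doubleS alpha beta delta n x : -1 < alpha ->
  Hfun alpha beta delta n.*2.+1 x =
  (\sum_(0 <= j < n.+1) hcoef n (alpha + delta + n%:R + 1) delta j *
    coshw alpha beta (delta + 2 * j%:R) x) * tanh x.
Proof.
move=> a1; have a1' : -1 < alpha + 1 by lra.
rewrite /Hfun /= odd_double [uphalf _]uphalf_double jacobi_poly_reflection//.
(* The shifts of the two Jacobi parameters cancel in their sum, so [N] is the same as in the even
   case and only [e] changes. *)
have -> : alpha + 1 + (delta - 1) + n%:R + 1 = alpha + delta + n%:R + 1 by ring.
rewrite (subrK 1 delta); congr (_ * _).
rewrite mulrA mulr_sumr; apply: eq_bigr => j _.
rewrite -coshw_addn /hcoef /coshw; ring.
Qed.

Lemma jacobi_funN alpha beta lam x :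
  jacobi_fun alpha beta lam (- x) = jacobi_fun alpha beta lam x.
Proof. by rewrite /jacobi_fun sinhN sqrrN. Qed.

Lemma sinh2x x : sinh (2 * x) = 2 * sinh x * cosh x.
Proof.
rewrite /sinh /cosh; have -> : 2 * x = x + x by ring.
by rewrite opprD !expRD; field.
Qed.

(** Raising alpha and beta by one multiplies the weight by sinh^2 cosh^2 and lowers the power of
    cosh by two, a net factor sinh^2. *)
Lemma wker_shiftE alpha beta s lam x : -1 < alpha -> 0 < x ->
  (coshw alpha beta s x)%:C * jacobi_fun (alpha + 1) (beta + 1) lam x *
    (Aweight alpha beta x)%:C * (sinh x ^+ 2)%:C =
  wker (alpha + 1) (beta + 1) s lam x.
Proof.
move=> a1 x0; have a1' : -1 < alpha + 1 by lra.
rewrite -wkerE//; have c0 := cosh_neq0 x; have s0 := sinh_gt0 x0.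
have sn := lt0r_neq0 s0.
have e1 : coshw alpha beta s x =
    cosh x `^ (- (alpha + 1) - (beta + 1) - s - 2) * cosh x ^+ 2.
  rewrite -powR_mulrn ?(ltW (cosh_gt0 x))// -powRD ?c0 ?implybT//.
  by congr (_ `^ _); ring.
have e2 : Aweight (alpha + 1) (beta + 1) x =
    Aweight alpha beta x * sinh x ^+ 2 * cosh x ^+ 2.
  rewrite /Aweight; have -> : 2 * (alpha + 1) + 1 = 2 * alpha + 1 + 2%:R by ring.
  have -> : 2 * (beta + 1) + 1 = 2 * beta + 1 + 2%:R by ring.
  rewrite powRD ?sn ?implybT// (powRD (x := cosh x)) ?c0 ?implybT//.
  by rewrite !powR_mulrn ?(ltW s0) ?(ltW (cosh_gt0 x))//; ring.
rewrite e1 e2 !rmorphM; move: (jacobi_fun _ _ _ _) (cosh x `^ _) => J w.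
by ring.
Qed.

Definition ockap alpha beta lam : R[i] :=
  ((rho alpha beta)%:C + 'i * lam) / (4 * (alpha + 1))%:C.

(** As sinh(2x) = 2 sinh^2 x / tanh x, the second part of the kernel is the shifted [wker] divided
    by tanh. *)
Lemma opdam_termE alpha beta s lam x : -1 < alpha -> 0 < x ->
  (coshw alpha beta s x)%:C * opdam_fun alpha beta lam x * (Aweight alpha beta x)%:C =
  wker alpha beta s lam x +
  2 * ockap alpha beta lam * (wker (alpha + 1) (beta + 1) s lam x * ((tanh x)^-1)%:C).
Proof.
move=> a1 x0; rewrite -wkerE// -wker_shiftE// /opdam_fun -/(ockap alpha beta lam).
have s0 : (sinh x)%:C != 0 by rewrite (inj_eq (@complexI R)) gt_eqF// sinh_gt0.
have c0 : (cosh x)%:C != 0 by rewrite (inj_eq (@complexI R)) cosh_neq0.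
have -> : ((tanh x)^-1)%:C = (cosh x)%:C / (sinh x)%:C.
  by rewrite -fmorphV -rmorphM /tanh invf_div.
have -> : (sinh (2 * x))%:C = 2 * (sinh x)%:C * (cosh x)%:C.
  by rewrite sinh2x !rmorphM rmorph_nat.
have -> : (sinh x ^+ 2)%:C = (sinh x)%:C ^+ 2 by rewrite rmorphXn.
rewrite -/(coshw alpha beta s x).
move: s0 c0; move: (sinh x)%:C (cosh x)%:C => S C.
move: (jacobi_fun _ _ _ _) (jacobi_fun _ _ _ _) (coshw _ _ _ _)%:C => J J' w.
move: (Aweight _ _ _)%:C (ockap _ _ _) => A k S0 C0.
by field; rewrite S0.
Qed.

Lemma opdam_termNE alpha beta s lam x : -1 < alpha -> 0 < x ->
  (coshw alpha beta s x)%:C * opdam_fun alpha beta lam (- x) *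
    (Aweight alpha beta x)%:C =
  wker alpha beta s lam x -
  2 * ockap alpha beta lam * (wker (alpha + 1) (beta + 1) s lam x * ((tanh x)^-1)%:C).
Proof.
move=> a1 x0; have h := opdam_termE beta s lam a1 x0.
(* Only the sinh(2x) term changes sign, so the values at x and - x add up to twice the Jacobi
   function. *)
have e : opdam_fun alpha beta lam (- x) =
    2 * jacobi_fun alpha beta lam x - opdam_fun alpha beta lam x.
  rewrite /opdam_fun !jacobi_funN mulrN sinhN rmorphN.
  by move: (jacobi_fun _ _ _ _) (jacobi_fun _ _ _ _) => J J'; ring.
rewrite e mulrBr mulrBl h -wkerE// -/(coshw alpha beta s x).
move: (wker _ _ _ _ _ * _) (jacobi_fun _ _ _ _) (ockap _ _ _) => u J k.
by ring.
Qed.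

End OpdamCherednik.

(** * Reduction of the transform to half-line integrals *)

Section OpdamCherednikIntegral.
Context {R : realType}.
Local Notation mu := (@lebesgue_measure R).
Local Notation half_line := (`]0%R, +oo[%classic : set R).
Implicit Types (alpha beta delta s x : R) (lam : R[i]) (n j : nat).

Lemma tanh_mul_integrable (f : R -> R[i]) : Cintegrable half_line f ->
  Cintegrable half_line (fun x => f x * (tanh x)%:C).
Proof.
move=> fI; have [f1 f2] := fI; have [m1 m2] := Cintegrable_measurable fI.
have mt : measurable_fun half_line (@tanh R).
  apply: continuous_measurable_0y => x x0.
  exact: (is_derive_continuous (is_derive_tanh x)).
have gI := @integrableD _ _ _ mu _ measurable_0y _ _
  (@integrable_norm _ _ _ mu _ _ f1) (@integrable_norm _ _ _ mu _ _ f2).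
apply: (Cintegrable_le measurable_0y _ _
  (gI : mu.-integrable half_line
    (EFin \o (fun x => `|complex.Re (f x)| + `|complex.Im (f x)|)))).
  split.
    have -> : (fun x => complex.Re (f x * (tanh x)%:C)) =
        (fun x => complex.Re (f x) * tanh x).
      by apply/funext => x; rewrite cReM [complex.Im _%:C]/= mulr0 subr0.
    exact: measurable_funM.
  have -> : (fun x => complex.Im (f x * (tanh x)%:C)) =
      (fun x => complex.Im (f x) * tanh x).
    by apply/funext => x; rewrite cImM [complex.Im _%:C]/= mulr0 add0r.
  exact: measurable_funM.
move=> x /=; rewrite in_itv/= andbT => x0.
apply: le_trans (cmod_le_ReIm (f x)); rewrite cmodM cmodR.
rewrite ler_piMr ?cmod_ge0// ger0_norm ?(ltW (tanh_gt0 x0))//.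
by rewrite (ltW (tanh_lt1 x)).
Qed.

Lemma coshwN alpha beta s x : coshw alpha beta s (- x) = coshw alpha beta s x.
Proof. by rewrite /coshw coshN. Qed.

(** The odd part cancels between the two half-lines, but its integrability is what makes the
    integral over the line absolutely convergent. *)
Lemma Cintegral_line_parts (f E O : R -> R[i]) :
  (forall x, 0 < x -> f x = E x - O x) ->
  (forall x, 0 < x -> f (- x) = E x + O x) ->
  Cintegrable half_line E -> Cintegrable half_line O ->
  Cintegrable setT f /\ Cintegral setT f = 2 * Cintegral half_line E.
Proof.
move=> f1 f2 EI OI; have mA := @measurable_0y R.
have ONI := CintegrableZ mA (-1) OI.
have mem x : x \in half_line -> 0 < x by rewrite inE/= in_itv/= andbT.
have g1 : {in half_line, (fun x => E x + -1 * O x) =1 f}.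
  by move=> x /mem x0; rewrite f1// mulN1r.
have g2 : {in half_line, (fun x => E x + O x) =1 (fun x => f (- x))}.
  by move=> x /mem x0; rewrite f2.
have i1 := Cintegrable_eq mA g1 (CintegrableD mA EI ONI).
have i2 := Cintegrable_eq mA g2 (CintegrableD mA EI OI).
have [h1 h2] := Cintegral_line i1 i2; split=> //.
rewrite h2 -(Cintegral_eq g1) -(Cintegral_eq g2) !CintegralD// CintegralZ//.
by rewrite addrACA mulN1r addNr addr0 mulr_natl mulr2n.
Qed.

Lemma Cintegral_lincomb n (c : nat -> R[i]) (F : nat -> R -> R[i]) :
  (forall j, Cintegrable half_line (F j)) ->
  Cintegrable half_line (fun x => \sum_(0 <= j < n.+1) c j * F j x) /\
  Cintegral half_line (fun x => \sum_(0 <= j < n.+1) c j * F j x) =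
  \sum_(0 <= j < n.+1) c j * Cintegral half_line (F j).
Proof.
move=> FI; have mA := @measurable_0y R.
have hI j : Cintegrable half_line (fun x => c j * F j x).
  exact: CintegrableZ.
split; first exact: Cintegrable_sum.
by rewrite Cintegral_sum//; apply: eq_bigr => j _; rewrite CintegralZ.
Qed.

Section HalfLineReduction.
Variables (alpha beta delta : R) (lam : R[i]) (n : nat).
Hypotheses (hab : beta <= alpha) (hb : - 2^-1 <= beta) (ha : - 2^-1 < alpha).
Hypotheses (hd : 0 < delta) (hlam : `|complex.Im lam| < delta + 1).

Local Notation kap := (ockap alpha beta lam).
Local Notation W j := (wker alpha beta (delta + 2 * j%:R) lam).
Local Notation W' j := (wker (alpha + 1) (beta + 1) (delta + 2 * j%:R) lam).
Let a1 : -1 < alpha. Proof. by have := ha; lra. Qed.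
Let dj j : delta <= delta + 2 * j%:R. Proof. by rewrite lerDl mulr_ge0. Qed.

Let WI j : Cintegrable half_line (W j) /\
  Cintegral half_line (W j) *
    (2 * (Gamma ((alpha - beta + (delta + 2 * j%:R) + 2) / 2)%:C *
          Gamma ((alpha + beta + (delta + 2 * j%:R) + 2) / 2)%:C)) =
  Gamma (alpha + 1)%:C * Gamma (spP (delta + 2 * j%:R) lam) *
    Gamma (spP (delta + 2 * j%:R) (- lam)).
Proof.
by apply: wker_integral => //; have := dj j; move: hab hb ha hd hlam; lra.
Qed.

Let W'I j : Cintegrable half_line (W' j) /\
  Cintegral half_line (W' j) *
    (2 * (Gamma ((alpha + 1 - (beta + 1) + (delta + 2 * j%:R) + 2) / 2)%:C *
          Gamma ((alpha + 1 + (beta + 1) + (delta + 2 * j%:R) + 2) / 2)%:C)) =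
  Gamma (alpha + 1 + 1)%:C * Gamma (spP (delta + 2 * j%:R) lam) *
    Gamma (spP (delta + 2 * j%:R) (- lam)).
Proof.
by apply: wker_integral => //; have := dj j; move: hab hb ha hd hlam; lra.
Qed.

Let W'tI j : Cintegrable half_line (fun x => W' j x * ((tanh x)^-1)%:C).
Proof.
by apply: wker_tanh_integrable => //; have := dj j; move: hab hb ha hd hlam; lra.
Qed.

Local Notation h e j := (hcoef n (alpha + delta + n%:R + 1) e j).

Lemma OC_double :
  Cintegrable setT (OC_integrand alpha beta (Hfun alpha beta delta n.*2) lam) /\
  OC_transform alpha beta (Hfun alpha beta delta n.*2) lam =
  \sum_(0 <= j < n.+1) (h (delta + 1) j)%:C * (2 * Cintegral half_line (W j)).
Proof.
pose E x := \sum_(0 <= j < n.+1) (h (delta + 1) j)%:C * W j x.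
pose O x := \sum_(0 <= j < n.+1) (h (delta + 1) j)%:C *
  (2 * kap * (W' j x * ((tanh x)^-1)%:C)).
have [EI Ei] := Cintegral_lincomb n (fun j => (h (delta + 1) j)%:C) (fun j => (WI j).1).
have OI : Cintegrable half_line O.
  apply: (Cintegral_lincomb n (fun j => (h (delta + 1) j)%:C) _).1 => j.
  by apply: CintegrableZ; [exact: measurable_0y|exact: W'tI].
have f1 x : 0 < x ->
    OC_integrand alpha beta (Hfun alpha beta delta n.*2) lam x = E x - O x.
  move=> x0; rewrite /OC_integrand gtr0_norm// Hfun_double// -mulrA real_complex_sum.
  rewrite mulr_suml -sumrB; apply: eq_bigr => j _.
  have := opdam_termNE beta (delta + 2 * j%:R) lam a1 x0; rewrite -mulrA => e.
  by rewrite real_complexM -mulrA e mulrBr.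
have f2 x : 0 < x ->
    OC_integrand alpha beta (Hfun alpha beta delta n.*2) lam (- x) = E x + O x.
  move=> x0; rewrite /OC_integrand opprK normrN gtr0_norm// Hfun_double//.
  rewrite -mulrA real_complex_sum mulr_suml -big_split/=; apply: eq_bigr => j _.
  have := opdam_termE beta (delta + 2 * j%:R) lam a1 x0; rewrite -mulrA => e.
  by rewrite coshwN real_complexM -mulrA e mulrDr.
have [I1 I2] := Cintegral_line_parts f1 f2 EI OI; split => //.
rewrite /OC_transform I2 Ei mulr_sumr; apply: eq_bigr => j _.
by rewrite mulrCA.
Qed.

(** The factor tanh of the odd functions cancels the 1 / tanh of the shifted kernel, so what
    survives is [wker] at (alpha + 1, beta + 1). *)
Lemma OC_doubleS :
  Cintegrable setT (OC_integrand alpha beta (Hfun alpha beta delta n.*2.+1) lam) /\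
  OC_transform alpha beta (Hfun alpha beta delta n.*2.+1) lam =
  - (2 * kap) *
  \sum_(0 <= j < n.+1) (h delta j)%:C * (2 * Cintegral half_line (W' j)).
Proof.
(* The minus sign comes from evaluating the kernel at - x; the first part of the kernel, times tanh,
   is the odd part [O]. *)
pose E x := \sum_(0 <= j < n.+1) (h delta j)%:C * (- (2 * kap) * W' j x).
pose O x := - \sum_(0 <= j < n.+1) (h delta j)%:C * (W j x * (tanh x)%:C).
have W'kI j : Cintegrable half_line (fun x => - (2 * kap) * W' j x).
  by apply: CintegrableZ; [exact: measurable_0y|exact: (W'I j).1].
have [EI Ei] := Cintegral_lincomb n (fun j => (h delta j)%:C) W'kI.
have OI : Cintegrable half_line O.
  have i : Cintegrable half_line (fun x => -1 *
      \sum_(0 <= j < n.+1) (h delta j)%:C * (W j x * (tanh x)%:C)).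
    apply: CintegrableZ; first exact: measurable_0y.
    apply: (Cintegral_lincomb n (fun j => (h delta j)%:C) _).1 => j.
    exact: tanh_mul_integrable (WI j).1.
  by apply: (Cintegrable_eq measurable_0y _ i) => x _; rewrite /O mulN1r.
have tt x : 0 < x -> ((tanh x)^-1)%:C * (tanh x)%:C = 1.
  by move=> x0; rewrite -rmorphM mulVf ?gt_eqF ?tanh_gt0.
have f1 x : 0 < x ->
    OC_integrand alpha beta (Hfun alpha beta delta n.*2.+1) lam x = E x - O x.
  move=> x0; rewrite /OC_integrand gtr0_norm// Hfun_doubleS// /O opprK.
  rewrite real_complexM -!mulrA real_complex_sum mulr_suml -big_split/=; apply: eq_bigr => j _.
  have := opdam_termNE beta (delta + 2 * j%:R) lam a1 x0; have := tt x x0.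
  rewrite (real_complexM (h delta j)).
  move: (coshw _ _ _ _)%:C (h _ _)%:C (opdam_fun _ _ _ _) => w c G.
  move: (Aweight _ _ _)%:C (tanh x)%:C ((tanh x)^-1)%:C (W j x) (W' j x) => A T U X Y.
  move=> e1 e2.
  transitivity (c * T * (w * G * A)); first by ring.
  rewrite e2; transitivity (c * T * X - 2 * kap * c * Y * (U * T)); first by ring.
  by rewrite e1; ring.
have f2 x : 0 < x ->
    OC_integrand alpha beta (Hfun alpha beta delta n.*2.+1) lam (- x) = E x + O x.
  move=> x0; rewrite /OC_integrand opprK normrN gtr0_norm// Hfun_doubleS// /O.
  rewrite tanhN mulrN real_complexN mulNr mulNr.
  rewrite real_complexM -!mulrA real_complex_sum mulr_suml -!sumrN -big_split/=.
  apply: eq_bigr => j _; rewrite coshwN.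
  have := opdam_termE beta (delta + 2 * j%:R) lam a1 x0; have := tt x x0.
  rewrite (real_complexM (h delta j)).
  move: (coshw _ _ _ _)%:C (h _ _)%:C (opdam_fun _ _ _ _) => w c G.
  move: (Aweight _ _ _)%:C (tanh x)%:C ((tanh x)^-1)%:C (W j x) (W' j x) => A T U X Y.
  move=> e1 e2.
  transitivity (- (c * T * (w * G * A))); first by ring.
  rewrite e2; transitivity (- (c * T * X) - 2 * kap * c * Y * (U * T)); first by ring.
  by rewrite e1; ring.
have [I1 I2] := Cintegral_line_parts f1 f2 EI OI; split => //.
rewrite /OC_transform I2 Ei !mulr_sumr; apply: eq_bigr => j _.
rewrite CintegralZ; [|exact: measurable_0y|exact: (W'I j).1].
by ring.
Qed.

End HalfLineReduction.
End OpdamCherednikIntegral.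

(** * Coefficients and Gamma quotients at shifted weights *)

Section HalfLineGamma.
Context {R : realType}.
Implicit Types (alpha beta delta s N e : R) (lam : R[i]) (n j : nat).

Lemma hcoef_complex n N e j : (hcoef n N e j)%:C =
  (-1) ^+ n / n`!%:R * ((-1) ^+ j * 'C(n, j)%:R * poch N%:C j *
    poch (e%:C + j%:R) (n - j)).
Proof.
have eE : (e + j%:R)%:C = e%:C + j%:R by rewrite rmorphD rmorph_nat.
have sg k : ((-1) ^+ k : R)%:C = (-1) ^+ k by rewrite rmorphXn rmorphN rmorph1.
have nC k : (k%:R : R)%:C = k%:R by rewrite rmorph_nat.
have vC (z : R) : (z^-1)%:C = z%:C^-1 by rewrite fmorphV.
by rewrite /hcoef !real_complexM vC !sg !nC !real_poch eE.
Qed.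

Lemma wker_integral_addn alpha beta s lam j : -1 < alpha ->
  `|complex.Im lam| < s + 1 ->
  0 < alpha - beta + s + 2 -> 0 < alpha + beta + s + 2 ->
  2 * Cintegral `]0, +oo[ (wker alpha beta (s + 2 * j%:R) lam) *
  (Gamma ((alpha - beta + s) / 2 + 1 + j%:R)%:C *
   Gamma ((alpha + beta + s) / 2 + 1 + j%:R)%:C) =
  Gamma (alpha + 1)%:C * Gamma (spP s lam + j%:R) * Gamma (spP s (- lam) + j%:R).
Proof.
move=> a1 hl h1 h2; have j0 : 0 <= 2 * j%:R :> R by rewrite mulr_ge0.
have hl' : `|complex.Im lam| < s + 2 * j%:R + 1 by lra.
have h1' : 0 < alpha - beta + (s + 2 * j%:R) + 2 by lra.
have h2' : 0 < alpha + beta + (s + 2 * j%:R) + 2 by lra.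
have [_ h] := wker_integral a1 hl' h1' h2'; rewrite -!spP_addn -h.
have -> : (alpha - beta + s) / 2 + 1 + j%:R =
    (alpha - beta + (s + 2 * j%:R) + 2) / 2 by field.
have -> : (alpha + beta + s) / 2 + 1 + j%:R =
    (alpha + beta + (s + 2 * j%:R) + 2) / 2 by field.
by rewrite -[in RHS]mulrCA -[in LHS]mulrA.
Qed.

End HalfLineGamma.

(** The bound on Im lam gives absolute convergence, asserted together with each formula. The odd
    formula carries [(-1) ^+ n.+1] rather than (-1)^n, since the odd part of the kernel at - x has
    its sign reversed. *)
Theorem theorem6p3 (R : realType) (alpha beta delta : R)
    (hab : beta <= alpha) (hb : - (1 / 2) <= beta) (ha : - (1 / 2) < alpha)
    (hd : 0 < delta) (n : nat) (lam : R[i])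
    (hlam : `|complex.Im lam| < delta + 1) :
  (Cintegrable setT
     (OC_integrand alpha beta (Hfun alpha beta delta n.*2) lam) /\
   OC_transform alpha beta (Hfun alpha beta delta n.*2) lam =
     (-1) ^+ n / (n`!)%:R *
     (Gamma (alpha + 1)%:C * Gamma ((delta%:C + 1 + 'i * lam) / 2)
        * Gamma ((delta%:C + 1 - 'i * lam) / 2)
      / (Gamma ((alpha + beta + delta) / 2 + n%:R + 1)%:C
         * Gamma ((alpha - beta + delta) / 2 + n%:R + 1)%:C)) *
     wilson n (- (lam ^+ 2 / 4))
       ((delta + 1) / 2)%:C ((delta + 1) / 2)%:C
       ((alpha + beta + 1) / 2)%:C ((alpha - beta + 1) / 2)%:C) /\
  (Cintegrable setT
     (OC_integrand alpha beta (Hfun alpha beta delta n.*2.+1) lam) /\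
   OC_transform alpha beta (Hfun alpha beta delta n.*2.+1) lam =
     (-1) ^+ n.+1 / (n`!)%:R *
     (((rho alpha beta)%:C + 'i * lam) * Gamma (alpha + 1)%:C
        * Gamma ((delta%:C + 1 + 'i * lam) / 2)
        * Gamma ((delta%:C + 1 - 'i * lam) / 2)
      / (2 * Gamma ((alpha + beta + delta) / 2 + n%:R + 2)%:C
         * Gamma ((alpha - beta + delta) / 2 + n%:R + 1)%:C)) *
     wilson n (- (lam ^+ 2 / 4))
       ((delta + 1) / 2)%:C ((delta - 1) / 2)%:C
       ((alpha + beta + 3) / 2)%:C ((alpha - beta + 1) / 2)%:C).
Proof.
have hb2 : - 2^-1 <= beta by lra.
have ha2 : - 2^-1 < alpha by lra.
have a1 : -1 < alpha by lra.
have a1' : -1 < alpha + 1 by lra.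
have hQ : (delta%:C + 1 - 'i * lam) / 2 = spP delta (- lam) by rewrite /spP mulrN.
rewrite -/(spP delta lam) hQ.
set y := (alpha - beta + delta) / 2 + 1.
have y0 : 0 < y by rewrite /y; lra.
have -> : (alpha - beta + delta) / 2 + n%:R + 1 = y + n%:R by rewrite /y; ring.
set N := alpha + delta + n%:R + 1.
split.
  have [h1 h2] := OC_double n hab hb2 ha2 hd hlam; split=> //; rewrite h2.
  set z := (alpha + beta + delta) / 2 + 1.
  have z0 : 0 < z by rewrite /z; lra.
  have -> : (alpha + beta + delta) / 2 + n%:R + 1 = z + n%:R by rewrite /z; ring.
  pose G j := 2 * Cintegral `]0, +oo[ (wker alpha beta (delta + 2 * j%:R) lam).
  have hG j : G j * (Gamma (y + j%:R)%:C * Gamma (z + j%:R)%:C) =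
      Gamma (alpha + 1)%:C * Gamma (spP delta lam + j%:R) *
      Gamma (spP delta (- lam) + j%:R).
    by apply: wker_integral_addn => //; lra.
  have key := gamma_wilson_sum n N%:C (delta + 1)%:C y0 z0 hlam hG.
  (* The sums a + b, a + c, a + d of Wilson parameters are the base [e] of the Jacobi coefficients
     and the unshifted Gamma arguments [z] and [y]. *)
  have ab : ((delta + 1) / 2)%:C + ((delta + 1) / 2)%:C = (delta + 1)%:C.
    by rewrite -rmorphD; congr (_%:C); field.
  have ac : ((delta + 1) / 2)%:C + ((alpha + beta + 1) / 2)%:C = z%:C.
    by rewrite -rmorphD; congr (_%:C); rewrite /z; field.
  have ad : ((delta + 1) / 2)%:C + ((alpha - beta + 1) / 2)%:C = y%:C.
    by rewrite -rmorphD; congr (_%:C); rewrite /y; field.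
  have aN : (delta + 1)%:C + ((alpha + beta + 1) / 2)%:C +
      ((alpha - beta + 1) / 2)%:C + n%:R - 1 = N%:C.
    rewrite -rmorphD -rmorphD -(rmorph_nat (real_complex R)) -rmorphD.
    by rewrite -(rmorph1 (real_complex R)) -rmorphB; congr (_%:C); rewrite /N; field.
  rewrite wilson_sum ?ab ?ac ?ad//; last by rewrite /= addr_gt0.
  rewrite aN -mulrA -key mulr_sumr; apply: eq_bigr => j _.
  by rewrite hcoef_complex -[LHS]mulrA.
have [h1 h2] := OC_doubleS n hab hb2 ha2 hd hlam; split=> //; rewrite h2.
(* Raising alpha and beta by one leaves alpha - beta alone and adds 2 to alpha + beta, so only this
   Gamma argument moves. *)
set z := (alpha + beta + delta) / 2 + 2.
have z0 : 0 < z by rewrite /z; lra.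
have -> : (alpha + beta + delta) / 2 + n%:R + 2 = z + n%:R by rewrite /z; ring.
pose G j := 2 * Cintegral `]0, +oo[
  (wker (alpha + 1) (beta + 1) (delta + 2 * j%:R) lam).
have hG j : G j * (Gamma (y + j%:R)%:C * Gamma (z + j%:R)%:C) =
    Gamma (alpha + 1 + 1)%:C * Gamma (spP delta lam + j%:R) *
    Gamma (spP delta (- lam) + j%:R).
  have -> : y = (alpha + 1 - (beta + 1) + delta) / 2 + 1 by rewrite /y; field.
  have -> : z = (alpha + 1 + (beta + 1) + delta) / 2 + 1 by rewrite /z; field.
  by apply: wker_integral_addn => //; lra.
have key := gamma_wilson_sum n N%:C delta%:C y0 z0 hlam hG.
have ab : ((delta + 1) / 2)%:C + ((delta - 1) / 2)%:C = delta%:C.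
  by rewrite -rmorphD; congr (_%:C); field.
have ac : ((delta + 1) / 2)%:C + ((alpha + beta + 3) / 2)%:C = z%:C.
  by rewrite -rmorphD; congr (_%:C); rewrite /z; field.
have ad : ((delta + 1) / 2)%:C + ((alpha - beta + 1) / 2)%:C = y%:C.
  by rewrite -rmorphD; congr (_%:C); rewrite /y; field.
have aN : delta%:C + ((alpha + beta + 3) / 2)%:C +
    ((alpha - beta + 1) / 2)%:C + n%:R - 1 = N%:C.
  rewrite -rmorphD -rmorphD -(rmorph_nat (real_complex R)) -rmorphD.
  by rewrite -(rmorph1 (real_complex R)) -rmorphB; congr (_%:C); rewrite /N; field.
rewrite wilson_sum ?ab ?ac ?ad// aN.
have eS : \sum_(0 <= j < n.+1) (hcoef n N delta j)%:C * G j =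
    (-1) ^+ n / n`!%:R * \sum_(0 <= j < n.+1) (-1) ^+ j * 'C(n, j)%:R *
      poch N%:C j * poch (delta%:C + j%:R) (n - j) * G j.
  by rewrite mulr_sumr; apply: eq_bigr => j _; rewrite hcoef_complex -[LHS]mulrA.
rewrite -/N eS key.
have c0 : 0 < complex.Re (alpha + 1)%:C by rewrite /=; lra.
(* The factor alpha + 1 released here cancels the one in the denominator of [ockap]. *)
have eG : Gamma (alpha + 1 + 1)%:C = (alpha + 1)%:C * Gamma (alpha + 1)%:C.
  by rewrite rmorphD rmorph1 Gamma_add1.
have eK : ockap alpha beta lam =
    ((rho alpha beta)%:C + 'i * lam) / (4 * (alpha + 1)%:C).
  by rewrite /ockap real_complexM rmorph_nat.
have c1 := Re_gt0_neq0 c0.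
have yn : 0 < y + n%:R by rewrite ltr_wpDr.
have zn : 0 < z + n%:R by rewrite ltr_wpDr.
have gy := Gamma_real_neq0 yn; have gz := Gamma_real_neq0 zn.
have f0 := fact_neq0 R[i] n.
rewrite eG eK exprS; move: gy gz c1 f0.
move: (Gamma (y + n%:R)%:C) (Gamma (z + n%:R)%:C) (alpha + 1)%:C (n`!%:R) => gy gz c f.
move: (\sum_(_ <= _ < _) _) (Gamma (spP _ _)) (Gamma (spP _ _)) (Gamma _) => W p q g.
move: ((rho alpha beta)%:C + 'i * lam) ((-1) ^+ n) => k S gy0 gz0 c0' f0.
by field; rewrite gy0 gz0 c0' f0.
Qed.
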